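(* Let $p>3$ be prime, suppose $1\le\ell\le p-1$, and define $$\mathcal F_1\left(\tfrac\ell p;z\right):=\eta(z)\,\mathcal G_1\left(\tfrac\ell p;z\right).$$ Then for every $A=\begin{pmatrix}a&b\\c&d\end{pmatrix}\in\Gamma_0(p)$, $$\mathcal F_1\left(\tfrac\ell p;z\right)\Big|[A]_1=\mu(A,\ell)\,\mathcal F_1\left(\tfrac{\overline{d\ell}}p;z\right),$$ where $$\mu(A,\ell)=\exp\left(\frac{3\pi i\,c\,d\,\ell^2}{p^2}\right)(-1)^{\frac{c\ell}p}\,(-1)^{\left\lfloor\frac{d\ell}p\right\rfloor}$$ and $\overline m$ denotes the least nonnegative residue of $m$ modulo $p$.
   Context: Notation: $z$ is in the upper half plane, $q=\exp(2\pi iz)$, $(q;q)_\infty=\prod_{n\ge1}(1-q^n)$, $\eta(z)=q^{1/24}(q;q)_\infty$, and for $A=\begin{pmatrix}a&b\\c&d\end{pmatrix}\in \mathrm{SL}_2(\mathbb Z)$, $(F|[A]_k)(z)=(cz+d)^{-k}F\left(\frac{az+b}{cz+d}\right)$. Square roots are principal. For integers $0<\ell<p$, $$\mathcal G_1\left(\tfrac\ell p;z\right)=\mathcal N\left(\tfrac\ell p;z\right)-T_1\left(\tfrac\ell p;z\right),$$ $$\mathcal N\left(\tfrac\ell p;z\right)=\csc\left(\tfrac{\ell\pi}p\right)\frac{q^{-1/24}}{(q;q)_\infty}\left(1+\sum_{n=1}^\infty\frac{(-1)^n(1+q^n)(2-2\cos(2\pi\ell/p))}{1-2\cos(2\pi\ell/p)q^n+q^{2n}}q^{\frac12n(3n+1)}\right),$$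 $$T_1\left(\tfrac\ell p;z\right)=-\frac i{\sqrt3}\int_{-\overline z}^{i\infty}\frac{\Theta_1(\frac\ell p;\tau)}{\sqrt{-i(\tau+z)}}\,d\tau,\qquad \Theta_1\left(\tfrac\ell p;\tau\right)=\sum_{n\in\mathbb Z}(-1)^n(6n+1)\sin\left(\tfrac{\pi\ell(6n+1)}p\right)\exp\left(3\pi i\tau\left(n+\tfrac16\right)^2\right).$$ *)

(* Defs.v *)
From Stdlib Require Import Reals ZArith Znumtheory.
From Coquelicot Require Import Coquelicot.

Open Scope R_scope.

Definition Cexp (w : C) : C :=
  (exp (Re w) * cos (Im w), exp (Re w) * sin (Im w)).

(* Principal branch: argument of the result in (-PI/2, PI/2], so the negative
   real axis is sent to the positive imaginary axis. *)
Definition Csqrt (w : C) : C :=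
  (sqrt ((Cmod w + Re w) / 2),
   (if Rlt_dec (Im w) 0 then -1 else 1) * sqrt ((Cmod w - Re w) / 2)).

(* As with Coquelicot's [Lim_seq] and [Series], the operators below are total;
   they are meaningful when the limit exists in [C]. *)
Definition CLim_seq (u : nat -> C) : C :=
  (real (Lim_seq (fun n => Re (u n))), real (Lim_seq (fun n => Im (u n)))).

Definition CSeries (a : nat -> C) : C := CLim_seq (fun n => sum_n a n).

(* Sum over all of [Z]: nonnegative and negative indices separately. *)
Definition CSeriesZ (a : Z -> C) : C :=
  (CSeries (fun n => a (Z.of_nat n))
   + CSeries (fun n => a (- Z.of_nat n - 1)%Z))%C.

Fixpoint Cprod (f : nat -> C) (n : nat) : C :=
  match n with
  | O => 1%C
  | S m => (Cprod f m * f m)%C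
  end.

(* Integral of [f] from [w0] to i*infinity along the vertical half-line
   { Re w0 + i t | t >= Im w0 }, on which d tau = i dt. *)
Definition Cint_to_ioo (f : C -> C) (w0 : C) : C :=
  @RInt_gen C_R_CompleteNormedModule
    (fun t : R => (Ci * f (Re w0, t))%C)
    (at_point (Im w0)) (Rbar_locally p_infty).

(* [qpow r z] is q^r = exp (2 pi i r z) for a real exponent r; fractional
   powers of q always have this meaning. *)
Definition qpow (r : R) (z : C) : C := Cexp (RtoC (2 * PI * r) * Ci * z)%C.

Definition qq (z : C) : C := qpow 1 z.

Definition qPoch_inf (q : C) : C :=
  CLim_seq (Cprod (fun n => (1 - q ^ (S n))%C)).

Definition eta (z : C) : C := (qpow (1 / 24) z * qPoch_inf (qq z))%C.

Record SL2Z : Set := mkSL2Z {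
  sl_a : Z; sl_b : Z; sl_c : Z; sl_d : Z;
  sl_det : (sl_a * sl_d - sl_b * sl_c = 1)%Z
}.

Definition Gamma0 (N : Z) (A : SL2Z) : Prop := (N | sl_c A)%Z.

(* F |[A]_k, for weights k = 0, 1, 2, ... *)
Definition slash (k : nat) (F : C -> C) (A : SL2Z) (z : C) : C :=
  let a := RtoC (IZR (sl_a A)) in
  let b := RtoC (IZR (sl_b A)) in
  let c := RtoC (IZR (sl_c A)) in
  let d := RtoC (IZR (sl_d A)) in
  (/ (c * z + d) ^ k * F ((a * z + b) / (c * z + d)))%C.

Definition ratio (l p : Z) : R := IZR l / IZR p.

(* The n-th term of the series; n (3n+1) is even, so [Nat.div] is exact. *)
Definition NN_term (l p : Z) (q : C) (n : nat) : C :=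
  let x := 2 * cos (2 * PI * ratio l p) in
  (RtoC ((-1) ^ n) * (1 + q ^ n) * (2 - RtoC x)
   / (1 - RtoC x * q ^ n + q ^ (2 * n))
   * q ^ (n * (3 * n + 1) / 2)%nat)%C.

Definition NN (l p : Z) (z : C) : C :=
  let q := qq z in
  (RtoC (/ sin (ratio l p * PI))
   * (qpow (- (1 / 24)) z / qPoch_inf q)
   * (1 + CSeries (fun n => NN_term l p q (S n))))%C.

Definition Theta1 (l p : Z) (tau : C) : C :=
  CSeriesZ (fun n =>
    (RtoC (powerRZ (-1) n * IZR (6 * n + 1)
           * sin (PI * IZR l * IZR (6 * n + 1) / IZR p))
     * Cexp (3 * RtoC PI * Ci * tau * RtoC ((IZR n + 1 / 6) ^ 2)))%C).

Definition T1 (l p : Z) (z : C) : C :=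
  (- (Ci / RtoC (sqrt 3))
   * Cint_to_ioo
       (fun tau => Theta1 l p tau / Csqrt (- Ci * (tau + z)))
       (- Cconj z))%C.

Definition GG1 (l p : Z) (z : C) : C := (NN l p z - T1 l p z)%C.

Definition FF1 (l p : Z) (z : C) : C := (eta z * GG1 l p z)%C.

(* When p > 0 divides c, both [Z.div] below are what is meant: c l / p is an
   exact quotient and d l / p is rounded towards minus infinity. *)
Definition mu (p : Z) (A : SL2Z) (l : Z) : C :=
  let c := sl_c A in
  let d := sl_d A in
  (Cexp (RtoC (3 * PI) * Ci * RtoC (IZR c * IZR d * IZR l ^ 2 / IZR p ^ 2))
   * RtoC (powerRZ (-1) (c * l / p))
   * RtoC (powerRZ (-1) (d * l / p)))%C.

(* Main.v *)
Require Import Defs.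
From Stdlib Require Import Reals ZArith Znumtheory.
From Coquelicot Require Import Coquelicot.
From Stdlib Require Import Lra Lia List Permutation Classical ClassicalEpsilon.
Import ListNotations.
Open Scope R_scope.

(** Let [alpha = l / p], [y = Im z], and for integers [m, n] let [w = m z + alpha + n]. The
    function in question turns out to be an absolutely convergent Eisenstein-like lattice sum,

      [PI FF1 (l, z) = sum_(m, n) (-1)^(mn + m + n) e^(- 3 PI i alpha m)
                         e^(- (3 PI / 2) |w|^2 / y) / w],

    and this sum is visibly modular of weight 1. Replacing [z] by its image under a matrix of
    determinant 1 with lower row [(c, d)] leaves [|w|^2 / y] unchanged, divides [w] by
    [c z + d], and permutes the lattice linearly; the point [alpha] is moved to
    [alpha (c z + d)]. When [p] divides [c], this is [beta = (d l mod p) / p] up to the lattice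
    vector with coordinates [c l / p] and [floor (d l / p)]. Shifting the indices by that vector
    changes the quadratic sign and the phase [e^(- 3 PI i alpha m)] by the constant [mu]. This is
    the content of [lterm_modular] and [Psi_modular].

    To establish the lattice sum, interpolate. For a real [s > y / 3] put

      [Psi s = sum_(m, n) (-1)^(m + n) q^(3 m^2 / 2) e^(- PI w^2 / s) / w].

    At [s = 2 y / 3] the Gaussian in [w] and the power of [q] combine to the sum above
    ([lterm_invariant]), while the two halves of [FF1] come from the rest of the half-line:

    - As [s] tends to infinity the Gaussian tends to 1, the row of index [m] becomes the partial
      fraction expansion of [PI / sin (PI (m z + alpha))] ([csc_partial_fractions]), and the sum
      over [m] becomes [PI eta NN], since the series defining [NN] is a sum of cosecants over
      [m] and [- m] paired ([eta_NN], [Psi_limit]).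

    - The derivative in [s] loses the denominator [w] and is a theta series. Inverting it along
      each row ([theta_transform]) gives an index [k] in [Z + 1/2] dual to [n], and completing
      the square separates the sum over [m], which is a theta series of characteristic [k / 3].
      By the pentagonal number theorem it is [eta] up to sign when [k / 3] is [1/6] or [- 1/6]
      modulo 1, and it vanishes when [k / 3] is [1/2]. What remains is
      [PI eta Theta1 / sqrt s] on the half-line where [Theta1] is integrated ([dPsi_Theta1]), so
      that the integral defining [T1] is the difference between the limit and the endpoint value
      of [Psi] ([eta_T1]). The limit cancels in [NN - T1], and [FF1_Psi] follows.

    The classical expansions used here are limits of finite identities. The cosecant expansion
    comes from the iterated triplication formula for [1 / sin], and the theta inversion from
    Fourier inversion on [Z / N] for [sin cos^(2M)], with [M] of the order of [N^2], both by
    dominated convergence ([has_sum_lim]); the pentagonal number theorem comes from an identity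
    of Shanks with an explicit error. *)

(** * Unordered summation *)

Fixpoint csum {I : Type} (f : I -> C) (L : list I) : C :=
  match L with nil => 0%C | i :: L' => (f i + csum f L')%C end.

Fixpoint rsum {I : Type} (g : I -> R) (L : list I) : R :=
  match L with nil => 0 | i :: L' => g i + rsum g L' end.

(** Unconditional convergence, over an index type without any order: the finite index sets are
    duplicate-free lists. Reindexing by an arbitrary bijection then costs nothing, which is what
    the action of a modular matrix on a lattice calls for. *)
Definition has_sum {I : Type} (f : I -> C) (s : C) : Prop :=
  forall eps, 0 < eps -> exists L0, forall L, NoDup L -> incl L0 L ->
    Cmod (csum f L - s) < eps.

Definition summable {I : Type} (g : I -> R) : Prop :=
  (forall i, 0 <= g i) /\ exists B, forall L, NoDup L -> rsum g L <= B.

(** Convergence of complex quantities along a filter, in terms of the modulus alone, so that it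
    combines directly with the estimates on [Cmod]. *)
Definition Clim {T : Type} (F : (T -> Prop) -> Prop) (u : T -> C) (l : C) :=
  forall eps, 0 < eps -> F (fun x => Cmod (u x - l) < eps).

Definition eqdec {I : Type} (x y : I) : {x = y} + {x <> y} :=
  excluded_middle_informative (x = y).

Lemma csum_app {I} (f : I -> C) L K : csum f (L ++ K) = (csum f L + csum f K)%C.
Proof. induction L as [|i L IH]; simpl; [|rewrite IH]; ring. Qed.

Lemma rsum_app {I} (f : I -> R) L K : rsum f (L ++ K) = rsum f L + rsum f K.
Proof. induction L as [|i L IH]; simpl; [|rewrite IH]; ring. Qed.

Lemma csum_perm {I} (f : I -> C) L K : Permutation L K -> csum f L = csum f K.
Proof. induction 1; simpl; try congruence; try ring. Qed.

Lemma rsum_perm {I} (f : I -> R) L K : Permutation L K -> rsum f L = rsum f K.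
Proof. induction 1; simpl; try congruence; try ring. Qed.

Lemma csum_map {I J} (f : I -> C) (phi : J -> I) L :
  csum f (map phi L) = csum (fun j => f (phi j)) L.
Proof. induction L as [|i L IH]; simpl; [|rewrite IH]; ring. Qed.

Lemma rsum_map {I J} (f : I -> R) (phi : J -> I) L :
  rsum f (map phi L) = rsum (fun j => f (phi j)) L.
Proof. induction L as [|i L IH]; simpl; [|rewrite IH]; ring. Qed.

Lemma csum_ext {I} (f g : I -> C) L :
  (forall i, In i L -> f i = g i) -> csum f L = csum g L.
Proof.
  induction L as [|i L IH]; simpl; intros H; [easy|].
  rewrite IH, (H i); auto.
Qed.

Lemma csum_plus {I} (f g : I -> C) L :
  csum (fun i => f i + g i)%C L = (csum f L + csum g L)%C.
Proof. induction L as [|i L IH]; simpl; [|rewrite IH]; ring. Qed.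

Lemma csum_scal {I} (c : C) (f : I -> C) L :
  csum (fun i => c * f i)%C L = (c * csum f L)%C.
Proof. induction L as [|i L IH]; simpl; [|rewrite IH]; ring. Qed.

Lemma rsum_scal {I} (c : R) (f : I -> R) L :
  rsum (fun i => c * f i) L = c * rsum f L.
Proof. induction L as [|i L IH]; simpl; [|rewrite IH]; ring. Qed.

Lemma csum_RtoC {I} (g : I -> R) L : csum (fun i => RtoC (g i)) L = RtoC (rsum g L).
Proof. induction L as [|i L IH]; simpl; [easy|]. now rewrite IH, RtoC_plus. Qed.

Lemma rsum_nonneg {I} (g : I -> R) L : (forall i, 0 <= g i) -> 0 <= rsum g L.
Proof.
  intros H; induction L as [|i L IH]; simpl; [lra|]. specialize (H i); lra.
Qed.

Lemma rsum_le {I} (f g : I -> R) L : (forall i, f i <= g i) -> rsum f L <= rsum g L.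
Proof.
  intros H; induction L as [|i L IH]; simpl; [lra|]. specialize (H i); lra.
Qed.

Lemma csum_Cmod {I} (f : I -> C) (g : I -> R) L :
  (forall i, Cmod (f i) <= g i) -> Cmod (csum f L) <= rsum g L.
Proof.
  intros H; induction L as [|i L IH]; simpl; [rewrite Cmod_0; lra|].
  eapply Rle_trans; [apply Cmod_triangle|]. specialize (H i); lra.
Qed.

Lemma NoDup_app_disjoint {I} (K D : list I) :
  NoDup K -> NoDup D -> (forall x, In x D -> ~ In x K) -> NoDup (K ++ D).
Proof.
  intros HK HD H; induction HK as [|x K Hx HK IH]; simpl; auto.
  constructor.
  - rewrite in_app_iff; intros [?|?]; [tauto|]. now apply (H x); [|left].
  - apply IH. intros y Hy Hy'. now apply (H y); [|right].
Qed.

Lemma incl_decompose {I} (K L : list I) :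
  NoDup K -> NoDup L -> incl K L ->
  exists D, Permutation L (K ++ D) /\ NoDup D /\ (forall x, In x D -> ~ In x K).
Proof.
  intros HK HL HKL.
  exists (filter (fun x => if in_dec eqdec x K then false else true) L).
  assert (Hd : forall x, In x (filter (fun x => if in_dec eqdec x K then false else true) L)
               -> ~ In x K).
  { intros x Hx. apply filter_In in Hx. destruct (in_dec eqdec x K); tauto || easy. }
  split; [|split]; auto using NoDup_filter.
  apply NoDup_Permutation; auto.
  - apply NoDup_app_disjoint; auto using NoDup_filter.
  - intros x; rewrite in_app_iff, filter_In.
    destruct (in_dec eqdec x K) as [i|i]; split; try tauto.
    intros [?|[? ?]]; [auto|easy].
Qed.

Lemma rsum_incl {I} (g : I -> R) K L :
  (forall i, 0 <= g i) -> NoDup K -> NoDup L -> incl K L -> rsum g K <= rsum g L.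
Proof.
  intros Hg HK HL H. destruct (incl_decompose K L HK HL H) as (D & P & _).
  rewrite (rsum_perm _ _ _ P), rsum_app. pose proof (rsum_nonneg g D Hg). lra.
Qed.

Lemma has_sum_nodup {I} (f : I -> C) s :
  has_sum f s -> forall eps, 0 < eps -> exists L0, NoDup L0 /\
    forall L, NoDup L -> incl L0 L -> Cmod (csum f L - s) < eps.
Proof.
  intros H eps He. destruct (H eps He) as [L0 HL0].
  exists (nodup eqdec L0). split; [apply NoDup_nodup|].
  intros L HL Hi. apply HL0; auto. intros x Hx. apply Hi. now apply nodup_In.
Qed.

Lemma has_sum_unique {I} (f : I -> C) s t : has_sum f s -> has_sum f t -> s = t.
Proof.
  intros Hs Ht. apply NNPP; intros Hne.
  assert (Hp : 0 < Cmod (s - t)).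
  { apply Cmod_gt_0. intros H0. apply Hne.
    replace s with (s - t + t)%C by ring. rewrite H0; ring. }
  destruct (Hs (Cmod (s - t) / 2)) as [L1 H1]; [lra|].
  destruct (Ht (Cmod (s - t) / 2)) as [L2 H2]; [lra|].
  set (L := nodup eqdec (L1 ++ L2)).
  assert (HL : NoDup L) by apply NoDup_nodup.
  assert (I1 : incl L1 L) by (intros x Hx; apply nodup_In, in_app_iff; auto).
  assert (I2 : incl L2 L) by (intros x Hx; apply nodup_In, in_app_iff; auto).
  specialize (H1 L HL I1). specialize (H2 L HL I2).
  assert (Cmod (s - t) <= Cmod (csum f L - s) + Cmod (csum f L - t)).
  { replace (s - t)%C with (- (csum f L - s) + (csum f L - t))%C by ring.
    eapply Rle_trans; [apply Cmod_triangle|]. rewrite Cmod_opp; lra. }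
  lra.
Qed.

Lemma has_sum_ext {I} (f g : I -> C) s :
  (forall i, f i = g i) -> has_sum f s -> has_sum g s.
Proof.
  intros H Hf eps He. destruct (Hf eps He) as [L0 HL]. exists L0.
  intros L H1 H2. rewrite <- (csum_ext f g); auto.
Qed.

Lemma has_sum_plus {I} (f g : I -> C) s t :
  has_sum f s -> has_sum g t -> has_sum (fun i => f i + g i)%C (s + t)%C.
Proof.
  intros Hs Ht eps He.
  destruct (Hs (eps / 2)) as [L1 H1]; [lra|].
  destruct (Ht (eps / 2)) as [L2 H2]; [lra|].
  exists (L1 ++ L2). intros L HL Hi.
  specialize (H1 L HL (fun x Hx => Hi x (proj2 (in_app_iff _ _ _) (or_introl Hx)))).
  specialize (H2 L HL (fun x Hx => Hi x (proj2 (in_app_iff _ _ _) (or_intror Hx)))).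
  rewrite csum_plus.
  replace (csum f L + csum g L - (s + t))%C
    with ((csum f L - s) + (csum g L - t))%C by ring.
  eapply Rle_lt_trans; [apply Cmod_triangle|]. lra.
Qed.

Lemma has_sum_scal {I} (c : C) (f : I -> C) s :
  has_sum f s -> has_sum (fun i => c * f i)%C (c * s)%C.
Proof.
  intros Hs eps He. pose proof (Cmod_ge_0 c) as Hc.
  destruct (Hs (eps / (Cmod c + 1))) as [L1 H1].
  { apply Rdiv_lt_0_compat; lra. }
  exists L1. intros L HL Hi. specialize (H1 L HL Hi).
  rewrite csum_scal. replace (c * csum f L - c * s)%C with (c * (csum f L - s))%C by ring.
  rewrite Cmod_mult. apply Rmult_lt_compat_r with (r := Cmod c + 1) in H1; [|lra].
  replace (eps / (Cmod c + 1) * (Cmod c + 1)) with eps in H1 by (field; lra).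
  pose proof (Cmod_ge_0 (csum f L - s)). nra.
Qed.

Lemma has_sum_minus {I} (f g : I -> C) s t :
  has_sum f s -> has_sum g t -> has_sum (fun i => f i - g i)%C (s - t)%C.
Proof.
  intros Hs Ht. replace (s - t)%C with (s + (-(1)) * t)%C by ring.
  eapply has_sum_ext; [|apply has_sum_plus; [exact Hs|apply has_sum_scal; exact Ht]].
  intros i; simpl; ring.
Qed.

Lemma has_sum_bij {I J} (phi : J -> I) (psi : I -> J) (f : I -> C) s :
  (forall i, phi (psi i) = i) -> (forall j, psi (phi j) = j) ->
  has_sum f s -> has_sum (fun j => f (phi j)) s.
Proof.
  intros H1 H2 Hs eps He. destruct (Hs eps He) as [L0 HL0].
  exists (map psi L0). intros L HL Hi. rewrite <- csum_map. apply HL0.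
  - apply FinFun.Injective_map_NoDup; auto.
    intros a b Hab. rewrite <- (H2 a), <- (H2 b). now rewrite Hab.
  - intros x Hx. rewrite <- (H1 x). apply in_map, Hi, in_map, Hx.
Qed.

Lemma has_sum_finite {I} (f : I -> C) (L : list I) :
  NoDup L -> (forall i, ~ In i L -> f i = 0%C) -> has_sum f (csum f L).
Proof.
  intros HL Hf eps He. exists L. intros L' HL' Hi.
  destruct (incl_decompose L L' HL HL' Hi) as (D & P & _ & HD).
  rewrite (csum_perm _ _ _ P), csum_app.
  rewrite (csum_ext f (fun _ => 0%C * 0%C)%C D).
  2:{ intros i Hin. rewrite Hf; auto; ring. }
  rewrite csum_scal.
  match goal with |- Cmod ?x < _ => replace x with (RtoC 0) by ring end.
  rewrite Cmod_0; lra.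
Qed.

Lemma has_sum_csum {I J} (f : J -> I -> C) (S : J -> C) (L : list J) :
  (forall j, has_sum (f j) (S j)) ->
  has_sum (fun i => csum (fun j => f j i) L) (csum S L).
Proof.
  intros H. induction L as [|j L IH]; simpl.
  - apply (has_sum_finite (fun _ : I => 0%C) nil); [constructor|auto].
  - apply has_sum_plus; auto.
Qed.

Lemma has_sum_inj {I J} (phi : J -> I) (f : I -> C) s :
  (forall a b, phi a = phi b -> a = b) ->
  (forall i, (forall j, phi j <> i) -> f i = 0%C) ->
  has_sum f s -> has_sum (fun j => f (phi j)) s.
Proof.
  intros Hinj Hz Hs eps He. destruct (has_sum_nodup f s Hs eps He) as (L0 & N0 & HL0).
  assert (Hpre : exists K : list J, forall j, In (phi j) L0 -> In j K).
  { clear - Hinj. induction L0 as [|i L0 [K HK]]; [now exists nil|].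
    destruct (classic (exists j, phi j = i)) as [[j Hj]|Hn].
    - exists (j :: K). intros j' [Hj'|Hj']; [left|right; auto].
      apply Hinj. congruence.
    - exists K. intros j' [Hj'|Hj']; [|auto]. exfalso; apply Hn; exists j'; auto. }
  destruct Hpre as [K HK]. exists K. intros L HL Hi.
  rewrite <- csum_map. set (M := map phi L).
  assert (HM : NoDup M).
  { apply FinFun.Injective_map_NoDup; auto. }
  set (U := nodup eqdec (M ++ L0)).
  assert (HU : NoDup U) by apply NoDup_nodup.
  assert (IU : incl M U) by (intros x Hx; apply nodup_In, in_app_iff; auto).
  assert (I0 : incl L0 U) by (intros x Hx; apply nodup_In, in_app_iff; auto).
  destruct (incl_decompose M U HM HU IU) as (D & P & _ & HD).
  replace (csum f M) with (csum f U); [now apply HL0|].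
  rewrite (csum_perm _ _ _ P), csum_app.
  rewrite (csum_ext f (fun _ => 0%C * 0%C)%C D).
  { rewrite csum_scal; ring. }
  intros i Hin. rewrite Hz; [ring|]. intros j Hj.
  assert (HiU : In i U) by (apply (Permutation_in _ (Permutation_sym P)), in_app_iff; auto).
  apply nodup_In, in_app_iff in HiU. destruct HiU as [HiM|Hi0]; [now apply (HD i)|].
  apply (HD i Hin). rewrite <- Hj. apply in_map, Hi, HK. now rewrite Hj.
Qed.

Lemma has_sum_exhaust {I} (f : I -> C) s (Ls : nat -> list I) :
  has_sum f s -> (forall n, NoDup (Ls n)) ->
  (forall i, eventually (fun n => In i (Ls n))) ->
  Clim eventually (fun n => csum f (Ls n)) s.
Proof.
  intros Hs Hnd Hex eps He. destruct (Hs eps He) as [L0 HL0].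
  assert (H : eventually (fun n => incl L0 (Ls n))).
  { clear - Hex. induction L0 as [|i L0 IH].
    - exists 0%nat. intros n _ x [].
    - generalize (filter_and _ _ (Hex i) IH). apply filter_imp.
      intros n [H1 H2] x [<-|Hx]; auto. }
  revert H. apply filter_imp. intros n Hn. now apply HL0.
Qed.

(** ** Absolute summability *)

Lemma summable_tail {I} (g : I -> R) : summable g ->
  forall eps, 0 < eps -> exists L0, NoDup L0 /\
    forall D, NoDup D -> (forall x, In x D -> ~ In x L0) -> rsum g D < eps.
Proof.
  intros [Hg [B HB]] eps He.
  destruct (completeness (fun x => exists L, NoDup L /\ x = rsum g L)) as [S [HS1 HS2]].
  - exists B. intros x (L & HL & ->). auto.
  - exists 0, nil. split; [constructor|easy].
  - assert (Hex : exists L0, NoDup L0 /\ S - eps < rsum g L0).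
    { apply NNPP; intros Hn. assert (S <= S - eps); [|lra]. apply HS2.
      intros x (L & HL & ->). apply Rnot_lt_le. intros Hlt. apply Hn; eauto. }
    destruct Hex as (L0 & N0 & H0). exists L0; split; auto.
    intros D HD Hdis.
    assert (rsum g (L0 ++ D) <= S).
    { apply HS1. exists (L0 ++ D); split; auto. now apply NoDup_app_disjoint. }
    rewrite rsum_app in H. lra.
Qed.

Lemma summable_has_sum_R {I} (g : I -> R) : summable g ->
  exists S, has_sum (fun i => RtoC (g i)) (RtoC S).
Proof.
  intros Hsg. pose proof Hsg as [Hg [B HB]].
  destruct (completeness (fun x => exists L, NoDup L /\ x = rsum g L)) as [S [HS1 HS2]].
  - exists B. intros x (L & HL & ->). auto.
  - exists 0, nil. split; [constructor|easy].
  - exists S. intros eps He.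
    assert (Hex : exists L0, NoDup L0 /\ S - eps < rsum g L0).
    { apply NNPP; intros Hn. assert (S <= S - eps); [|lra]. apply HS2.
      intros x (L & HL & ->). apply Rnot_lt_le. intros Hlt. apply Hn; eauto. }
    destruct Hex as (L0 & N0 & H0). exists L0.
    intros L HL Hi. rewrite csum_RtoC, <- RtoC_minus, Cmod_R.
    assert (rsum g L <= S) by (apply HS1; eauto).
    pose proof (rsum_incl g L0 L Hg N0 HL Hi).
    apply Rabs_def1; lra.
Qed.

Lemma summable_le {I} (f g : I -> R) :
  summable g -> (forall i, 0 <= f i <= g i) -> summable f.
Proof.
  intros [Hg [B HB]] H. split; [intros; apply H|]. exists B. intros L HL.
  eapply Rle_trans; [|apply HB, HL]. apply rsum_le. intros; apply H.
Qed.

Lemma summable_scal {I} c (g : I -> R) :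
  0 <= c -> summable g -> summable (fun i => c * g i).
Proof.
  intros Hc [Hg [B HB]]. split.
  - intros i. specialize (Hg i). nra.
  - exists (c * B). intros L HL. rewrite rsum_scal. specialize (HB L HL). nra.
Qed.

Lemma summable_inj {I J} (phi : J -> I) (g : I -> R) :
  (forall a b, phi a = phi b -> a = b) -> summable g -> summable (fun j => g (phi j)).
Proof.
  intros Hinj [Hg [B HB]]. split; [auto|]. exists B. intros L HL.
  rewrite <- rsum_map. apply HB. apply FinFun.Injective_map_NoDup; auto.
Qed.

(** A real family bounded by [g] is the difference of [f + g] and [g], both nonnegative;
    this reduces absolute summability of complex families to nonnegative ones. *)
Lemma summable_has_sum {I} (f : I -> C) (g : I -> R) :
  summable g -> (forall i, Cmod (f i) <= g i) -> exists s, has_sum f s.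
Proof.
  intros Hg Hf.
  assert (Hreal : forall u : I -> R, (forall i, Rabs (u i) <= g i) ->
            exists S, has_sum (fun i => RtoC (u i)) S).
  { intros u Hu.
    destruct (summable_has_sum_R g Hg) as [S1 H1].
    destruct (summable_has_sum_R (fun i => u i + g i)) as [S2 H2].
    { apply summable_le with (fun i => 2 * g i); [apply summable_scal; [lra|auto]|].
      intros i. specialize (Hu i). apply Rabs_le_between in Hu. lra. }
    exists (RtoC S2 - RtoC S1)%C.
    eapply has_sum_ext; [|apply has_sum_minus; [exact H2|exact H1]].
    intros i; simpl. rewrite <- RtoC_minus. f_equal. ring. }
  destruct (Hreal (fun i => Re (f i))) as [S1 H1].
  { intros i. eapply Rle_trans; [apply re_le_Cmod|apply Hf]. }
  destruct (Hreal (fun i => Im (f i))) as [S2 H2].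
  { intros i. eapply Rle_trans; [|apply Hf].
    eapply Rle_trans; [apply Rmax_r|apply Rmax_Cmod]. }
  exists (S1 + Ci * S2)%C.
  eapply has_sum_ext; [|apply has_sum_plus; [exact H1|apply has_sum_scal; exact H2]].
  intros i; simpl. destruct (f i) as [a b]. unfold RtoC, Ci, Cplus, Cmult, Re, Im; simpl.
  f_equal; ring.
Qed.

Lemma csum_sub_tail {I} (f : I -> C) (g : I -> R) s L0 eps :
  has_sum f s -> (forall i, Cmod (f i) <= g i) -> NoDup L0 ->
  (forall D, NoDup D -> (forall x, In x D -> ~ In x L0) -> rsum g D < eps) ->
  Cmod (s - csum f L0) <= eps.
Proof.
  intros Hs Hf N0 HD. apply le_epsilon. intros e He.
  destruct (has_sum_nodup f s Hs e He) as (L1 & N1 & H1).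
  set (L := nodup eqdec (L0 ++ L1)).
  assert (HL : NoDup L) by apply NoDup_nodup.
  assert (I0 : incl L0 L) by (intros x Hx; apply nodup_In, in_app_iff; auto).
  assert (I1 : incl L1 L) by (intros x Hx; apply nodup_In, in_app_iff; auto).
  specialize (H1 L HL I1).
  destruct (incl_decompose L0 L N0 HL I0) as (D & P & ND & HDd).
  rewrite (csum_perm _ _ _ P), csum_app in H1.
  specialize (HD D ND HDd).
  pose proof (csum_Cmod f g D Hf).
  replace (s - csum f L0)%C
    with (- (csum f L0 + csum f D - s) + csum f D)%C by ring.
  eapply Rle_trans; [apply Cmod_triangle|]. rewrite Cmod_opp. lra.
Qed.

Lemma Clim_csum {T I} (F : (T -> Prop) -> Prop) {FF : Filter F} (f : T -> I -> C) f0 L :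
  (forall i, Clim F (fun x => f x i) (f0 i)) ->
  Clim F (fun x => csum (f x) L) (csum f0 L).
Proof.
  intros H. induction L as [|i L IH]; simpl.
  - intros eps He. apply filter_forall. intros _.
    replace (0 - 0)%C with (RtoC 0) by ring. rewrite Cmod_0; lra.
  - intros eps He. generalize (filter_and (F := F) _ _ (H i (eps / 2) ltac:(lra)) (IH (eps / 2) ltac:(lra))).
    apply filter_imp. intros x [H1 H2].
    replace (f x i + csum (f x) L - (f0 i + csum f0 L))%C
      with ((f x i - f0 i) + (csum (f x) L - csum f0 L))%C by ring.
    eapply Rle_lt_trans; [apply Cmod_triangle|]. lra.
Qed.

Lemma Clim_bound {T} (F : (T -> Prop) -> Prop) {FF : ProperFilter F} (u : T -> C) l B :
  F (fun x => Cmod (u x) <= B) -> Clim F u l -> Cmod l <= B.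
Proof.
  intros HB Hl. apply le_epsilon. intros e He.
  destruct (filter_ex (F := F) _ (filter_and (F := F) _ _ HB (Hl e He))) as [x [H1 H2]].
  replace l with (- (u x - l) + u x)%C by ring.
  eapply Rle_trans; [apply Cmod_triangle|]. rewrite Cmod_opp. lra.
Qed.

(** Tannery's theorem, the dominated convergence theorem for sums. The filter
    is arbitrary because it serves for sequences of finite identities, for difference quotients
    and for a real parameter tending to infinity. *)
Lemma has_sum_lim {T I} (F : (T -> Prop) -> Prop) {FF : ProperFilter F}
  (f : T -> I -> C) (f0 : I -> C) (g : I -> R) (S : T -> C) (S0 : C) :
  summable g -> F (fun x => forall i, Cmod (f x i) <= g i) ->
  (forall i, Clim F (fun x => f x i) (f0 i)) ->
  F (fun x => has_sum (f x) (S x)) -> has_sum f0 S0 ->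
  Clim F S S0.
Proof.
  intros Hg Hb Hl HS H0 eps He.
  destruct (summable_tail g Hg (eps / 4)) as (L0 & N0 & HL0); [lra|].
  assert (Hb0 : forall i, Cmod (f0 i) <= g i).
  { intros i. apply (Clim_bound F (fun x => f x i)); auto.
    revert Hb; apply filter_imp; auto. }
  pose proof (csum_sub_tail f0 g S0 L0 _ H0 Hb0 N0 HL0) as H1.
  generalize (filter_and (F := F) _ _ (filter_and (F := F) _ _ Hb HS)
    (Clim_csum F f f0 L0 Hl (eps / 4) ltac:(lra))).
  apply filter_imp. intros x [[Hx1 Hx2] Hx3].
  pose proof (csum_sub_tail (f x) g (S x) L0 _ Hx2 Hx1 N0 HL0) as H2.
  replace (S x - S0)%C with ((S x - csum (f x) L0) + ((csum (f x) L0 - csum f0 L0)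
     + - (S0 - csum f0 L0)))%C by ring.
  eapply Rle_lt_trans; [apply Cmod_triangle|].
  eapply Rle_lt_trans; [apply Rplus_le_compat_l, Cmod_triangle|].
  rewrite Cmod_opp. lra.
Qed.

(** ** Products and iterated sums *)

Lemma rsum_list_prod {I J} (a : I -> R) (b : J -> R) K L :
  rsum (fun p => a (fst p) * b (snd p)) (list_prod K L) = rsum a K * rsum b L.
Proof.
  induction K as [|i K IH]; simpl; [ring|].
  rewrite rsum_app, IH, rsum_map. simpl. rewrite (rsum_scal (a i) b). ring.
Qed.

Lemma NoDup_list_prod {I J} (K : list I) (L : list J) :
  NoDup K -> NoDup L -> NoDup (list_prod K L).
Proof.
  intros HK HL; induction HK as [|i K Hi HK IH]; simpl; [constructor|].
  apply NoDup_app_disjoint; auto.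
  - apply FinFun.Injective_map_NoDup; auto. intros x y; congruence.
  - intros [x y] Hxy Hin. apply in_map_iff in Hin. destruct Hin as (b & Hb & _).
    apply in_prod_iff in Hxy. apply Hi. injection Hb as -> ->. tauto.
Qed.

Lemma summable_prod {I J} (a : I -> R) (b : J -> R) :
  summable a -> summable b -> summable (fun p : I * J => a (fst p) * b (snd p)).
Proof.
  intros [Ha [A HA]] [Hb [B HB]].
  assert (Hn : forall p : I * J, 0 <= a (fst p) * b (snd p)).
  { intros p. specialize (Ha (fst p)); specialize (Hb (snd p)); nra. }
  split; auto. exists (A * B). intros L HL.
  set (K1 := nodup eqdec (map fst L)). set (K2 := nodup eqdec (map snd L)).
  eapply Rle_trans.
  - apply (rsum_incl _ L (list_prod K1 K2)); auto.
    + apply NoDup_list_prod; apply NoDup_nodup.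
    + intros [x y] Hxy. apply in_prod; apply nodup_In.
      * now apply (in_map fst L (x, y)).
      * now apply (in_map snd L (x, y)).
  - rewrite rsum_list_prod.
    pose proof (HA K1 (NoDup_nodup _ _)). pose proof (HB K2 (NoDup_nodup _ _)).
    pose proof (rsum_nonneg a K1 Ha). pose proof (rsum_nonneg b K2 Hb).
    apply Rmult_le_compat; auto.
Qed.

(** Over a finite set of rows containing the relevant indices, each row is replaced by a
    finite part close to its sum; their union is a finite part of the double family. *)
Lemma has_sum_fubini {A B} (f : A * B -> C) (r : A -> C) s :
  has_sum f s -> (forall a, has_sum (fun b => f (a, b)) (r a)) -> has_sum r s.
Proof.
  intros Hs Hr eps He.
  destruct (Hs (eps / 2)) as [L0 HL0]; [lra|].
  exists (map fst L0). intros K HK Hi.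
  set (d := eps / 2 / (INR (length K) + 1)).
  assert (Hlen : 0 < INR (length K) + 1) by (pose proof (pos_INR (length K)); lra).
  assert (Hd : 0 < d) by (apply Rdiv_lt_0_compat; lra).
  assert (Hex : forall K', NoDup K' -> exists U : list (A * B), NoDup U /\
     (forall a b, In (a, b) U -> In a K') /\
     (forall a b, In a K' -> In (a, b) L0 -> In (a, b) U) /\
     Cmod (csum f U - csum r K') <= INR (length K') * d).
  { induction 1 as [|a K' Ha HK' (U & U1 & U2 & U3 & U4)].
    - exists nil. split; [constructor|]. split; [easy|]. split; [easy|].
      replace (csum f nil - csum r nil)%C with (RtoC 0) by (simpl; ring).
      rewrite Cmod_0. simpl. lra.
    - destruct (Hr a d Hd) as [M HM].
      set (M' := nodup eqdec (M ++ map snd L0)).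
      assert (NM : NoDup M') by apply NoDup_nodup.
      specialize (HM M' NM).
      assert (IM : incl M M') by (intros x Hx; apply nodup_In, in_app_iff; auto).
      specialize (HM IM).
      exists (map (fun b => (a, b)) M' ++ U). repeat split.
      + apply NoDup_app_disjoint; auto.
        * apply FinFun.Injective_map_NoDup; auto. intros x y; congruence.
        * intros [x y] Hxy Hin. apply in_map_iff in Hin.
          destruct Hin as (b & Hb & _). injection Hb as <- <-.
          now apply Ha, (U2 a b).
      + intros x y Hin. apply in_app_iff in Hin. destruct Hin as [Hin|Hin].
        * apply in_map_iff in Hin. destruct Hin as (b & Hb & _).
          left; congruence.
        * right; now apply (U2 x y).
      + intros x y [<-|Hx] Hxy; apply in_app_iff.
        * left. apply in_map_iff. exists y; split; auto.
          apply nodup_In, in_app_iff. right. now apply (in_map snd L0 (a, y)).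
        * right. now apply U3.
      + rewrite csum_app, csum_map. cbn [length csum]. rewrite S_INR.
        match goal with |- Cmod ?x <= _ => replace x with
          ((csum (fun b => f (a, b)) M' - r a) + (csum f U - csum r K'))%C by ring end.
        eapply Rle_trans; [apply Cmod_triangle|]. lra. }
  destruct (Hex K HK) as (U & U1 & U2 & U3 & U4).
  assert (IU : incl L0 U).
  { intros [a b] Hab. apply U3; auto. apply Hi. now apply (in_map fst L0 (a, b)). }
  specialize (HL0 U U1 IU).
  assert (INR (length K) * d < eps / 2).
  { apply Rlt_le_trans with ((INR (length K) + 1) * d); [nra|].
    unfold d. right. field. lra. }
  replace (csum r K - s)%C with (- (csum f U - csum r K) + (csum f U - s))%C by ring.
  eapply Rle_lt_trans; [apply Cmod_triangle|]. rewrite Cmod_opp. lra.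
Qed.

Lemma has_sum_swap {A B} (f : A * B -> C) s :
  has_sum f s -> has_sum (fun p : B * A => f (snd p, fst p)) s.
Proof.
  apply (has_sum_bij (fun p : B * A => (snd p, fst p)) (fun p : A * B => (snd p, fst p)));
  now intros [? ?].
Qed.

(** A total sum operator, so that a sum depending on a parameter can be named as a function of
    it; it is meaningful only for summable families. *)
Definition hsum {I : Type} (f : I -> C) : C := epsilon (inhabits (RtoC 0)) (has_sum f).

Lemma hsum_correct {I} (f : I -> C) : (exists s, has_sum f s) -> has_sum f (hsum f).
Proof. intros H. unfold hsum. now apply epsilon_spec. Qed.

(** * Limits and derivatives of complex-valued functions *)

Lemma ball_Rabs (x d y : R) : ball x d y <-> Rabs (y - x) < d.
Proof. reflexivity. Qed.

Lemma Clim_ext {T} (F : (T -> Prop) -> Prop) {FF : Filter F} (u v : T -> C) l :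
  (forall x, u x = v x) -> Clim F u l -> Clim F v l.
Proof.
  intros H Hu eps He. generalize (Hu eps He). apply filter_imp. intros x; now rewrite H.
Qed.

Lemma Clim_ext_loc {T} (F : (T -> Prop) -> Prop) {FF : Filter F} (u v : T -> C) l :
  F (fun x => u x = v x) -> Clim F u l -> Clim F v l.
Proof.
  intros H Hu eps He. generalize (filter_and (F := F) _ _ H (Hu eps He)).
  apply filter_imp. intros x [-> ?]; auto.
Qed.

Lemma Clim_const {T} (F : (T -> Prop) -> Prop) {FF : Filter F} l :
  Clim F (fun _ => l) l.
Proof.
  intros eps He. apply filter_forall. intros _.
  replace (l - l)%C with (RtoC 0) by ring. rewrite Cmod_0; lra.
Qed.

Lemma Clim_plus {T} (F : (T -> Prop) -> Prop) {FF : Filter F} (u v : T -> C) l m :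
  Clim F u l -> Clim F v m -> Clim F (fun x => u x + v x)%C (l + m)%C.
Proof.
  intros Hu Hv eps He.
  generalize (filter_and (F := F) _ _ (Hu (eps/2) ltac:(lra)) (Hv (eps/2) ltac:(lra))).
  apply filter_imp. intros x [H1 H2].
  replace (u x + v x - (l + m))%C with ((u x - l) + (v x - m))%C by ring.
  eapply Rle_lt_trans; [apply Cmod_triangle|lra].
Qed.

Lemma Clim_mult {T} (F : (T -> Prop) -> Prop) {FF : Filter F} (u v : T -> C) l m :
  Clim F u l -> Clim F v m -> Clim F (fun x => u x * v x)%C (l * m)%C.
Proof.
  intros Hu Hv eps He.
  pose proof (Cmod_ge_0 l) as Hl. pose proof (Cmod_ge_0 m) as Hm.
  set (d := Rmin 1 (eps / (Cmod l + Cmod m + 1))).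
  assert (Hq : 0 < eps / (Cmod l + Cmod m + 1)) by (apply Rdiv_lt_0_compat; lra).
  assert (Hd : 0 < d) by (apply Rmin_pos; lra).
  assert (Hd1 : d <= 1) by apply Rmin_l.
  assert (Hd2 : d * (Cmod l + Cmod m + 1) <= eps).
  { apply Rle_trans with (eps / (Cmod l + Cmod m + 1) * (Cmod l + Cmod m + 1)).
    - apply Rmult_le_compat_r; [lra|apply Rmin_r].
    - right; field; lra. }
  generalize (filter_and (F := F) _ _ (Hu d Hd) (Hv d Hd)).
  apply filter_imp. intros x [H1 H2].
  replace (u x * v x - l * m)%C
    with ((u x - l) * (v x - m) + (l * (v x - m) + m * (u x - l)))%C by ring.
  eapply Rle_lt_trans; [apply Cmod_triangle|].
  eapply Rle_lt_trans; [apply Rplus_le_compat_l, Cmod_triangle|].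
  rewrite !Cmod_mult.
  pose proof (Cmod_ge_0 (u x - l)). pose proof (Cmod_ge_0 (v x - m)). nra.
Qed.

Lemma Clim_scal {T} (F : (T -> Prop) -> Prop) {FF : Filter F} c (u : T -> C) l :
  Clim F u l -> Clim F (fun x => c * u x)%C (c * l)%C.
Proof. intros; apply Clim_mult; auto. now apply Clim_const. Qed.

Lemma Clim_minus {T} (F : (T -> Prop) -> Prop) {FF : Filter F} (u v : T -> C) l m :
  Clim F u l -> Clim F v m -> Clim F (fun x => u x - v x)%C (l - m)%C.
Proof.
  intros Hu Hv. replace (l - m)%C with (l + (-(1)) * m)%C by ring.
  apply (Clim_ext F (fun x => u x + (-(1)) * v x)%C); [intros; cbv beta; ring|].
  apply Clim_plus; auto. now apply Clim_scal.
Qed.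

Lemma Clim_inv {T} (F : (T -> Prop) -> Prop) {FF : Filter F} (u : T -> C) (l : C) :
  l <> 0%C -> Clim F u l -> Clim F (fun x => / u x)%C (/ l)%C.
Proof.
  intros Hl Hu eps He. assert (Hm : 0 < Cmod l) by (apply Cmod_gt_0; auto).
  assert (Hd : 0 < Rmin (Cmod l / 2) (eps * Cmod l * Cmod l / 2)).
  { apply Rmin_pos; [lra|]. apply Rdiv_lt_0_compat; [|lra].
    apply Rmult_lt_0_compat; [|lra]. now apply Rmult_lt_0_compat. }
  generalize (Hu _ Hd). apply filter_imp. intros x Hx.
  assert (H1 : Cmod (u x - l) < Cmod l / 2) by (eapply Rlt_le_trans; [exact Hx|apply Rmin_l]).
  assert (H2 : Cmod (u x - l) < eps * Cmod l * Cmod l / 2)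
    by (eapply Rlt_le_trans; [exact Hx|apply Rmin_r]).
  assert (H3 : Cmod l / 2 < Cmod (u x)).
  { assert (Cmod l <= Cmod (u x) + Cmod (u x - l)); [|lra].
    replace l with (u x + - (u x - l))%C at 1 by ring.
    eapply Rle_trans; [apply Cmod_triangle|]. rewrite Cmod_opp; lra. }
  assert (Hux : u x <> 0%C) by (apply Cmod_gt_0; lra).
  replace (/ u x - / l)%C with (- (u x - l) / (u x * l))%C by (field; auto).
  rewrite Cmod_div, Cmod_opp, Cmod_mult by (apply Cmult_neq_0; auto).
  apply Rmult_lt_reg_r with (Cmod (u x) * Cmod l); [nra|].
  unfold Rdiv. rewrite Rmult_assoc, Rinv_l by nra.
  assert (0 < eps * Cmod l * (Cmod (u x) - Cmod l / 2)).
  { apply Rmult_lt_0_compat; [|lra]. apply Rmult_lt_0_compat; lra. }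
  nra.
Qed.

Lemma Clim_unique {T} (F : (T -> Prop) -> Prop) {FF : ProperFilter F} (u : T -> C) l m :
  Clim F u l -> Clim F u m -> l = m.
Proof.
  intros Hl Hm. apply NNPP; intros Hne.
  assert (Hp : 0 < Cmod (l - m)).
  { apply Cmod_gt_0. intros H0. apply Hne.
    replace l with (l - m + m)%C by ring. rewrite H0; ring. }
  destruct (filter_ex (F := F) _ (filter_and (F := F) _ _ (Hl (Cmod (l - m) / 2) ltac:(lra))
     (Hm (Cmod (l - m) / 2) ltac:(lra)))) as [x [H1 H2]].
  assert (Cmod (l - m) <= Cmod (u x - l) + Cmod (u x - m)).
  { replace (l - m)%C with (- (u x - l) + (u x - m))%C by ring.
    eapply Rle_trans; [apply Cmod_triangle|]. rewrite Cmod_opp; lra. }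
  lra.
Qed.

Lemma Clim_dominated {T} (F : (T -> Prop) -> Prop) {FF : Filter F} (u : T -> C) l (r : T -> R) :
  F (fun x => Cmod (u x - l) <= r x) -> filterlim r F (locally 0) -> Clim F u l.
Proof.
  intros Hb Hr eps He.
  assert (Hr' := proj1 (filterlim_locally r 0) Hr (mkposreal eps He)).
  generalize (filter_and (F := F) _ _ Hb Hr'). apply filter_imp. intros x [H1 H2].
  eapply Rle_lt_trans; [exact H1|].
  assert (H3 : Rabs (r x - 0) < eps) by exact H2. apply Rabs_def2 in H3. lra.
Qed.

Lemma Clim_RtoC {T} (F : (T -> Prop) -> Prop) {FF : Filter F} (r : T -> R) a :
  filterlim r F (locally a) -> Clim F (fun x => RtoC (r x)) (RtoC a).
Proof.
  intros Hr eps He. generalize (proj1 (filterlim_locally r a) Hr (mkposreal eps He)).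
  apply filter_imp. intros x H. rewrite <- RtoC_minus, Cmod_R. exact H.
Qed.

Lemma Clim_comp {T U} (F : (T -> Prop) -> Prop) (G : (U -> Prop) -> Prop) (h : T -> U)
  (u : U -> C) l : filterlim h F G -> Clim G u l -> Clim F (fun x => u (h x)) l.
Proof. intros Hh Hu eps He. exact (Hh _ (Hu eps He)). Qed.

Lemma im_le_Cmod z : Rabs (Im z) <= Cmod z.
Proof. eapply Rle_trans; [apply Rmax_r|apply Rmax_Cmod]. Qed.

Lemma Cmod_le_abs z : Cmod z <= Rabs (Re z) + Rabs (Im z).
Proof.
  replace z with (RtoC (Re z) + Ci * RtoC (Im z))%C at 1.
  2:{ destruct z. unfold RtoC, Ci, Cplus, Cmult, Re, Im; simpl. f_equal; ring. }
  eapply Rle_trans; [apply Cmod_triangle|].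
  rewrite Cmod_mult, !Cmod_R, Cmod_Ci. lra.
Qed.

Lemma Clim_Re {T} (F : (T -> Prop) -> Prop) {FF : Filter F} (u : T -> C) l :
  Clim F u l -> filterlim (fun x => Re (u x)) F (locally (Re l)).
Proof.
  intros H. apply filterlim_locally. intros eps. generalize (H eps (cond_pos eps)).
  apply filter_imp. intros x Hx. eapply Rle_lt_trans; [|exact Hx].
  exact (re_le_Cmod (u x - l)).
Qed.

Lemma Clim_Im {T} (F : (T -> Prop) -> Prop) {FF : Filter F} (u : T -> C) l :
  Clim F u l -> filterlim (fun x => Im (u x)) F (locally (Im l)).
Proof.
  intros H. apply filterlim_locally. intros eps. generalize (H eps (cond_pos eps)).
  apply filter_imp. intros x Hx. eapply Rle_lt_trans; [|exact Hx].
  exact (im_le_Cmod (u x - l)).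
Qed.

Lemma Clim_seq_correct (u : nat -> C) l : Clim eventually u l -> CLim_seq u = l.
Proof.
  intros H. unfold CLim_seq.
  rewrite (is_lim_seq_unique (fun n => Re (u n)) (Re l)).
  2:{ exact (Clim_Re _ _ _ H). }
  rewrite (is_lim_seq_unique (fun n => Im (u n)) (Im l)).
  2:{ exact (Clim_Im _ _ _ H). }
  now destruct l.
Qed.

(** The real and imaginary parts are kept separate so that the differentiation rules, the mean
    value theorem and the fundamental theorem of calculus for real functions apply to each. *)
Definition Cis_derive (f : R -> C) (x : R) (l : C) : Prop :=
  is_derive (fun t => Re (f t)) x (Re l) /\ is_derive (fun t => Im (f t)) x (Im l).

Lemma Cis_derive_ext f g x l :
  (forall t, f t = g t) -> Cis_derive f x l -> Cis_derive g x l.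
Proof.
  intros H [H1 H2]. split; (eapply is_derive_ext; [|eassumption]);
  intros t; simpl; now rewrite H.
Qed.

Lemma Cis_derive_const (c : C) (x : R) : Cis_derive (fun _ => c) x 0%C.
Proof.
  split.
  - exact (is_derive_const (K := R_AbsRing) (V := R_NormedModule) (Re c) x).
  - exact (is_derive_const (K := R_AbsRing) (V := R_NormedModule) (Im c) x).
Qed.

Lemma Cis_derive_RtoC (r : R -> R) (x l : R) :
  is_derive r x l -> Cis_derive (fun t => RtoC (r t)) x (RtoC l).
Proof. intros H; split; [exact H|].
  exact (is_derive_const (K := R_AbsRing) (V := R_NormedModule) 0 x). Qed.

Lemma Cis_derive_plus f g x l m :
  Cis_derive f x l -> Cis_derive g x m ->
  Cis_derive (fun t => f t + g t)%C x (l + m)%C.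
Proof.
  intros [H1 H2] [H3 H4]. split.
  - exact (is_derive_plus (K := R_AbsRing) (V := R_NormedModule) _ _ _ _ _ H1 H3).
  - exact (is_derive_plus (K := R_AbsRing) (V := R_NormedModule) _ _ _ _ _ H2 H4).
Qed.

Lemma is_derive_prod (f g : R -> R) (x l m : R) :
  is_derive f x l -> is_derive g x m ->
  is_derive (fun t => f t * g t) x (l * g x + f x * m).
Proof. intros H1 H2. apply (is_derive_mult (K := R_AbsRing)); auto. intros; apply Rmult_comm. Qed.

Lemma Cis_derive_mult f g x l m :
  Cis_derive f x l -> Cis_derive g x m ->
  Cis_derive (fun t => f t * g t)%C x (l * g x + f x * m)%C.
Proof.
  intros [H1 H2] [H3 H4]. split.
  - replace (Re (l * g x + f x * m)%C) with
      ((Re l * Re (g x) + Re (f x) * Re m) - (Im l * Im (g x) + Im (f x) * Im m)).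
    2:{ destruct l, m, (f x), (g x); simpl; ring. }
    eapply is_derive_ext.
    2:{ apply (is_derive_minus (K := R_AbsRing) (V := R_NormedModule)).
        - apply (is_derive_prod _ _ _ _ _ H1 H3).
        - apply (is_derive_prod _ _ _ _ _ H2 H4). }
    intros t; simpl. destruct (f t), (g t); reflexivity.
  - replace (Im (l * g x + f x * m)%C) with
      ((Re l * Im (g x) + Re (f x) * Im m) + (Im l * Re (g x) + Im (f x) * Re m)).
    2:{ destruct l, m, (f x), (g x); simpl; ring. }
    eapply is_derive_ext.
    2:{ apply (is_derive_plus (K := R_AbsRing) (V := R_NormedModule)).
        - apply (is_derive_prod _ _ _ _ _ H1 H4).
        - apply (is_derive_prod _ _ _ _ _ H2 H3). }
    intros t; simpl. destruct (f t), (g t); simpl. reflexivity.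
Qed.

Lemma Cis_derive_scal c f x l :
  Cis_derive f x l -> Cis_derive (fun t => c * f t)%C x (c * l)%C.
Proof.
  intros H. replace (c * l)%C with (0 * f x + c * l)%C by ring.
  apply (Cis_derive_mult (fun _ => c) f); auto. apply Cis_derive_const.
Qed.

Lemma Cis_derive_Cexp f x l :
  Cis_derive f x l -> Cis_derive (fun t => Cexp (f t)) x (l * Cexp (f x))%C.
Proof.
  intros [H1 H2].
  assert (E : is_derive (fun t => exp (Re (f t))) x (Re l * exp (Re (f x)))).
  { apply (is_derive_comp exp (fun t => Re (f t))); auto. apply is_derive_exp. }
  split.
  - replace (Re (l * Cexp (f x))%C) with
      (Re l * exp (Re (f x)) * cos (Im (f x)) + exp (Re (f x)) * (Im l * - sin (Im (f x)))).
    2:{ destruct l, (f x); simpl; ring. }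
    apply (is_derive_prod (fun t => exp (Re (f t))) (fun t => cos (Im (f t)))); auto.
    apply (is_derive_comp cos (fun t => Im (f t))); auto. apply is_derive_cos.
  - replace (Im (l * Cexp (f x))%C) with
      (Re l * exp (Re (f x)) * sin (Im (f x)) + exp (Re (f x)) * (Im l * cos (Im (f x)))).
    2:{ destruct l, (f x); simpl; ring. }
    apply (is_derive_prod (fun t => exp (Re (f t))) (fun t => sin (Im (f t)))); auto.
    apply (is_derive_comp sin (fun t => Im (f t))); auto. apply is_derive_sin.
Qed.

Lemma Cis_derive_comp (f : R -> C) (u : R -> R) (t : R) (l : C) (du : R) :
  is_derive u t du -> Cis_derive f (u t) l -> Cis_derive (fun t => f (u t)) t (RtoC du * l)%C.
Proof.
  intros Hu [H1 H2]. split.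
  - replace (Re (RtoC du * l)%C) with (du * Re l) by (destruct l; simpl; ring).
    exact (is_derive_comp (K := R_AbsRing) (V := R_NormedModule) (fun t => Re (f t)) u t (Re l) du H1 Hu).
  - replace (Im (RtoC du * l)%C) with (du * Im l) by (destruct l; simpl; ring).
    exact (is_derive_comp (K := R_AbsRing) (V := R_NormedModule) (fun t => Im (f t)) u t (Im l) du H2 Hu).
Qed.

Lemma Cis_derive_quotient f x l :
  Cis_derive f x l <->
  Clim (Rbar_locally' 0) (fun h => (f (x + h)%R - f x) / RtoC h)%C l.
Proof.
  assert (Hq : forall h, h <> 0 -> ((f (x + h)%R - f x) / RtoC h)%C =
     ((Re (f (x + h)) - Re (f x)) / h, (Im (f (x + h)) - Im (f x)) / h)).
  { intros h Hh. destruct (f (x + h)) as [a b], (f x) as [c d].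
    unfold Cdiv, Cminus, Cinv, Cmult, Cplus, Copp, RtoC, Re, Im; simpl.
    f_equal; field; auto. }
  split.
  - intros [H1 H2]. apply is_derive_Reals in H1. apply is_derive_Reals in H2.
    intros eps He.
    destruct (H1 (eps / 2)) as [d1 Hd1]; [lra|].
    destruct (H2 (eps / 2)) as [d2 Hd2]; [lra|].
    exists (mkposreal _ (Rmin_pos _ _ (cond_pos d1) (cond_pos d2))).
    intros h Hh Hh0.
    assert (Hh' : Rabs (h - 0) < Rmin d1 d2) by exact Hh. rewrite Rminus_0_r in Hh'.
    rewrite Hq; auto. eapply Rle_lt_trans; [apply Cmod_le_abs|].
    assert (Rabs h < d1) by (eapply Rlt_le_trans; [exact Hh'|apply Rmin_l]).
    assert (Rabs h < d2) by (eapply Rlt_le_trans; [exact Hh'|apply Rmin_r]).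
    specialize (Hd1 h Hh0 H). specialize (Hd2 h Hh0 H0).
    destruct l as [a b]. simpl in *. unfold Rminus in *. lra.
  - intros H. split; apply is_derive_Reals; intros eps He;
    destruct (H eps He) as [d Hd]; exists d; intros h Hh0 Hh;
    assert (Hb : ball 0 d h) by
     (apply ball_Rabs; now rewrite Rminus_0_r);
    specialize (Hd h Hb Hh0); rewrite Hq in Hd; auto.
    + eapply Rle_lt_trans; [|exact Hd]. eapply Rle_trans; [|apply re_le_Cmod].
      right. destruct l; simpl. reflexivity.
    + eapply Rle_lt_trans; [|exact Hd]. eapply Rle_trans; [|apply im_le_Cmod].
      right. destruct l; simpl. reflexivity.
Qed.

(** The real mean value theorem applied to the projection onto the direction of the
    increment; this gives the bound without losing a constant. *)
Lemma Cmean_value (h dh : R -> C) D a b : a <= b ->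
  (forall t, a <= t <= b -> Cis_derive h t (dh t)) ->
  (forall t, a <= t <= b -> Cmod (dh t) <= D) ->
  Cmod (h b - h a) <= D * (b - a).
Proof.
  intros Hab Hd HD. set (v := (h b - h a)%C).
  assert (HD0 : 0 <= D) by (eapply Rle_trans; [apply Cmod_ge_0|apply (HD a); lra]).
  set (phi := fun t => Re v * Re (h t) + Im v * Im (h t)).
  assert (Hphi : forall t, a <= t <= b ->
     is_derive phi t (Re v * Re (dh t) + Im v * Im (dh t))).
  { intros t Ht. destruct (Hd t Ht) as [H1 H2].
    apply (is_derive_plus (K := R_AbsRing) (V := R_NormedModule)).
    - apply is_derive_scal, H1.
    - apply is_derive_scal, H2. }
  destruct (MVT_gen phi a b (fun t => Re v * Re (dh t) + Im v * Im (dh t))) as (c & Hc & Heq).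
  - rewrite Rmin_left, Rmax_right by lra. intros t Ht; apply Hphi; lra.
  - rewrite Rmin_left, Rmax_right by lra. intros t Ht.
    apply derivable_continuous_pt. exists (Re v * Re (dh t) + Im v * Im (dh t)).
    apply is_derive_Reals, Hphi; lra.
  - rewrite Rmin_left, Rmax_right in Hc by lra.
    assert (Hv : Cmod v ^ 2 = phi b - phi a).
    { rewrite Cmod2_alt. unfold phi, v. destruct (h a), (h b); simpl; ring. }
    assert (Hcs : Re v * Re (dh c) + Im v * Im (dh c) <= Cmod v * Cmod (dh c)).
    { rewrite <- Cmod_conj with (c := v), <- Cmod_mult.
      eapply Rle_trans; [|eapply Rle_trans; [apply Rle_abs|apply (re_le_Cmod)]].
      right. destruct v, (dh c); simpl; ring. }
    specialize (HD c Hc). pose proof (Cmod_ge_0 v) as Hv0.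
    destruct (Req_dec (Cmod v) 0) as [E|E]; [rewrite E; nra|].
    apply Rmult_le_reg_l with (Cmod v); [lra|].
    replace (Cmod v * Cmod v) with (Cmod v ^ 2) by ring.
    rewrite Hv, Heq.
    apply Rle_trans with (Cmod v * D * (b - a)); [|right; ring].
    apply Rmult_le_compat_r; [lra|]. nra.
Qed.

(** * The complex exponential, sine and cosine *)

Lemma Cexp_0 : Cexp 0 = 1%C.
Proof. unfold Cexp, RtoC; simpl. rewrite exp_0, cos_0, sin_0. f_equal; ring. Qed.

Lemma Cexp_add a b : Cexp (a + b) = (Cexp a * Cexp b)%C.
Proof.
  destruct a, b. unfold Cexp, Cplus, Cmult, Re, Im; simpl.
  rewrite exp_plus, cos_plus, sin_plus. f_equal; ring.
Qed.

Lemma Cexp_mod w : Cmod (Cexp w) = exp (Re w).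
Proof.
  apply Rsqr_inj; [apply Cmod_ge_0|left; apply exp_pos|].
  rewrite !Rsqr_pow2, Cmod2_alt. unfold Cexp; simpl Re; simpl Im.
  pose proof (sin2_cos2 (Im w)) as H. unfold Rsqr in H. nra.
Qed.

Lemma Cexp_neq0 w : Cexp w <> 0%C.
Proof.
  apply Cmod_gt_0. rewrite Cexp_mod. apply exp_pos.
Qed.

Lemma Cexp_opp w : Cexp (- w) = (/ Cexp w)%C.
Proof.
  assert (H : (Cexp (- w) * Cexp w)%C = 1%C).
  { rewrite <- Cexp_add, <- Cexp_0. f_equal. ring. }
  pose proof (Cexp_neq0 w).
  replace (Cexp (- w)) with (Cexp (- w) * Cexp w / Cexp w)%C by (field; auto).
  rewrite H. field; auto.
Qed.

Lemma Cexp_pow w n : (Cexp w ^ n)%C = Cexp (RtoC (INR n) * w).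
Proof.
  induction n as [|n IH].
  - simpl. rewrite <- Cexp_0. f_equal. ring.
  - rewrite S_INR, RtoC_plus. cbn [Cpow]. rewrite IH, <- Cexp_add. f_equal. ring.
Qed.

Lemma exp_le x y : x <= y -> exp x <= exp y.
Proof. intros [H|<-]; [left; now apply exp_increasing|right; auto]. Qed.

Lemma exp_pow_nat x n : exp x ^ n = exp (INR n * x).
Proof.
  induction n as [|n IH]; [simpl; rewrite Rmult_0_l, exp_0; auto|].
  rewrite S_INR. simpl pow. rewrite IH, <- exp_plus. f_equal; ring.
Qed.

Lemma Cexp_mod_le w : Cmod (Cexp w) <= exp (Cmod w).
Proof.
  rewrite Cexp_mod. apply exp_le. eapply Rle_trans; [apply Rle_abs|apply re_le_Cmod].
Qed.

Lemma le_div a b c : 0 < c -> a * c <= b -> a <= b / c.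
Proof. intros Hc H. now apply Rle_div_r. Qed.

Lemma div_le a b c : 0 < c -> a <= b * c -> a / c <= b.
Proof. intros Hc H. now apply Rle_div_l. Qed.

Lemma exp_ge_1 x : 0 <= x -> 1 <= exp x.
Proof. intros H. rewrite <- exp_0. now apply exp_le. Qed.

Lemma Cmod_scal_le t w : 0 <= t <= 1 -> Cmod (RtoC t * w) <= Cmod w.
Proof.
  intros H. rewrite Cmod_mult, Cmod_R, Rabs_pos_eq by lra.
  pose proof (Cmod_ge_0 w). nra.
Qed.

Lemma Cis_derive_ray w t : Cis_derive (fun t => RtoC t * w)%C t w.
Proof.
  apply Cis_derive_ext with (fun t => w * RtoC t)%C; [intros; cbv beta; ring|].
  pose proof (Cis_derive_scal w (fun t => RtoC t) t (RtoC 1)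
    (Cis_derive_RtoC (fun t => t) t 1 (is_derive_id (K := R_AbsRing) t))) as H.
  now rewrite Cmult_1_r in H.
Qed.

Lemma Cexp_taylor1 w : Cmod (Cexp w - 1) <= Cmod w * exp (Cmod w).
Proof.
  assert (H := Cmean_value (fun t => Cexp (RtoC t * w)) (fun t => w * Cexp (RtoC t * w))%C
     (Cmod w * exp (Cmod w)) 0 1).
  cbv beta in H. rewrite Cmult_1_l, Cmult_0_l, Cexp_0 in H.
  rewrite Rminus_0_r, Rmult_1_r in H. apply H; [lra| |].
  - intros t _. apply Cis_derive_Cexp, Cis_derive_ray.
  - intros t Ht. rewrite Cmod_mult. apply Rmult_le_compat_l; [apply Cmod_ge_0|].
    eapply Rle_trans; [apply Cexp_mod_le|]. apply exp_le. now apply Cmod_scal_le.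
Qed.

Lemma Cexp_taylor2 w : Cmod (Cexp w - 1 - w) <= Cmod w ^ 2 * exp (Cmod w).
Proof.
  assert (H := Cmean_value (fun t => Cexp (RtoC t * w) + (- (1)) * (RtoC t * w))%C
     (fun t => w * Cexp (RtoC t * w) + (- (1)) * w)%C
     (Cmod w ^ 2 * exp (Cmod w)) 0 1).
  cbv beta in H.
  rewrite !Cmult_1_l, !Cmult_0_l, Cexp_0 in H.
  match type of H with _ -> _ -> _ -> Cmod ?x <= _ =>
    replace x with (Cexp w - 1 - w)%C in H by ring end.
  rewrite Rminus_0_r, Rmult_1_r in H. apply H; [lra| |].
  - intros t _. apply Cis_derive_plus.
    + apply Cis_derive_Cexp, Cis_derive_ray.
    + apply Cis_derive_scal, Cis_derive_ray.
  - intros t Ht. replace (w * Cexp (t * w) + - (1) * w)%C with (w * (Cexp (t * w) - 1))%C by ring.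
    rewrite Cmod_mult. simpl (Cmod w ^ 2). rewrite Rmult_1_r, Rmult_assoc.
    apply Rmult_le_compat_l; [apply Cmod_ge_0|].
    eapply Rle_trans; [apply Cexp_taylor1|]. apply Rmult_le_compat.
    + apply Cmod_ge_0.
    + left; apply exp_pos.
    + now apply Cmod_scal_le.
    + apply exp_le. now apply Cmod_scal_le.
Qed.

Lemma Cexp_taylor3 w :
  Cmod (Cexp w - 1 - w - w * w / 2) <= Cmod w ^ 3 * exp (Cmod w).
Proof.
  assert (H := Cmean_value
     (fun t => Cexp (RtoC t * w) + (- (1)) * (RtoC t * w) + (- (1/2)) * ((RtoC t * w) * (RtoC t * w)))%C
     (fun t => w * Cexp (RtoC t * w) + (- (1)) * w + (- (1/2)) * (w * (RtoC t * w) + (RtoC t * w) * w))%C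
     (Cmod w ^ 3 * exp (Cmod w)) 0 1).
  cbv beta in H.
  rewrite !Cmult_1_l, !Cmult_0_l, Cexp_0 in H.
  match type of H with _ -> _ -> _ -> Cmod ?x <= _ =>
    replace x with (Cexp w - 1 - w - w * w / 2)%C in H by field end.
  rewrite Rminus_0_r, Rmult_1_r in H. apply H; [lra| |].
  - intros t _. apply Cis_derive_plus; [apply Cis_derive_plus|].
    + apply Cis_derive_Cexp, Cis_derive_ray.
    + apply Cis_derive_scal, Cis_derive_ray.
    + apply Cis_derive_scal, (Cis_derive_mult (fun t => RtoC t * w)%C (fun t => RtoC t * w)%C);
      apply Cis_derive_ray.
  - intros t Ht.
    match goal with |- Cmod ?x <= _ =>
      replace x with (w * (Cexp (t * w) - 1 - t * w))%C by field end.
    rewrite Cmod_mult. change (Cmod w ^ 3) with (Cmod w * Cmod w ^ 2). rewrite Rmult_assoc.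
    apply Rmult_le_compat_l; [apply Cmod_ge_0|].
    eapply Rle_trans; [apply Cexp_taylor2|]. apply Rmult_le_compat.
    + apply pow_le, Cmod_ge_0.
    + left; apply exp_pos.
    + apply pow_incr. split; [apply Cmod_ge_0|now apply Cmod_scal_le].
    + apply exp_le. now apply Cmod_scal_le.
Qed.

Lemma Clim_Cexp {T} (F : (T -> Prop) -> Prop) {FF : Filter F} (u : T -> C) l :
  Clim F u l -> Clim F (fun x => Cexp (u x)) (Cexp l).
Proof.
  intros H.
  assert (H0 : Clim F (fun x => Cexp (u x - l)) 1%C).
  { intros eps He.
    assert (He3 : 0 < Rmin 1 (eps / 3)) by (apply Rmin_pos; lra).
    generalize (H _ He3). apply filter_imp. intros x Hx.
    eapply Rle_lt_trans; [apply Cexp_taylor1|].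
    assert (Cmod (u x - l) < 1) by (eapply Rlt_le_trans; [exact Hx|apply Rmin_l]).
    assert (Cmod (u x - l) < eps / 3) by (eapply Rlt_le_trans; [exact Hx|apply Rmin_r]).
    assert (exp (Cmod (u x - l)) <= 3).
    { eapply Rle_trans; [|apply exp_le_3]. apply exp_le; lra. }
    pose proof (exp_pos (Cmod (u x - l))). pose proof (Cmod_ge_0 (u x - l)). nra. }
  apply (Clim_ext F (fun x => Cexp l * Cexp (u x - l))%C).
  { intros x. rewrite <- Cexp_add. f_equal; ring. }
  pose proof (Clim_scal F (Cexp l) _ _ H0) as H1. now rewrite Cmult_1_r in H1.
Qed.

Definition Csin (u : C) : C := ((Cexp (Ci * u) - Cexp (- (Ci * u))) / (2 * Ci))%C.

Definition Ccos (u : C) : C := ((Cexp (Ci * u) + Cexp (- (Ci * u))) / 2)%C.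

Lemma Ci_neq0 : Ci <> 0%C.
Proof. intros H; injection H; lra. Qed.

Lemma C2_neq0 : RtoC 2 <> 0%C.
Proof. intros H; injection H; lra. Qed.

Lemma RtoC_neq0 r : r <> 0 -> RtoC r <> 0%C.
Proof. intros H E. injection E; auto. Qed.

Lemma Csin_RtoC x : Csin (RtoC x) = RtoC (sin x).
Proof.
  unfold Csin. rewrite Cexp_opp. unfold Cexp.
  replace (Re (Ci * x)) with 0 by (simpl; ring).
  replace (Im (Ci * x)) with x by (simpl; ring).
  rewrite exp_0, !Rmult_1_l. pose proof (sin2_cos2 x) as H. unfold Rsqr in H.
  unfold Cdiv, Cminus, Cplus, Copp, Cinv, Cmult, Ci, RtoC; simpl.
  replace (cos x * (cos x * 1) + sin x * (sin x * 1)) with 1 by lra.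
  f_equal; field; lra.
Qed.

Lemma Csin_opp u : Csin (- u) = (- Csin u)%C.
Proof.
  unfold Csin. replace (Ci * - u)%C with (- (Ci * u))%C by ring.
  replace (- - (Ci * u))%C with (Ci * u)%C by ring. field.
  repeat split; auto using Ci_neq0, C2_neq0.
Qed.

Lemma Ci_sq : (Ci * Ci)%C = (- (1))%C.
Proof. unfold Ci, Cmult, Copp, RtoC; simpl. f_equal; ring. Qed.

Lemma Csin_le u : Cmod (Csin u) <= Cmod u * exp (Cmod u).
Proof.
  unfold Csin. rewrite Cmod_div by (apply Cmult_neq_0; [apply C2_neq0|apply Ci_neq0]).
  rewrite Cmod_mult, Cmod_Ci, Cmod_R, Rabs_pos_eq by lra.
  assert (H1 := Cexp_taylor1 (Ci * u)). assert (H2 := Cexp_taylor1 (- (Ci * u))).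
  rewrite Cmod_opp in H2. rewrite Cmod_mult, Cmod_Ci, Rmult_1_l in H1, H2.
  assert (Cmod (Cexp (Ci * u) - Cexp (- (Ci * u))) <= 2 * (Cmod u * exp (Cmod u))).
  { replace (Cexp (Ci * u) - Cexp (- (Ci * u)))%C with
     ((Cexp (Ci * u) - 1) + - (Cexp (- (Ci * u)) - 1))%C by ring.
    eapply Rle_trans; [apply Cmod_triangle|]. rewrite Cmod_opp. lra. }
  lra.
Qed.

Lemma Csin_near u : Cmod (Csin u - u) <= Cmod u ^ 2 * exp (Cmod u).
Proof.
  replace (Csin u - u)%C with
   (((Cexp (Ci * u) - 1 - Ci * u) + - (Cexp (- (Ci * u)) - 1 - - (Ci * u))) / (2 * Ci))%C.
  2:{ unfold Csin. field. repeat split; auto using Ci_neq0, C2_neq0. }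
  rewrite Cmod_div by (apply Cmult_neq_0; [apply C2_neq0|apply Ci_neq0]).
  rewrite Cmod_mult, Cmod_Ci, Cmod_R, Rabs_pos_eq by lra.
  assert (H1 := Cexp_taylor2 (Ci * u)). assert (H2 := Cexp_taylor2 (- (Ci * u))).
  rewrite Cmod_opp in H2. rewrite Cmod_mult, Cmod_Ci, Rmult_1_l in H1, H2.
  pose proof (Cmod_triangle (Cexp (Ci * u) - 1 - Ci * u)
     (- (Cexp (- (Ci * u)) - 1 - - (Ci * u)))) as H3.
  rewrite Cmod_opp in H3. lra.
Qed.

Lemma Ccos_near u : Cmod (Ccos u - (1 - u * u / 2)) <= Cmod u ^ 3 * exp (Cmod u).
Proof.
  assert (Hi : ((Ci * u) * (Ci * u))%C = (- (u * u))%C).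
  { replace ((Ci * u) * (Ci * u))%C with (Ci * Ci * (u * u))%C by ring. rewrite Ci_sq; ring. }
  replace (Ccos u - (1 - u * u / 2))%C with
   (((Cexp (Ci * u) - 1 - Ci * u - (Ci * u) * (Ci * u) / 2)
     + (Cexp (- (Ci * u)) - 1 - - (Ci * u) - (- (Ci * u)) * (- (Ci * u)) / 2)) / 2)%C.
  2:{ replace (- (Ci * u) * - (Ci * u))%C with ((Ci * u) * (Ci * u))%C by ring.
      rewrite Hi. unfold Ccos. field. }
  rewrite Cmod_div by apply C2_neq0. rewrite Cmod_R, Rabs_pos_eq by lra.
  assert (H1 := Cexp_taylor3 (Ci * u)). assert (H2 := Cexp_taylor3 (- (Ci * u))).
  rewrite Cmod_opp in H2. rewrite Cmod_mult, Cmod_Ci, Rmult_1_l in H1, H2.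
  pose proof (Cmod_triangle (Cexp (Ci * u) - 1 - Ci * u - (Ci * u) * (Ci * u) / 2)
     (Cexp (- (Ci * u)) - 1 - - (Ci * u) - (- (Ci * u)) * (- (Ci * u)) / 2)). lra.
Qed.

Lemma Csin_mod2 u : Cmod (Csin u) ^ 2 = sin (Re u) ^ 2 + sinh (Im u) ^ 2.
Proof.
  destruct u as [a b]. rewrite Cmod2_alt. unfold Csin, Cexp, sinh.
  replace (Re (Ci * (a, b))) with (- b) by (simpl; ring).
  replace (Im (Ci * (a, b))) with a by (simpl; ring).
  replace (Re (- (Ci * (a, b)))) with b by (simpl; ring).
  replace (Im (- (Ci * (a, b)))) with (- a) by (simpl; ring).
  rewrite cos_neg, sin_neg. simpl Re; simpl Im.
  assert (H := sin2_cos2 a). unfold Rsqr in H.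
  assert (He : exp b * exp (- b) = 1) by (rewrite <- exp_plus, Rplus_opp_r; apply exp_0).
  set (E := exp b) in *. set (E' := exp (- b)) in *.
  simpl. field_simplify.
  replace (cos a ^ 2) with (1 - sin a ^ 2) by (simpl; lra).
  replace (E' * E) with 1 by lra. nra || (field_simplify; nra).
Qed.

Lemma Ccos_mod2 u : Cmod (Ccos u) ^ 2 = 1 - sin (Re u) ^ 2 + sinh (Im u) ^ 2.
Proof.
  destruct u as [a b]. rewrite Cmod2_alt. unfold Ccos, Cexp, sinh.
  replace (Re (Ci * (a, b))) with (- b) by (simpl; ring).
  replace (Im (Ci * (a, b))) with a by (simpl; ring).
  replace (Re (- (Ci * (a, b)))) with b by (simpl; ring).
  replace (Im (- (Ci * (a, b)))) with (- a) by (simpl; ring).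
  rewrite cos_neg, sin_neg. simpl Re; simpl Im.
  assert (H := sin2_cos2 a). unfold Rsqr in H.
  assert (He : exp b * exp (- b) = 1) by (rewrite <- exp_plus, Rplus_opp_r; apply exp_0).
  set (E := exp b) in *. set (E' := exp (- b)) in *.
  simpl. field_simplify.
  replace (cos a ^ 2) with (1 - sin a ^ 2) by (simpl; lra).
  nra || (field_simplify; nra).
Qed.

Lemma Csin_add u v : Csin (u + v) = (Csin u * Ccos v + Ccos u * Csin v)%C.
Proof.
  unfold Csin, Ccos.
  replace (Ci * (u + v))%C with (Ci * u + Ci * v)%C by ring.
  replace (- (Ci * u + Ci * v))%C with (- (Ci * u) + - (Ci * v))%C by ring.
  rewrite !Cexp_add. field. repeat split; auto using Ci_neq0, C2_neq0.
Qed.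

Lemma Ccos_opp u : Ccos (- u) = Ccos u.
Proof.
  unfold Ccos. replace (Ci * - u)%C with (- (Ci * u))%C by ring.
  replace (- - (Ci * u))%C with (Ci * u)%C by ring. f_equal. ring.
Qed.

Lemma Csin_sub u v : Csin (u - v) = (Csin u * Ccos v - Ccos u * Csin v)%C.
Proof.
  unfold Cminus. rewrite Csin_add, Ccos_opp, Csin_opp. ring.
Qed.

Lemma Ccos_RtoC x : Ccos (RtoC x) = RtoC (cos x).
Proof.
  unfold Ccos. rewrite Cexp_opp. unfold Cexp.
  replace (Re (Ci * x)) with 0 by (simpl; ring).
  replace (Im (Ci * x)) with x by (simpl; ring).
  rewrite exp_0, !Rmult_1_l. pose proof (sin2_cos2 x) as H. unfold Rsqr in H.
  unfold Cdiv, Cminus, Cplus, Copp, Cinv, Cmult, Ci, RtoC; simpl.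
  replace (cos x * (cos x * 1) + sin x * (sin x * 1)) with 1 by lra.
  f_equal; field; lra.
Qed.

Lemma Csin2_Ccos2 u : (Csin u * Csin u + Ccos u * Ccos u)%C = 1%C.
Proof.
  unfold Csin, Ccos. rewrite Cexp_opp. pose proof (Cexp_neq0 (Ci * u)).
  assert (Hi := Ci_sq).
  replace ((Cexp (Ci * u) - / Cexp (Ci * u)) / (2 * Ci) *
    ((Cexp (Ci * u) - / Cexp (Ci * u)) / (2 * Ci)))%C
   with ((Cexp (Ci * u) - / Cexp (Ci * u)) * (Cexp (Ci * u) - / Cexp (Ci * u)) / (4 * (Ci * Ci)))%C.
  - rewrite Hi. field. auto.
  - field. repeat split; auto using Ci_neq0, C2_neq0.
Qed.

Lemma PI_upper : PI < 3.5.
Proof.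
  destruct (PI_ineq 1) as [_ H]. simpl in H. unfold tg_alt, PI_tg in H. simpl in H. lra.
Qed.

Lemma sin_lower a : Rabs a <= 2 -> a ^ 2 / 16 <= sin a ^ 2.
Proof.
  pose proof PI2_3_2 as HPI.
  assert (Hcos : forall x, 0 <= x <= 1 -> 1 / 2 <= cos x).
  { intros x Hx. rewrite <- cos_PI3. apply cos_decr_1; lra. }
  assert (Hsin : forall x, 0 <= x <= 1 -> x / 2 <= sin x).
  { intros x Hx. destruct (MVT_gen sin 0 x cos) as (t & Ht & E).
    - intros t _. apply is_derive_sin.
    - intros t _. apply continuity_sin.
    - rewrite Rmin_left, Rmax_right in Ht by lra. specialize (Hcos t ltac:(lra)).
      rewrite sin_0 in E. nra. }
  assert (Hp : forall b, 0 <= b <= 2 -> b / 4 <= sin b).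
  { intros b Hb. replace b with (2 * (b / 2)) at 2 by field. rewrite sin_2a.
    specialize (Hcos (b / 2) ltac:(lra)). specialize (Hsin (b / 2) ltac:(lra)). nra. }
  intros Ha. destruct (Rle_dec 0 a) as [H|H].
  - rewrite Rabs_pos_eq in Ha by lra. specialize (Hp a ltac:(lra)). nra.
  - rewrite Rabs_left in Ha by lra. specialize (Hp (- a) ltac:(lra)).
    rewrite sin_neg in Hp. nra.
Qed.

Lemma sinh_lower b : b ^ 2 <= sinh b ^ 2.
Proof.
  assert (Hp : forall b, 0 <= b -> b <= sinh b).
  { intros c Hc. unfold sinh.
    destruct (Req_dec c 0) as [->|Hn]; [rewrite Ropp_0; lra|].
    destruct (MVT_gen (fun t => exp t - exp (- t) - 2 * t) 0 c
       (fun t => exp t + exp (- t) - 2)) as (t & Ht & E).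
    - intros x _. auto_derive; auto. ring.
    - intros x _. apply derivable_continuous_pt.
      exists (exp x + exp (- x) - 2). apply is_derive_Reals. auto_derive; auto. ring.
    - rewrite Ropp_0, exp_0 in E.
      assert (0 <= exp t + exp (- t) - 2).
      { assert (exp t * exp (- t) = 1) by (rewrite <- exp_plus, Rplus_opp_r; apply exp_0).
        pose proof (exp_pos t). pose proof (exp_pos (- t)).
        pose proof (pow2_ge_0 (exp t - exp (- t))). nra. }
      nra. }
  destruct (Rle_dec 0 b) as [H|H].
  - specialize (Hp b H). nra.
  - specialize (Hp (- b) ltac:(lra)). unfold sinh in *. rewrite Ropp_involutive in Hp.
    nra.
Qed.

Lemma Csin_lower u : Rabs (Re u) <= 2 -> Cmod u / 4 <= Cmod (Csin u).
Proof.
  intros H. apply sin_lower in H. pose proof (sinh_lower (Im u)).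
  pose proof (pow2_ge_0 (Im u)).
  apply Rsqr_incr_0; [|pose proof (Cmod_ge_0 u); lra|apply Cmod_ge_0].
  rewrite !Rsqr_pow2, Csin_mod2.
  replace ((Cmod u / 4) ^ 2) with (Cmod u ^ 2 / 16) by field.
  rewrite Cmod2_alt. lra.
Qed.

Lemma sinh_upper b : Rabs b <= 1 -> sinh b ^ 2 <= 9 * b ^ 2.
Proof.
  intros Hb. assert (H := Csin_mod2 (0, b)). simpl in H. rewrite sin_0 in H.
  assert (H1 := Csin_le (0, b)).
  assert (E : Cmod (0, b) = Rabs b).
  { unfold Cmod; simpl. rewrite <- sqrt_Rsqr_abs. f_equal. unfold Rsqr; ring. }
  rewrite E in H1. pose proof (Rabs_pos b).
  assert (exp (Rabs b) <= 3) by (eapply Rle_trans; [apply exp_le; exact Hb|apply exp_le_3]).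
  pose proof (Cmod_ge_0 (Csin (0, b))).
  assert (H5 : Cmod (Csin (0, b)) <= 3 * Rabs b) by nra.
  rewrite <- (pow2_abs b). nra.
Qed.

Lemma Cexp_RtoC x : Cexp (RtoC x) = RtoC (exp x).
Proof. unfold Cexp, RtoC; simpl. rewrite cos_0, sin_0. f_equal; ring. Qed.

Lemma Cexp_Ci x : Cexp (Ci * RtoC x) = (cos x, sin x).
Proof.
  unfold Cexp. replace (Re (Ci * RtoC x)) with 0 by (simpl; ring).
  replace (Im (Ci * RtoC x)) with x by (simpl; ring). rewrite exp_0. f_equal; ring.
Qed.

(** * Sums over the integers *)

Definition sg (n : Z) : R := if Z.even n then 1 else -1.

Lemma sg_add m n : sg (m + n) = sg m * sg n.
Proof.
  unfold sg. rewrite Z.even_add. destruct (Z.even m), (Z.even n); simpl; ring.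
Qed.

Lemma sg_opp n : sg (- n) = sg n.
Proof. unfold sg. now rewrite Z.even_opp. Qed.

Lemma sg_sq n : sg n * sg n = 1.
Proof. unfold sg; destruct (Z.even n); ring. Qed.

Lemma sg_abs n : Rabs (sg n) = 1.
Proof. unfold sg; destruct (Z.even n); [rewrite Rabs_pos_eq|rewrite Rabs_left]; lra. Qed.

Lemma sg_Cmod n : Cmod (RtoC (sg n)) = 1.
Proof. now rewrite Cmod_R, sg_abs. Qed.

Lemma sg_succ n : sg (n + 1) = - sg n.
Proof. rewrite sg_add. unfold sg at 2; simpl. ring. Qed.

Lemma sg_powerRZ n : powerRZ (-1) n = sg n.
Proof.
  induction n using Z.peano_ind.
  - reflexivity.
  - unfold Z.succ. rewrite powerRZ_add, IHn, sg_succ by lra. simpl; ring.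
  - unfold Z.pred. rewrite powerRZ_add, IHn, sg_add by lra. simpl. unfold sg at 3; simpl.
    field.
Qed.

Lemma sg_pow n : (-1) ^ n = sg (Z.of_nat n).
Proof. now rewrite <- sg_powerRZ, <- pow_powerRZ. Qed.

Lemma Cexp_PI : Cexp (Ci * PI) = RtoC (-1).
Proof.
  unfold Cexp. replace (Re (Ci * PI)) with 0 by (simpl; ring).
  replace (Im (Ci * PI)) with PI by (simpl; ring).
  rewrite exp_0, cos_PI, sin_PI. unfold RtoC. f_equal; ring.
Qed.

Lemma Cexp_PI_Z n : Cexp (Ci * PI * RtoC (IZR n)) = RtoC (sg n).
Proof.
  induction n using Z.peano_ind.
  - replace (Ci * PI * 0)%C with (RtoC 0) by ring. rewrite Cexp_0. reflexivity.
  - unfold Z.succ. rewrite plus_IZR, RtoC_plus.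
    replace (Ci * PI * (IZR n + 1))%C with (Ci * PI * IZR n + Ci * PI)%C by ring.
    rewrite Cexp_add, IHn, Cexp_PI, sg_succ, <- RtoC_mult. f_equal; ring.
  - unfold Z.pred. rewrite plus_IZR, RtoC_plus.
    replace (Ci * PI * (IZR n + -1))%C with (Ci * PI * IZR n + - (Ci * PI))%C
      by (replace (RtoC (-1)) with (- (1))%C by (unfold Copp, RtoC; simpl; f_equal; ring); ring).
    rewrite Cexp_add, Cexp_opp, IHn, Cexp_PI, sg_add. unfold sg at 3; simpl.
    rewrite <- RtoC_inv, <- RtoC_mult by lra. f_equal; field.
Qed.

Lemma summable_nat (g : nat -> R) B :
  (forall n, 0 <= g n) -> (forall N, rsum g (seq 0 N) <= B) -> summable g.
Proof.
  intros Hg HB. split; auto. exists B. intros L HL.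
  eapply Rle_trans; [|apply (HB (S (list_max L)))].
  apply rsum_incl; auto using seq_NoDup.
  intros x Hx. apply in_seq. split; [lia|].
  assert (H := proj1 (list_max_le L (list_max L)) (le_n _)).
  rewrite Forall_forall in H. specialize (H x Hx). lia.
Qed.

Lemma summable_finite {I} (g : I -> R) (K : list I) :
  NoDup K -> (forall i, In i K) -> (forall i, 0 <= g i) -> summable g.
Proof.
  intros HK Hin Hg. split; auto. exists (rsum g K). intros L HL.
  apply rsum_incl; auto. intros x _; auto.
Qed.

(** The standard majorant of all the series below; its terms are dominated by the telescoping
    differences [4 / (n + 1) - 4 / (n + 2)]. *)
Lemma summable_inv_sq_nat : summable (fun n : nat => / (1 + INR n ^ 2)).
Proof.
  apply summable_nat with 4.
  - intros n. left. apply Rinv_0_lt_compat. pose proof (pow2_ge_0 (INR n)). lra.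
  - intros N.
    assert (H : rsum (fun n => / (1 + INR n ^ 2)) (seq 0 N) <= 4 - 4 / (INR N + 1)).
    { induction N as [|N IH].
      { simpl. replace (4 / (0 + 1)) with 4 by field. lra. }
      rewrite seq_S, rsum_app. cbn [rsum]. simpl Nat.add. rewrite S_INR.
      pose proof (pos_INR N) as HN. set (x := INR N) in *.
      assert (/ (1 + x ^ 2) <= 4 / (x + 1) - 4 / (x + 1 + 1)); [|lra].
      replace (4 / (x + 1) - 4 / (x + 1 + 1)) with (/ ((x + 1) * (x + 2) / 4)).
      2:{ field. lra. }
      apply Rinv_le_contravar; nra. }
    assert (0 < 4 / (INR N + 1)).
    { pose proof (pos_INR N). apply Rdiv_lt_0_compat; lra. }
    lra.
Qed.

Lemma summable_inv_sq : summable (fun n : Z => / (1 + IZR n ^ 2)).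
Proof.
  assert (Hb : summable (fun _ : bool => 1)).
  { apply summable_finite with [true; false].
    - repeat constructor; simpl; intuition easy.
    - intros []; simpl; auto.
    - intros; lra. }
  assert (H := summable_prod _ _ Hb summable_inv_sq_nat).
  apply (summable_inj (fun n : Z => (Z.ltb n 0, Z.abs_nat n))) in H.
  - eapply summable_le; [exact H|]. intros n. cbv beta. simpl snd.
    rewrite INR_IZR_INZ, Zabs2Nat.id_abs, abs_IZR, pow2_abs.
    pose proof (pow2_ge_0 (IZR n)).
    assert (0 < / (1 + IZR n ^ 2)) by (apply Rinv_0_lt_compat; lra). lra.
  - intros a b E. injection E. intros E1 E2.
    apply (f_equal Z.of_nat) in E1. rewrite !Zabs2Nat.id_abs in E1.
    destruct (Z.ltb_spec a 0), (Z.ltb_spec b 0); try easy; lia.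
Qed.

(** From [a (1 + u) <= exp (d u)] with [a] small and [d = c / (k + 1)], raised to the power
    [k]. *)
Lemma exp_poly_bound c k : 0 < c -> exists B, 0 < B /\
  forall u, 0 <= u -> (1 + u) ^ k * exp (- (c * u)) <= B.
Proof.
  intros Hc. pose proof (pos_INR k) as Hk.
  set (d := c / (INR k + 1)). assert (Hd : 0 < d) by (apply Rdiv_lt_0_compat; lra).
  set (a := Rmin 1 d). assert (Ha : 0 < a) by (apply Rmin_pos; lra).
  exists (/ a ^ k). split; [apply Rinv_0_lt_compat, pow_lt, Ha|].
  intros u Hu.
  assert (H1 : a * (1 + u) <= exp (d * u)).
  { apply Rle_trans with (1 + d * u); [|apply exp_ineq1_le].
    assert (a <= 1) by apply Rmin_l. assert (a <= d) by apply Rmin_r. nra. }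
  assert (H2 : (a * (1 + u)) ^ k <= exp (c * u)).
  { apply Rle_trans with (exp (d * u) ^ k); [apply pow_incr; split; [nra|auto]|].
    rewrite exp_pow_nat. apply exp_le. apply Rle_trans with ((INR k + 1) * (d * u)); [nra|].
    right. unfold d. field. lra. }
  rewrite Rpow_mult_distr in H2. rewrite exp_Ropp.
  pose proof (exp_pos (c * u)). pose proof (pow_lt a k Ha).
  apply Rmult_le_reg_l with (a ^ k * exp (c * u)); [nra|].
  field_simplify; [|lra|lra]. lra.
Qed.

Definition zlist (n : nat) : list Z :=
  map (fun k => (Z.of_nat k - Z.of_nat n)%Z) (seq 0 (2 * n + 1)).

Lemma zlist_NoDup n : NoDup (zlist n).
Proof.
  apply FinFun.Injective_map_NoDup; [|apply seq_NoDup]. intros a b; lia.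
Qed.

Lemma zlist_In n i : In i (zlist n) <-> (- Z.of_nat n <= i <= Z.of_nat n)%Z.
Proof.
  unfold zlist. rewrite in_map_iff. split.
  - intros (k & <- & Hk). apply in_seq in Hk. lia.
  - intros H. exists (Z.to_nat (i + Z.of_nat n)). rewrite in_seq. lia.
Qed.

Lemma zlist_eventually i : eventually (fun n => In i (zlist n)).
Proof. exists (Z.to_nat (Z.abs i)). intros n Hn. apply zlist_In. lia. Qed.

Lemma csum_zlist_S (f : Z -> C) n :
  csum f (zlist (S n)) =
  (csum f (zlist n) + (f (Z.of_nat (S n)) + f (- Z.of_nat (S n))%Z))%C.
Proof.
  rewrite (csum_perm f (zlist (S n))
    (zlist n ++ [Z.of_nat (S n); (- Z.of_nat (S n))%Z])).
  - rewrite csum_app. simpl. ring.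
  - apply NoDup_Permutation; [apply zlist_NoDup| |].
    + apply NoDup_app_disjoint; [apply zlist_NoDup| |].
      * constructor; [simpl; lia|]. constructor; [easy|constructor].
      * intros x Hx. rewrite zlist_In. simpl In in Hx. lia.
    + intros x. rewrite in_app_iff, !zlist_In. simpl In. lia.
Qed.

Lemma has_sum_zlist (f : Z -> C) s :
  has_sum f s -> Clim eventually (fun n => csum f (zlist n)) s.
Proof.
  intros H. apply has_sum_exhaust; auto using zlist_NoDup, zlist_eventually.
Qed.

Lemma sum_n_csum (a : nat -> C) n : sum_n a n = csum a (seq 0 (S n)).
Proof.
  induction n as [|n IH].
  - rewrite sum_O. symmetry. apply Cplus_0_r.
  - rewrite sum_Sn, IH, (seq_S (S n)), csum_app.
    change plus with Cplus. simpl (csum a [_]). rewrite Cplus_0_r. reflexivity.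
Qed.

Lemma CSeries_has_sum (a : nat -> C) s : has_sum a s -> CSeries a = s.
Proof.
  intros H. apply Clim_seq_correct.
  apply (Clim_ext eventually (fun n => csum a (seq 0 (S n)))).
  { intros n. now rewrite sum_n_csum. }
  apply has_sum_exhaust; auto using seq_NoDup.
  intros i. exists i. intros n Hn. apply in_seq. lia.
Qed.

Lemma CSeriesZ_has_sum (f : Z -> C) (g : Z -> R) s :
  summable g -> (forall n, Cmod (f n) <= g n) -> has_sum f s -> CSeriesZ f = s.
Proof.
  intros Hg Hf Hs. unfold CSeriesZ.
  assert (I1 : forall a b, Z.of_nat a = Z.of_nat b -> a = b) by lia.
  assert (I2 : forall a b, (- Z.of_nat a - 1)%Z = (- Z.of_nat b - 1)%Z -> a = b) by lia.
  destruct (summable_has_sum (fun n => f (Z.of_nat n)) _ (summable_inj _ g I1 Hg)) as [s1 H1].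
  { intros; apply Hf. }
  destruct (summable_has_sum (fun n => f (- Z.of_nat n - 1)%Z) _ (summable_inj _ g I2 Hg))
    as [s2 H2].
  { intros; apply Hf. }
  rewrite (CSeries_has_sum _ _ H1), (CSeries_has_sum _ _ H2).
  apply (Clim_unique eventually (fun n => csum f
    (map Z.of_nat (seq 0 n) ++ map (fun k => (- Z.of_nat k - 1)%Z) (seq 0 n)))).
  - apply (Clim_ext eventually (fun n => csum (fun k => f (Z.of_nat k)) (seq 0 n)
       + csum (fun k => f (- Z.of_nat k - 1)%Z) (seq 0 n))%C).
    { intros n. now rewrite csum_app, !csum_map. }
    assert (Hev : forall i : nat, eventually (fun n => In i (seq 0 n))).
    { intros i. exists (S i). intros n Hn. apply in_seq. lia. }
    apply Clim_plus; try apply _; apply has_sum_exhaust; auto using seq_NoDup.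
  - apply has_sum_exhaust; auto.
    + intros n. apply NoDup_app_disjoint.
      * apply FinFun.Injective_map_NoDup; [exact I1|apply seq_NoDup].
      * apply FinFun.Injective_map_NoDup; [exact I2|apply seq_NoDup].
      * intros x Hx Hx'. apply in_map_iff in Hx, Hx'.
        destruct Hx as (a & Ha & _), Hx' as (b & Hb & _). lia.
    + intros i. exists (S (Z.abs_nat i)). intros n Hn. apply in_app_iff.
      rewrite !in_map_iff. destruct (Z_lt_le_dec i 0).
      * right. exists (Z.to_nat (- i - 1)). rewrite in_seq. lia.
      * left. exists (Z.to_nat i). rewrite in_seq. lia.
Qed.

(** The three-element type [comparison] indexes the residues. *)
Definition residue3 (c : comparison) : Z :=
  match c with Eq => 0 | Lt => -1 | Gt => 1 end.

Lemma has_sum_mod3 (f : Z -> C) s s0 s1 s2 :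
  has_sum f s -> has_sum (fun i => f (3 * i)%Z) s0 ->
  has_sum (fun i => f (3 * i - 1)%Z) s1 -> has_sum (fun i => f (3 * i + 1)%Z) s2 ->
  s = (s0 + s1 + s2)%C.
Proof.
  intros H H0 H1 H2.
  assert (Hb := has_sum_bij (fun p : comparison * Z => (3 * snd p + residue3 (fst p))%Z)
    (fun n => (Z.compare n (3 * ((n + 1) / 3)), ((n + 1) / 3)%Z)) f s).
  assert (Hf := has_sum_fubini (fun p : comparison * Z => f (3 * snd p + residue3 (fst p))%Z)
    (fun c => match c with Eq => s0 | Lt => s1 | Gt => s2 end) s).
  cbv beta in Hf.
  apply (has_sum_unique (fun c => match c with Eq => s0 | Lt => s1 | Gt => s2 end)).
  - apply Hf.
    + apply Hb; auto.
      * intros n. cbn [fst snd].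
        pose proof (Z.div_mod (n + 1) 3 ltac:(lia)).
        pose proof (Z.mod_pos_bound (n + 1) 3 ltac:(lia)).
        destruct (Z.compare_spec n (3 * ((n + 1) / 3)));
          cbn [fst snd residue3]; lia.
      * intros [c i]. cbn [fst snd].
        assert (E : ((3 * i + residue3 c + 1) / 3 = i)%Z).
        { symmetry. apply Z.div_unique with (residue3 c + 1)%Z; destruct c; cbn [residue3]; lia. }
        rewrite E. f_equal.
        destruct c; cbn [residue3].
        -- apply Z.compare_eq_iff; lia.
        -- apply Z.compare_lt_iff; lia.
        -- apply Z.compare_gt_iff; lia.
    + intros c. cbn [fst snd]. destruct c.
      * eapply has_sum_ext; [|exact H0]. intros i. cbn [fst snd residue3]. f_equal; lia.
      * eapply has_sum_ext; [|exact H1]. intros i. cbn [fst snd residue3]. f_equal; lia.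
      * eapply has_sum_ext; [|exact H2]. intros i. cbn [fst snd residue3]. f_equal; lia.
  - replace (s0 + s1 + s2)%C with
     (csum (fun c => match c with Eq => s0 | Lt => s1 | Gt => s2 end) [Eq; Lt; Gt])
      by (simpl; ring).
    apply has_sum_finite.
    + repeat constructor; simpl; intuition easy.
    + intros []; simpl; intuition.
Qed.

(** * The partial fraction expansion of the cosecant *)

Lemma Csin_PI_Z w : Csin (PI * w) = 0%C -> exists k : Z, (w + RtoC (IZR k))%C = 0%C.
Proof.
  intros H. assert (H2 := Csin_mod2 (PI * w)). rewrite H, Cmod_0 in H2.
  destruct w as [p q].
  replace (Re (PI * (p, q))) with (PI * p) in H2 by (simpl; ring).
  replace (Im (PI * (p, q))) with (PI * q) in H2 by (simpl; ring).
  pose proof (pow2_ge_0 (sin (PI * p))). pose proof (pow2_ge_0 (sinh (PI * q))).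
  assert (Hs : sin (PI * p) = 0) by nra. assert (Hh : sinh (PI * q) = 0) by nra.
  assert (Hq : PI * q = 0).
  { unfold sinh in Hh. assert (exp (PI * q) = exp (- (PI * q))) by lra.
    apply exp_inv in H3. lra. }
  destruct (sin_eq_0_0 _ Hs) as [k Hk]. pose proof PI_RGT_0.
  exists (- k)%Z. rewrite opp_IZR. unfold Cplus, RtoC; simpl.
  assert (p = IZR k) by (apply Rmult_eq_reg_l with PI; lra).
  assert (q = 0) by (apply Rmult_eq_reg_l with PI; lra). subst. f_equal; ring.
Qed.

Lemma Csin_PI_neq0 w : (forall k : Z, (w + RtoC (IZR k))%C <> 0%C) -> Csin (PI * w) <> 0%C.
Proof. intros H E. destruct (Csin_PI_Z w E) as [k Hk]. now apply (H k). Qed.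

Lemma Ccos_PI_Z k : Ccos (PI * RtoC (IZR k)) = RtoC (sg k).
Proof.
  unfold Ccos. replace (Ci * (PI * IZR k))%C with (Ci * PI * IZR k)%C by ring.
  rewrite Cexp_opp, Cexp_PI_Z. unfold sg.
  destruct (Z.even k); unfold Cdiv, Cplus, Cmult, Cinv, RtoC; simpl; f_equal; field; lra.
Qed.

Definition away (d : R) (X : C) : Prop := forall n : Z, d <= Cmod (X + RtoC (IZR n)).

(** If [X + n] were close to 0 then [sin (PI (X + n))] would be small, but its modulus is that
    of [sin (PI X)] whatever [n] is. *)
Lemma away_exists X : (forall k : Z, (X + RtoC (IZR k))%C <> 0%C) ->
  exists d, 0 < d <= 1 /\ away d X.
Proof.
  intros HX. set (s := Cmod (Csin (PI * X))).
  assert (Hs : 0 < s) by (apply Cmod_gt_0, Csin_PI_neq0, HX).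
  pose proof PI_RGT_0 as HPI. pose proof PI_upper.
  exists (Rmin (1 / 4) (s / 11)). split.
  { split; [apply Rmin_pos; lra|]. eapply Rle_trans; [apply Rmin_l|lra]. }
  intros n. apply Rnot_lt_le. intros Hlt.
  assert (H1 : Cmod (X + IZR n) < 1 / 4) by (eapply Rlt_le_trans; [exact Hlt|apply Rmin_l]).
  assert (H2 : Cmod (X + IZR n) < s / 11) by (eapply Rlt_le_trans; [exact Hlt|apply Rmin_r]).
  assert (E : Cmod (Csin (PI * (X + IZR n))) = s).
  { replace (PI * (X + IZR n))%C with (PI * X + PI * IZR n)%C by ring.
    rewrite Csin_add, Ccos_PI_Z.
    rewrite <- (RtoC_mult PI), Csin_RtoC.
    rewrite (sin_eq_0_1 (PI * IZR n)) by (exists n; ring).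
    replace (Csin (PI * X) * sg n + Ccos (PI * X) * 0)%C
      with (Csin (PI * X) * sg n)%C by ring.
    rewrite Cmod_mult, sg_Cmod. unfold s; ring. }
  pose proof (Csin_le (PI * (X + IZR n))) as H3. rewrite E in H3.
  rewrite Cmod_mult, Cmod_R, Rabs_pos_eq in H3 by lra.
  pose proof (Cmod_ge_0 (X + IZR n)).
  assert (exp (PI * Cmod (X + IZR n)) <= 3).
  { eapply Rle_trans; [apply exp_le|apply exp_le_3]. nra. }
  pose proof (exp_pos (PI * Cmod (X + IZR n))).
  assert (s <= PI * Cmod (X + IZR n) * 3) by nra. nra.
Qed.

(** The product of the two distances grows like [n^2] once [n] exceeds [2 |X|]; for the finitely
    many smaller [n] the distance [d] takes over. *)
Lemma away_pair d X n : 0 < d <= 1 -> away d X ->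
  d ^ 2 * (1 + IZR n ^ 2) <=
  5 * (1 + Cmod X ^ 2) * (Cmod (X + RtoC (IZR n)) * Cmod (X - RtoC (IZR n))).
Proof.
  intros Hd Ha.
  assert (H1 := Ha n). assert (H2 := Ha (- n)%Z).
  rewrite opp_IZR, RtoC_opp in H2. fold (Cminus X (IZR n)) in H2.
  set (a := Cmod (X + IZR n)) in *. set (b := Cmod (X - IZR n)) in *.
  assert (Hn : Cmod (RtoC (IZR n)) = Rabs (IZR n)) by apply Cmod_R.
  assert (Ta : Rabs (IZR n) <= a + Cmod X).
  { rewrite <- Hn. replace (RtoC (IZR n)) with ((X + IZR n) + - X)%C at 1 by ring.
    eapply Rle_trans; [apply Cmod_triangle|]. rewrite Cmod_opp. unfold a; lra. }
  assert (Tb : Rabs (IZR n) <= b + Cmod X).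
  { rewrite <- Hn. replace (RtoC (IZR n)) with (- (X - IZR n) + X)%C at 1 by ring.
    eapply Rle_trans; [apply Cmod_triangle|]. rewrite Cmod_opp. unfold b; lra. }
  pose proof (Cmod_ge_0 X) as HX. set (x := Cmod X) in *.
  assert (Hab : d ^ 2 <= a * b).
  { replace (d ^ 2) with (d * d) by ring. apply Rmult_le_compat; lra. }
  rewrite <- (pow2_abs (IZR n)). set (N := Rabs (IZR n)) in *.
  assert (HN : 0 <= N) by apply Rabs_pos.
  assert (Hd2 : d ^ 2 <= 1) by (replace (d ^ 2) with (d * d) by ring; nra).
  pose proof (pow2_ge_0 x) as Hx2. pose proof (pow2_ge_0 N) as HN2.
  pose proof (pow2_ge_0 d) as Hd0.
  destruct (Rle_dec (2 * x) N) as [H|H].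
  - assert (N / 2 * (N / 2) <= a * b) by (apply Rmult_le_compat; lra).
    assert (d ^ 2 * N ^ 2 <= 1 * N ^ 2) by (apply Rmult_le_compat_r; lra).
    assert (0 <= x ^ 2 * (a * b)) by (apply Rmult_le_pos; lra). lra.
  - assert (N * N <= (2 * x) * (2 * x)) by (apply Rmult_le_compat; lra).
    apply Rle_trans with ((a * b) * (1 + N ^ 2)); [apply Rmult_le_compat_r; lra|].
    apply Rle_trans with ((a * b) * (5 * (1 + x ^ 2))); [|lra].
    apply Rmult_le_compat_l; lra.
Qed.

Lemma Clim_Csin_scale {T} (F : (T -> Prop) -> Prop) {FF : Filter F} (N : T -> R) w :
  F (fun k => 1 <= N k) -> filterlim (fun k => / N k) F (locally 0) ->
  Clim F (fun k => RtoC (N k / PI) * Csin (PI * w / RtoC (N k)))%C w.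
Proof.
  intros H1 H0. pose proof PI_RGT_0 as HPI.
  apply (Clim_dominated F _ w (fun k => PI * Cmod w ^ 2 * exp (PI * Cmod w) * / N k)).
  - revert H1. apply filter_imp. intros k Hk.
    assert (HN : RtoC (N k) <> 0%C) by (apply RtoC_neq0; lra).
    assert (HP : RtoC PI <> 0%C) by (apply RtoC_neq0; lra).
    replace (RtoC (N k / PI) * Csin (PI * w / N k) - w)%C
      with (RtoC (N k / PI) * (Csin (PI * w / N k) - PI * w / N k))%C.
    2:{ rewrite RtoC_div by lra. field. auto. }
    rewrite Cmod_mult, Cmod_R, Rabs_pos_eq by (left; apply Rdiv_lt_0_compat; lra).
    pose proof (Csin_near (PI * w / N k)) as H.
    rewrite Cmod_div, Cmod_mult, !Cmod_R, !Rabs_pos_eq in H by (auto; lra).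
    pose proof (Cmod_ge_0 w) as Hw.
    apply Rle_trans with (N k / PI * ((PI * Cmod w / N k) ^ 2 * exp (PI * Cmod w))).
    + apply Rmult_le_compat_l; [left; apply Rdiv_lt_0_compat; lra|].
      eapply Rle_trans; [exact H|]. apply Rmult_le_compat_l; [apply pow2_ge_0|].
      apply exp_le. apply Rle_div_l; [lra|].
      assert (0 <= PI * Cmod w) by (apply Rmult_le_pos; lra). nra.
    + right. field. split; lra.
  - replace 0 with (PI * Cmod w ^ 2 * exp (PI * Cmod w) * 0) by ring.
    apply (filterlim_comp _ _ _ (fun k => / N k)
       (fun x => PI * Cmod w ^ 2 * exp (PI * Cmod w) * x) F (locally 0)); auto.
    apply (filterlim_scal_r (K := R_AbsRing) (V := R_NormedModule)
       (PI * Cmod w ^ 2 * exp (PI * Cmod w)) 0).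
Qed.

Lemma sqrt3_sq : (RtoC (sqrt 3) * RtoC (sqrt 3))%C = RtoC 3.
Proof. rewrite <- RtoC_mult, sqrt_sqrt by lra. easy. Qed.

Lemma Csin_triple u : Csin (3 * u) = (3 * Csin u - 4 * (Csin u * Csin u * Csin u))%C.
Proof.
  replace (3 * u)%C with (u + (u + u))%C by ring.
  assert (E : Ccos (u + u) = (Ccos u * Ccos u - Csin u * Csin u)%C).
  { unfold Ccos, Csin. rewrite !Cexp_opp.
    replace (Ci * (u + u))%C with (Ci * u + Ci * u)%C by ring. rewrite Cexp_add.
    pose proof (Cexp_neq0 (Ci * u)) as H. set (e := Cexp (Ci * u)) in *.
    replace ((e - / e) / (2 * Ci) * ((e - / e) / (2 * Ci)))%C
      with ((e - / e) * (e - / e) / (4 * (Ci * Ci)))%C.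
    - rewrite Ci_sq. field. auto.
    - field. repeat split; auto using Ci_neq0, C2_neq0. }
  rewrite (Csin_add u (u + u)), E, (Csin_add u u).
  assert (H := Csin2_Ccos2 u).
  replace (Ccos u * (Csin u * Ccos u + Ccos u * Csin u))%C
    with (2 * Csin u * (Ccos u * Ccos u))%C by ring.
  replace (Ccos u * Ccos u)%C with (1 - Csin u * Csin u)%C by (rewrite <- H; ring).
  ring.
Qed.

(** With [s = sin u] and [s1, s2] the two neighbouring sines, [s1 + s2 = s] and
    [s1 s2 = s^2 - 3/4], while [sin (3u) = - 4 s s1 s2]. *)
Lemma Csin_third u : Csin u <> 0%C -> Csin (u + RtoC (PI / 3)) <> 0%C ->
  Csin (u - RtoC (PI / 3)) <> 0%C ->
  (/ Csin u - / Csin (u + RtoC (PI / 3)) - / Csin (u - RtoC (PI / 3)))%C = (3 / Csin (3 * u))%C.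
Proof.
  intros Ha Hb Hd.
  assert (Hsum : (Csin (u + RtoC (PI / 3)) + Csin (u - RtoC (PI / 3)))%C = Csin u).
  { rewrite Csin_add, Csin_sub, Ccos_RtoC, cos_PI3, RtoC_div by lra. field. }
  assert (Hprod : (Csin (u + RtoC (PI / 3)) * Csin (u - RtoC (PI / 3)))%C
     = (Csin u * Csin u - 3 / 4)%C).
  { rewrite Csin_add, Csin_sub, Csin_RtoC, Ccos_RtoC, sin_PI3, cos_PI3.
    assert (H := Csin2_Ccos2 u). assert (H3 := sqrt3_sq).
    rewrite !RtoC_div by lra.
    set (s := Csin u) in *. set (c := Ccos u) in *. set (r := RtoC (sqrt 3)) in *.
    assert (Hc : (c * c)%C = (1 - s * s)%C) by (rewrite <- H; ring).
    replace ((s * (1 / 2) + c * (r / 2)) * (s * (1 / 2) - c * (r / 2)))%C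
      with ((s * s - (c * c) * (r * r)) / 4)%C by field.
    rewrite Hc, H3. field. }
  rewrite Csin_triple.
  set (p := Csin (u + RtoC (PI / 3))) in *. set (m := Csin (u - RtoC (PI / 3))) in *.
  set (s := Csin u) in *.
  replace (3 * s - 4 * (s * s * s))%C with (- (4 * (s * (p * m))))%C by (rewrite Hprod; field).
  replace (/ s - / p - / m)%C with ((p * m - s * (p + m)) / (s * (p * m)))%C by (field; auto).
  rewrite Hsum. replace (s * s)%C with (p * m + 3 / 4)%C by (rewrite Hprod; field).
  field. auto.
Qed.

(** ** The finite identity *)

Fixpoint h3 (K : nat) : nat := match K with O => 0 | S K' => 3 * h3 K' + 1 end.

Lemma h3_pow K : 2 * INR (h3 K) + 1 = 3 ^ K.
Proof.
  induction K as [|K IH]; [simpl; ring|].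
  cbn [h3 pow]. rewrite plus_INR, mult_INR, <- IH. simpl. ring.
Qed.

Lemma zlist_triple h : Permutation (zlist (3 * h + 1))
  (map (fun l => 3 * l)%Z (zlist h) ++ map (fun l => 3 * l + 1)%Z (zlist h)
   ++ map (fun l => 3 * l + -1)%Z (zlist h)).
Proof.
  apply NoDup_Permutation; [apply zlist_NoDup| |].
  - assert (Hm : forall c, NoDup (map (fun l => 3 * l + c)%Z (zlist h))).
    { intros c. apply FinFun.Injective_map_NoDup; [|apply zlist_NoDup]. intros a b; lia. }
    apply NoDup_app_disjoint; [|apply NoDup_app_disjoint|].
    + rewrite (map_ext _ (fun l => 3 * l + 0)%Z) by (intros; lia). apply Hm.
    + apply Hm.
    + apply (Hm (-1)%Z).
    + intros x Hx Hx'. apply in_map_iff in Hx, Hx'.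
      destruct Hx as (a & Ha & _), Hx' as (b & Hb & _). lia.
    + intros x Hx Hx'. apply in_app_iff in Hx. rewrite !in_map_iff in Hx.
      apply in_map_iff in Hx'. destruct Hx' as (b & Hb & _).
      destruct Hx as [(a & Ha & _)|(a & Ha & _)]; lia.
  - intros x. rewrite !in_app_iff, !in_map_iff, zlist_In. split.
    + intros Hx.
      pose proof (Z.div_mod (x + 1) 3 ltac:(lia)).
      pose proof (Z.mod_pos_bound (x + 1) 3 ltac:(lia)).
      set (q := ((x + 1) / 3)%Z) in *. set (r := ((x + 1) mod 3)%Z) in *.
      assert (Hr : (r = 0 \/ r = 1 \/ r = 2)%Z) by lia.
      destruct Hr as [Hr|[Hr|Hr]].
      * right; right. exists q. rewrite zlist_In. lia.
      * left. exists q. rewrite zlist_In. lia.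
      * right; left. exists q. rewrite zlist_In. lia.
    + intros [(a & Ha & Hi)|[(a & Ha & Hi)|(a & Ha & Hi)]]; apply zlist_In in Hi; lia.
Qed.

Lemma not_int_third X e : (forall k : Z, (X + RtoC (IZR k))%C <> 0%C) ->
  forall k : Z, ((X + RtoC (IZR e)) / 3 + RtoC (IZR k))%C <> 0%C.
Proof.
  intros HX k E. apply (HX (e + 3 * k)%Z).
  replace (X + RtoC (IZR (e + 3 * k)))%C with (3 * ((X + RtoC (IZR e)) / 3 + RtoC (IZR k)))%C.
  - rewrite E; ring.
  - rewrite plus_IZR, mult_IZR, RtoC_plus, RtoC_mult. field.
Qed.

(** Iterating [Csin_third]: each cosecant is replaced by three cosecants of a third of the
    argument, shifted by multiples of [PI / 3], until the [3^K] shifts fill a symmetric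
    interval. *)
Lemma csc_finite K X : (forall k : Z, (X + RtoC (IZR k))%C <> 0%C) ->
  csum (fun l => RtoC (sg l) / Csin (PI * (X + RtoC (IZR l)) / RtoC (3 ^ K)))%C (zlist (h3 K))
  = (RtoC (3 ^ K) / Csin (PI * X))%C.
Proof.
  revert X; induction K as [|K IH]; intros X HX.
  - simpl. unfold sg; simpl. replace (PI * (X + 0) / 1)%C with (PI * X)%C by field. ring.
  - cbn [h3]. rewrite (csum_perm _ _ _ (zlist_triple (h3 K))), !csum_app, !csum_map.
    assert (He : forall e, csum (fun l => RtoC (sg (3 * l + e)) /
        Csin (PI * (X + RtoC (IZR (3 * l + e))) / RtoC (3 ^ S K)))%C (zlist (h3 K)) =
        (RtoC (sg e) * (RtoC (3 ^ K) / Csin (PI * ((X + RtoC (IZR e)) / 3))))%C).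
    { intros e. rewrite <- IH by now apply not_int_third.
      rewrite <- csum_scal. apply csum_ext. intros l _.
      replace (sg (3 * l + e)) with (sg e * sg l).
      2:{ rewrite sg_add. replace (3 * l)%Z with (l + (l + l))%Z by lia.
          rewrite !sg_add, sg_sq. ring. }
      replace (PI * (X + RtoC (IZR (3 * l + e))) / RtoC (3 ^ S K))%C
        with (PI * ((X + IZR e) / 3 + IZR l) / RtoC (3 ^ K))%C.
      2:{ cbn [pow]. rewrite plus_IZR, mult_IZR, RtoC_plus, !RtoC_mult. field.
          apply RtoC_neq0, pow_nonzero; lra. }
      rewrite RtoC_mult. unfold Cdiv. ring. }
    rewrite (csum_ext (fun j => RtoC (sg (3 * j)) / _)%C
       (fun l => RtoC (sg (3 * l + 0)) /
        Csin (PI * (X + RtoC (IZR (3 * l + 0))) / RtoC (3 ^ S K)))%C)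
      by (intros i _; now rewrite Z.add_0_r).
    rewrite !He.
    assert (HX3 : forall e, Csin (PI * ((X + RtoC (IZR e)) / 3)) <> 0%C).
    { intros e. now apply Csin_PI_neq0, not_int_third. }
    assert (T := Csin_third (PI * X / 3)).
    replace (PI * X / 3 + RtoC (PI / 3))%C with (PI * ((X + IZR 1) / 3))%C in T
      by (rewrite RtoC_div by lra; field).
    replace (PI * X / 3 - RtoC (PI / 3))%C with (PI * ((X + IZR (-1)) / 3))%C in T.
    2:{ rewrite RtoC_div by lra.
        replace (RtoC (-1)) with (- (1))%C by (unfold Copp, RtoC; simpl; f_equal; ring). field. }
    replace (PI * X / 3)%C with (PI * ((X + IZR 0) / 3))%C in T by field.
    specialize (T (HX3 0%Z) (HX3 1%Z) (HX3 (-1)%Z)).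
    replace (3 * (PI * ((X + IZR 0) / 3)))%C with (PI * X)%C in T by field.
    unfold sg; simpl Z.even; cbv iota.
    replace (RtoC (-1)) with (- (1))%C at 1 2 by (unfold Copp, RtoC; simpl; f_equal; ring).
    transitivity (RtoC (3 ^ K) * (3 / Csin (PI * X)))%C.
    + rewrite <- T. unfold Cdiv. ring.
    + cbn [pow]. rewrite RtoC_mult. unfold Cdiv. ring.
Qed.

(** ** The limit of the finite identities *)

Lemma csum_zlist_opp (g : Z -> C) h :
  csum (fun l => g (- l)%Z) (zlist h) = csum g (zlist h).
Proof.
  rewrite <- (csum_map g Z.opp). apply csum_perm, NoDup_Permutation.
  - apply FinFun.Injective_map_NoDup; [|apply zlist_NoDup]. intros a b; lia.
  - apply zlist_NoDup.
  - intros x. rewrite in_map_iff, zlist_In. split.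
    + intros (y & <- & Hy). apply zlist_In in Hy. lia.
    + intros Hx. exists (- x)%Z. rewrite zlist_In. lia.
Qed.

Lemma has_sum_zlist_finite (f : Z -> C) h :
  has_sum (fun l => if in_dec eqdec l (zlist h) then f l else 0%C) (csum f (zlist h)).
Proof.
  rewrite (csum_ext f (fun l => if in_dec eqdec l (zlist h) then f l else 0%C) (zlist h)).
  - apply has_sum_finite; [apply zlist_NoDup|].
    intros i Hi. now destruct (in_dec eqdec i (zlist h)).
  - intros i Hi. now destruct (in_dec eqdec i (zlist h)).
Qed.

Lemma Clim_zlist_indicator {T} (F : (T -> Prop) -> Prop) {FF : Filter F}
  (f : T -> Z -> C) (h : T -> nat) l c :
  filterlim h F eventually -> Clim F (fun k => f k l) c ->
  Clim F (fun k => if in_dec eqdec l (zlist (h k)) then f k l else 0%C) c.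
Proof.
  intros Hh Hf. apply (Clim_ext_loc F (fun k => f k l)); auto.
  generalize (Hh _ (zlist_eventually l)). unfold filtermap. apply filter_imp.
  intros k Hk. now destruct (in_dec eqdec l (zlist (h k))).
Qed.

(** [1/sin(a+b) + 1/sin(a-b) = 2 sin a cos b / (sin(a+b) sin(a-b))], so for symmetric pairs
    the finite identity has terms of size [1/l^2]. *)
Lemma csc_pair_bound N X l : 1 <= N -> 100 * Cmod X <= N -> Rabs (IZR l) <= N / 2 ->
  (forall k : Z, (X + RtoC (IZR k))%C <> 0%C) ->
  Cmod (RtoC (PI / N) / Csin (PI * (X + RtoC (IZR l)) / RtoC N)
      + RtoC (PI / N) / Csin (PI * (X - RtoC (IZR l)) / RtoC N)) <=
  100 * Cmod X / (Cmod (X + RtoC (IZR l)) * Cmod (X - RtoC (IZR l))).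
Proof.
  intros HN HX Hl Hint. pose proof PI_RGT_0 as HP. pose proof PI_upper as HP'.
  assert (HNC : RtoC N <> 0%C) by (apply RtoC_neq0; lra).
  assert (Hp := Hint l). assert (Hm := Hint (- l)%Z).
  rewrite opp_IZR, RtoC_opp in Hm. fold (Cminus X (IZR l)) in Hm.
  assert (Hlow : forall w, Rabs (Re w) <= 0.51 * N ->
    PI / N * Cmod w / 4 <= Cmod (Csin (PI * w / N))).
  { intros w Hw. eapply Rle_trans; [|apply Csin_lower].
    - rewrite Cmod_div, Cmod_mult, !Cmod_R, !Rabs_pos_eq by (auto; lra).
      right; field; lra.
    - replace (Re (PI * w / N)) with (PI * Re w / N).
      2:{ destruct w; unfold Cdiv, Cinv, Cmult, RtoC, Re; simpl. field; lra. }
      unfold Rdiv. rewrite !Rabs_mult, (Rabs_pos_eq PI), (Rabs_pos_eq (/ N)) by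
        (try left; try apply Rinv_0_lt_compat; lra).
      apply Rle_div_l; [lra|]. pose proof (Rabs_pos (Re w)). nra. }
  assert (HRe := re_le_Cmod X). 
  assert (Hx : Cmod X <= N / 100) by lra.
  assert (Bp := Hlow (X + IZR l)%C). assert (Bm := Hlow (X - IZR l)%C).
  specialize (Bp ltac:(
    replace (Re (X + IZR l)) with (Re X + IZR l) by (destruct X; reflexivity);
    eapply Rle_trans; [apply Rabs_triang|]; lra)).
  specialize (Bm ltac:(
    replace (Re (X - IZR l)) with (Re X + - IZR l) by (destruct X; reflexivity);
    eapply Rle_trans; [apply Rabs_triang|]; rewrite Rabs_Ropp; lra)).
  set (wp := (X + IZR l)%C) in *. set (wm := (X - IZR l)%C) in *.
  assert (Hwp : 0 < Cmod wp) by now apply Cmod_gt_0.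
  assert (Hwm : 0 < Cmod wm) by now apply Cmod_gt_0.
  assert (HPN : 0 < PI / N) by (apply Rdiv_lt_0_compat; lra).
  set (sp := Csin (PI * wp / N)) in *. set (sm := Csin (PI * wm / N)) in *.
  assert (Hsp : 0 < PI / N * Cmod wp / 4).
  { apply Rdiv_lt_0_compat; [|lra]. now apply Rmult_lt_0_compat. }
  assert (Hsm : 0 < PI / N * Cmod wm / 4).
  { apply Rdiv_lt_0_compat; [|lra]. now apply Rmult_lt_0_compat. }
  assert (Np : sp <> 0%C) by (apply Cmod_gt_0; lra).
  assert (Nm : sm <> 0%C) by (apply Cmod_gt_0; lra).
  assert (Hsum : (sp + sm)%C = (2 * Csin (PI * X / N) * RtoC (cos (PI * IZR l / N)))%C).
  { unfold sp, sm, wp, wm.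
    replace (PI * (X + IZR l) / N)%C with (PI * X / N + RtoC (PI * IZR l / N))%C
      by (rewrite RtoC_div, RtoC_mult by lra; field; auto).
    replace (PI * (X - IZR l) / N)%C with (PI * X / N - RtoC (PI * IZR l / N))%C
      by (rewrite RtoC_div, RtoC_mult by lra; field; auto).
    rewrite Csin_add, Csin_sub, Ccos_RtoC. ring. }
  replace (RtoC (PI / N) / sp + RtoC (PI / N) / sm)%C
    with (RtoC (PI / N) * (sp + sm) / (sp * sm))%C by (field; auto).
  rewrite Hsum, Cmod_div, !Cmod_mult, !Cmod_R by (apply Cmult_neq_0; auto).
  rewrite (Rabs_pos_eq (PI / N)), (Rabs_pos_eq 2) by lra.
  assert (Hs : Cmod (Csin (PI * X / N)) <= 3 * (PI / N * Cmod X)).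
  { eapply Rle_trans; [apply Csin_le|].
    rewrite Cmod_div, Cmod_mult, !Cmod_R, !Rabs_pos_eq by (auto; lra).
    replace (PI * Cmod X / N) with (PI / N * Cmod X) by (field; lra).
    pose proof (Cmod_ge_0 X).
    assert (PI / N * Cmod X <= 1).
    { replace (PI / N * Cmod X) with (PI * Cmod X / N) by (field; lra).
      apply Rle_div_l; [lra|]. nra. }
    assert (exp (PI / N * Cmod X) <= 3).
    { eapply Rle_trans; [apply exp_le|apply exp_le_3]. auto. }
    assert (0 <= PI / N * Cmod X) by (apply Rmult_le_pos; lra). nra. }
  assert (Hc : Rabs (cos (PI * IZR l / N)) <= 1).
  { apply Rabs_le, COS_bound. }
  pose proof (Cmod_ge_0 (Csin (PI * X / N))) as Hs0.
  pose proof (Rabs_pos (cos (PI * IZR l / N))) as Hc0. pose proof (Cmod_ge_0 X) as HX0.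
  set (A := PI / N) in *.
  apply Rle_trans with (A * (2 * (3 * (A * Cmod X)) * 1)
     / ((A * Cmod wp / 4) * (A * Cmod wm / 4))).
  - unfold Rdiv at 1 2. apply Rmult_le_compat.
    + apply Rmult_le_pos; [lra|]. apply Rmult_le_pos; lra.
    + left. apply Rinv_0_lt_compat. apply Rmult_lt_0_compat; lra.
    + apply Rmult_le_compat_l; [lra|]. apply Rmult_le_compat; lra.
    + apply Rinv_le_contravar; [now apply Rmult_lt_0_compat|].
      apply Rmult_le_compat; lra.
  - replace (A * (2 * (3 * (A * Cmod X)) * 1) / ((A * Cmod wp / 4) * (A * Cmod wm / 4)))
      with (96 * Cmod X / (Cmod wp * Cmod wm)) by (field; lra).
    unfold Rdiv. apply Rmult_le_compat_r; [|lra].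
    left. apply Rinv_0_lt_compat. now apply Rmult_lt_0_compat.
Qed.

Lemma pow3_ge K : INR K + 1 <= 3 ^ K.
Proof.
  induction K as [|K IH]; [simpl; lra|].
  rewrite S_INR. cbn [pow]. pose proof (pos_INR K). lra.
Qed.

Lemma filterlim_inv_pow3 : filterlim (fun K => / 3 ^ K) eventually (locally 0).
Proof.
  assert (H := is_lim_seq_geom (/ 3)). rewrite Rabs_pos_eq in H by lra.
  specialize (H ltac:(lra)).
  change (is_lim_seq (fun K => / 3 ^ K) 0).
  eapply is_lim_seq_ext; [|exact H]. intros K. simpl. now rewrite pow_inv.
Qed.

(** The terms are averaged over [n] and [- n]: the expansion of the cosecant converges only
    conditionally, and this average makes it absolutely convergent without changing the sum over
    a symmetric interval. *)
Lemma csc_partial_fractions X : (forall k : Z, (X + RtoC (IZR k))%C <> 0%C) ->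
  has_sum (fun n => RtoC (sg n) * ((/ (X + RtoC (IZR n)) + / (X - RtoC (IZR n))) / 2))%C
    (PI / Csin (PI * X))%C.
Proof.
  intros HX. destruct (away_exists X HX) as (d & Hd & Ha).
  assert (Hd2 : 0 < d ^ 2) by (apply pow_lt; lra).
  set (f0 := fun n : Z => (RtoC (sg n) * ((/ (X + RtoC (IZR n)) + / (X - RtoC (IZR n))) / 2))%C).
  set (a := fun (K : nat) (w : C) => (RtoC (PI / 3 ^ K) / Csin (PI * w / RtoC (3 ^ K)))%C).
  set (f1 := fun K l => (RtoC (sg l) * ((a K (X + RtoC (IZR l)) + a K (X - RtoC (IZR l))) / 2))%C).
  set (f := fun K l => if in_dec eqdec l (zlist (h3 K)) then f1 K l else 0%C).
  set (B := 500 * Cmod X * (1 + Cmod X ^ 2) / d ^ 2).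
  pose proof (Cmod_ge_0 X) as HX0.
  assert (HB : 0 <= B).
  { apply Rmult_le_pos; [|left; now apply Rinv_0_lt_compat].
    pose proof (pow2_ge_0 (Cmod X)). apply Rmult_le_pos; lra. }
  assert (Hg : summable (fun n : Z => B * / (1 + IZR n ^ 2)))
    by (apply summable_scal; [exact HB|apply summable_inv_sq]).
  assert (HN : forall K, 0 < 3 ^ K) by (intros; apply pow_lt; lra).
  assert (Hm : forall l, (X - RtoC (IZR l))%C <> 0%C).
  { intros l. unfold Cminus. rewrite <- RtoC_opp, <- opp_IZR. apply HX. }
  assert (Hpq : forall l, Cmod X / (Cmod (X + IZR l) * Cmod (X - IZR l)) * 100
     <= B * / (1 + IZR l ^ 2)).
  { intros l. assert (H := away_pair d X l Hd Ha).
    assert (H1 : 0 < Cmod (X + IZR l)) by now apply Cmod_gt_0.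
    assert (H2 : 0 < Cmod (X - IZR l)) by now apply Cmod_gt_0.
    pose proof (pow2_ge_0 (IZR l)).
    set (P := Cmod (X + IZR l) * Cmod (X - IZR l)) in *.
    assert (HP : 0 < P) by now apply Rmult_lt_0_compat.
    unfold B. apply Rmult_le_reg_r with (P * d ^ 2 * (1 + IZR l ^ 2)).
    { apply Rmult_lt_0_compat; [|lra]. now apply Rmult_lt_0_compat. }
    replace (Cmod X / P * 100 * (P * d ^ 2 * (1 + IZR l ^ 2)))
      with (100 * Cmod X * (d ^ 2 * (1 + IZR l ^ 2))) by (field; lra).
    replace (500 * Cmod X * (1 + Cmod X ^ 2) / d ^ 2 * / (1 + IZR l ^ 2) *
      (P * d ^ 2 * (1 + IZR l ^ 2)))
      with (100 * Cmod X * (5 * (1 + Cmod X ^ 2) * P)) by (field; split; lra).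
    apply Rmult_le_compat_l; lra. }
  assert (Hbound : eventually (fun K => forall l, Cmod (f K l) <= B * / (1 + IZR l ^ 2))).
  { exists (Z.to_nat (up (100 * Cmod X))). intros K HK l. unfold f.
    destruct (in_dec eqdec l (zlist (h3 K))) as [Hl|Hl].
    2:{ rewrite Cmod_0. apply Rmult_le_pos; auto. left. apply Rinv_0_lt_compat.
        pose proof (pow2_ge_0 (IZR l)). lra. }
    apply zlist_In in Hl. unfold f1, a.
    assert (HK3 : 100 * Cmod X <= 3 ^ K).
    { pose proof (pow3_ge K). destruct (archimed (100 * Cmod X)) as [A1 _].
      assert (IZR (up (100 * Cmod X)) <= INR K).
      { rewrite INR_IZR_INZ. apply IZR_le. lia. }
      lra. }
    assert (Hl2 : Rabs (IZR l) <= 3 ^ K / 2).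
    { rewrite <- h3_pow. rewrite <- abs_IZR.
      apply Rle_trans with (INR (h3 K)); [|lra].
      rewrite INR_IZR_INZ. apply IZR_le. lia. }
    assert (1 <= 3 ^ K) by (pose proof (pow3_ge K); pose proof (pos_INR K); lra).
    assert (HH := csc_pair_bound (3 ^ K) X l H HK3 Hl2 HX).
    rewrite Cmod_mult, sg_Cmod, Cmod_div, (Cmod_R 2), (Rabs_pos_eq 2) by (apply C2_neq0 || lra).
    specialize (Hpq l). 
    assert (0 <= Cmod (X + IZR l) * Cmod (X - IZR l)) by (apply Rmult_le_pos; apply Cmod_ge_0).
    match type of HH with ?u <= _ => pose proof (Cmod_ge_0 (RtoC (PI / 3 ^ K) / Csin (PI * (X + IZR l) / RtoC (3 ^ K)) + RtoC (PI / 3 ^ K) / Csin (PI * (X - IZR l) / RtoC (3 ^ K)))); set (U := u) in * end.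
    replace (100 * Cmod X / (Cmod (X + IZR l) * Cmod (X - IZR l)))
      with (Cmod X / (Cmod (X + IZR l) * Cmod (X - IZR l)) * 100) in HH by (unfold Rdiv; ring).
    lra. }
  assert (Hah : filterlim h3 eventually eventually).
  { intros P [n Hn]. exists n. intros K HK. apply Hn.
    apply Nat.le_trans with K; auto. clear. induction K; cbn [h3]; lia. }
  assert (Halim : forall w : C, w <> 0%C -> Clim eventually (fun K => a K w) (/ w)%C).
  { intros w Hw. unfold a.
    assert (H := Clim_Csin_scale eventually (fun K => 3 ^ K) w
       ltac:(apply filter_forall; intros K; pose proof (pow3_ge K); pose proof (pos_INR K); lra)
       filterlim_inv_pow3).
    assert (Hw0 : 0 < Cmod w) by (apply Cmod_gt_0; exact Hw).
    assert (Hne := H (Cmod w) Hw0).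
    apply (Clim_inv eventually _ w Hw) in H. revert H. apply Clim_ext_loc; [apply _|].
    revert Hne. apply filter_imp. intros K HK. specialize (HN K). pose proof PI_RGT_0.
    assert (Csin (PI * w / RtoC (3 ^ K)) <> 0%C).
    { intros E. rewrite E in HK. replace (RtoC (3 ^ K / PI) * 0 - w)%C with (- w)%C in HK by ring.
      rewrite Cmod_opp in HK. lra. }
    rewrite !RtoC_div by lra. field.
    repeat split; auto; apply RtoC_neq0; lra. }
  assert (Hlim : forall l, Clim eventually (fun K => f K l) (f0 l)).
  { intros l. apply Clim_zlist_indicator; auto; [apply _|].
    unfold f1, f0. apply Clim_scal; [apply _|]. unfold Cdiv.
    apply Clim_mult; [apply _| |apply Clim_const, _].
    apply Clim_plus; [apply _| |]; apply Halim; auto. }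
  assert (Hsum : forall K, has_sum (f K) (PI / Csin (PI * X))%C).
  { intros K. unfold f. replace (PI / Csin (PI * X))%C with (csum (f1 K) (zlist (h3 K))).
    - apply has_sum_zlist_finite.
    - set (G := fun l : Z => (RtoC (sg l) / Csin (PI * (X + RtoC (IZR l)) / RtoC (3 ^ K)))%C).
      rewrite (csum_ext (f1 K) (fun l => (RtoC (PI / 3 ^ K) / 2) * (G l + G (- l)%Z))%C).
      + rewrite csum_scal, csum_plus, csum_zlist_opp. unfold G. rewrite csc_finite by auto.
        specialize (HN K). rewrite RtoC_div by lra. field.
        split; [now apply Csin_PI_neq0|apply RtoC_neq0; lra].
      + intros l _. unfold f1, G, a. rewrite sg_opp, opp_IZR, RtoC_opp.
        unfold Cdiv, Cminus. ring. }
  assert (Hb0 : forall l, Cmod (f0 l) <= B * / (1 + IZR l ^ 2)).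
  { intros l. apply (Clim_bound eventually (fun K => f K l)); auto.
    revert Hbound. apply filter_imp. auto. }
  destruct (summable_has_sum f0 _ Hg Hb0) as [S HS].
  replace (PI / Csin (PI * X))%C with S; [exact HS|].
  apply (Clim_unique eventually (fun K => PI / Csin (PI * X))%C).
  - apply (has_sum_lim eventually f f0 _ (fun _ => PI / Csin (PI * X))%C S Hg); auto.
    apply filter_forall. auto.
  - apply Clim_const, _.
Qed.

(** * The theta transformation *)

(** Fourier coefficients of [cos^(2M)], that is [binomial(2M, M+s) / 4^M]. *)
Fixpoint cosc (M : nat) (s : Z) : R :=
  match M with
  | O => if Z.eqb s 0 then 1 else 0
  | S M' => (cosc M' (s - 1) + 2 * cosc M' s + cosc M' (s + 1)) / 4
  end.

Lemma cosc_nonneg M s : 0 <= cosc M s.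
Proof.
  revert s; induction M as [|M IH]; intros s; cbn [cosc].
  - destruct (Z.eqb s 0); lra.
  - pose proof (IH (s - 1)%Z). pose proof (IH s). pose proof (IH (s + 1)%Z). lra.
Qed.

Lemma cosc_opp M s : cosc M (- s) = cosc M s.
Proof.
  revert s; induction M as [|M IH]; intros s; cbn [cosc].
  - destruct (Z.eqb_spec s 0), (Z.eqb_spec (- s) 0); auto; lia.
  - replace (- s - 1)%Z with (- (s + 1))%Z by lia.
    replace (- s + 1)%Z with (- (s - 1))%Z by lia. rewrite !IH. lra.
Qed.

(** The quotient of neighbouring binomial coefficients, as a two-term relation free of
    divisions, hence valid outside the support as well. *)
Lemma cosc_ratio M s :
  (INR M + IZR s + 1) * cosc M (s + 1) = (INR M - IZR s) * cosc M s.
Proof.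
  revert s; induction M as [|M IH]; intros s.
  - cbn [cosc]. change (INR 0) with 0.
    destruct (Z.eqb_spec (s + 1) 0), (Z.eqb_spec s 0); try lia; subst; try lra.
    replace (IZR s) with (-1); [lra|]. replace s with (-1)%Z by lia. lra.
  - cbn [cosc]. rewrite S_INR. replace (s + 1 - 1)%Z with s by lia.
    pose proof (IH (s - 1)%Z) as H1. pose proof (IH s) as H2. pose proof (IH (s + 1)%Z) as H3.
    replace (s - 1 + 1)%Z with s in H1 by lia.
    rewrite minus_IZR in H1. rewrite plus_IZR in H3. 
    set (a := cosc M (s - 1)) in *. set (b := cosc M s) in *.
    set (c := cosc M (s + 1)) in *. set (d := cosc M (s + 1 + 1)) in *.
    nra.
Qed.

Lemma cosc_support M s : (Z.of_nat M < s)%Z -> cosc M s = 0.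
Proof.
  revert s; induction M as [|M IH]; intros s Hs; cbn [cosc].
  - destruct (Z.eqb_spec s 0); [lia|auto].
  - rewrite !IH by lia. lra.
Qed.

Lemma cosc_has_sum M (phi : C) :
  has_sum (fun s => RtoC (cosc M s) * Cexp (2 * Ci * RtoC (IZR s) * phi))%C
    (Ccos phi ^ (2 * M))%C.
Proof.
  induction M as [|M IH].
  - replace (Ccos phi ^ (2 * 0))%C with
      (csum (fun s => RtoC (cosc 0 s) * Cexp (2 * Ci * RtoC (IZR s) * phi))%C [0%Z]).
    + apply has_sum_finite; [repeat constructor; auto|].
      intros s Hs. cbn [cosc]. destruct (Z.eqb_spec s 0) as [->|_].
      * exfalso; apply Hs; now left.
      * ring.
    + simpl. replace (2 * Ci * 0 * phi)%C with (RtoC 0) by ring. rewrite Cexp_0. ring.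
  - set (E := fun s : Z => Cexp (2 * Ci * RtoC (IZR s) * phi)) in *.
    assert (HE : forall s c, E (s + c)%Z = (E s * E c)%C).
    { intros s c. unfold E. rewrite <- Cexp_add. f_equal.
      rewrite plus_IZR, RtoC_plus. ring. }
    assert (Hsh : forall c, has_sum (fun s => RtoC (cosc M (s - c)%Z) * E s)%C
       (E c * Ccos phi ^ (2 * M))%C).
    { intros c. apply has_sum_scal with (c := E c) in IH.
      apply (has_sum_bij (fun s => (s - c)%Z) (fun s => (s + c)%Z)) in IH; try (intros; lia).
      revert IH. apply has_sum_ext. intros s. cbv beta.
      replace (E s) with (E (s - c + c)%Z) by (f_equal; lia). rewrite HE. unfold E. ring. }
    assert (H := has_sum_scal (1 / 4) _ _ (has_sum_plus _ _ _ _ (Hsh 1%Z)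
       (has_sum_plus _ _ _ _ (has_sum_scal 2 _ _ (Hsh 0%Z)) (Hsh (-1)%Z)))).
    replace (Ccos phi ^ (2 * S M))%C with
     (1 / 4 * (E 1%Z * Ccos phi ^ (2 * M) +
      (2 * (E 0%Z * Ccos phi ^ (2 * M)) + E (-1)%Z * Ccos phi ^ (2 * M))))%C.
    + revert H. apply has_sum_ext. intros s. cbv beta. cbn [cosc].
      replace (s - 0)%Z with s by lia. replace (s - -1)%Z with (s + 1)%Z by lia.
      rewrite RtoC_div, !RtoC_plus, RtoC_mult by lra. unfold E. field.
    + replace (2 * S M)%nat with (S (S (2 * M))) by lia. cbn [Cpow].
      set (P := (Ccos phi ^ (2 * M))%C).
      assert (E0 : E 0%Z = 1%C).
      { unfold E. replace (2 * Ci * 0 * phi)%C with (RtoC 0) by ring. apply Cexp_0. }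
      assert (E1 : E 1%Z = (Cexp (Ci * phi) * Cexp (Ci * phi))%C).
      { unfold E. rewrite <- Cexp_add. f_equal. ring. }
      assert (Em : E (-1)%Z = (Cexp (- (Ci * phi)) * Cexp (- (Ci * phi)))%C).
      { unfold E. rewrite <- Cexp_add. f_equal.
        replace (RtoC (-1)) with (- (1))%C by (unfold Copp, RtoC; simpl; f_equal; ring). ring. }
      rewrite E0, E1, Em. unfold Ccos. rewrite Cexp_opp.
      pose proof (Cexp_neq0 (Ci * phi)). field. auto.
Qed.

(** Multiplication by [sin] turns the coefficients into differences of neighbours, with
    half-integral frequencies. *)
Lemma sin_cosc_has_sum M (phi : C) :
  has_sum (fun s => RtoC ((cosc M s - cosc M (s + 1)) / 2) / Ci
     * Cexp (Ci * RtoC (2 * IZR s + 1) * phi))%C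
    (Csin phi * Ccos phi ^ (2 * M))%C.
Proof.
  assert (H := cosc_has_sum M phi).
  assert (H1 := has_sum_scal (Cexp (Ci * phi) / (2 * Ci)) _ _ H).
  assert (H2 := has_sum_scal (Cexp (- (Ci * phi)) / (2 * Ci)) _ _ H).
  apply (has_sum_bij (fun s => (s + 1)%Z) (fun s => (s - 1)%Z)) in H2; try (intros; lia).
  assert (H3 := has_sum_minus _ _ _ _ H1 H2).
  replace (Csin phi * Ccos phi ^ (2 * M))%C with
    (Cexp (Ci * phi) / (2 * Ci) * Ccos phi ^ (2 * M)
     - Cexp (- (Ci * phi)) / (2 * Ci) * Ccos phi ^ (2 * M))%C.
  2:{ unfold Csin. field. repeat split; auto using C2_neq0, Ci_neq0. }
  revert H3. apply has_sum_ext. intros s. cbv beta.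
  assert (E1 : Cexp (Ci * RtoC (2 * IZR s + 1) * phi)
    = (Cexp (Ci * phi) * Cexp (2 * Ci * IZR s * phi))%C).
  { rewrite <- Cexp_add. f_equal. rewrite RtoC_plus, RtoC_mult. ring. }
  assert (E2 : Cexp (Ci * RtoC (2 * IZR s + 1) * phi)
    = (Cexp (- (Ci * phi)) * Cexp (2 * Ci * IZR (s + 1) * phi))%C).
  { rewrite <- Cexp_add. f_equal. rewrite plus_IZR, !RtoC_plus, RtoC_mult. ring. }
  replace (Cexp (Ci * phi) / (2 * Ci) * (RtoC (cosc M s) * Cexp (2 * Ci * RtoC (IZR s) * phi)))%C
   with (RtoC (cosc M s) / (2 * Ci) * Cexp (Ci * RtoC (2 * IZR s + 1) * phi))%C
   by (rewrite E1; unfold Cdiv; ring).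
  replace (Cexp (- (Ci * phi)) / (2 * Ci) *
     (RtoC (cosc M (s + 1)) * Cexp (2 * Ci * RtoC (IZR (s + 1)) * phi)))%C
   with (RtoC (cosc M (s + 1)) / (2 * Ci) * Cexp (Ci * RtoC (2 * IZR s + 1) * phi))%C
   by (rewrite E2; unfold Cdiv; ring).
  rewrite RtoC_div, RtoC_minus by lra. field. repeat split; auto using C2_neq0, Ci_neq0.
Qed.

Lemma Cexp_geometric (th : C) h :
  ((Cexp th - 1) * csum (fun l => Cexp (th * RtoC (IZR l))) (zlist h))%C
  = (Cexp (th * RtoC (INR h + 1)) - Cexp (- (th * RtoC (INR h))))%C.
Proof.
  induction h as [|h IH].
  - cbn. replace (th * 0)%C with (RtoC 0) by ring. replace (- (RtoC 0))%C with (RtoC 0) by ring.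
    rewrite Rplus_0_l, !Cexp_0. replace (th * 1)%C with th by ring. ring.
  - rewrite csum_zlist_S, opp_IZR, <- INR_IZR_INZ, RtoC_opp.
    rewrite Cmult_plus_distr_l, IH, S_INR.
    set (a := INR h).
    replace (th * RtoC (a + 1 + 1))%C with (th * RtoC (a + 1) + th)%C
      by (rewrite !RtoC_plus; ring).
    replace (th * - RtoC (a + 1))%C with (- (th * RtoC (a + 1)))%C by ring.
    replace (- (th * RtoC a))%C with (- (th * RtoC (a + 1)) + th)%C
      by (rewrite !RtoC_plus; ring).
    rewrite !Cexp_add. ring.
Qed.

(** Averaging the characters of [Z/N] over a complete residue system. *)
Lemma root_filter h e :
  csum (fun l => Cexp (2 * PI * Ci * RtoC (IZR e / (2 * INR h + 1)) * RtoC (IZR l))) (zlist h)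
  = if Zdivide_dec (2 * Z.of_nat h + 1) e then RtoC (2 * INR h + 1) else 0%C.
Proof.
  pose proof (pos_INR h) as Hh. set (N := 2 * INR h + 1).
  assert (HN : IZR (2 * Z.of_nat h + 1) = N).
  { unfold N. rewrite plus_IZR, mult_IZR, <- INR_IZR_INZ. ring. }
  set (th := (2 * PI * Ci * RtoC (IZR e / N))%C).
  assert (HthZ : forall q : Z, IZR e = IZR q * N -> forall l : Z,
            Cexp (th * RtoC (IZR l)) = 1%C).
  { intros q Hq l. unfold th. rewrite Hq.
    replace (2 * PI * Ci * RtoC (IZR q * N / N) * IZR l)%C
      with (Ci * PI * RtoC (IZR (2 * (q * l))))%C.
    - rewrite Cexp_PI_Z. unfold sg. rewrite Z.even_mul. reflexivity.
    - replace (IZR q * N / N) with (IZR q) by (field; unfold N; lra).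
      rewrite !mult_IZR, !RtoC_mult. ring. }
  destruct (Zdivide_dec (2 * Z.of_nat h + 1) e) as [[q Hq]|Hn].
  - rewrite (csum_ext _ (fun _ : Z => 1%C)).
    + unfold N. clear. induction h as [|h IH].
      { cbn. rewrite Cplus_0_r. f_equal. ring. }
      rewrite csum_zlist_S, IH, S_INR, !RtoC_plus, !RtoC_mult, !RtoC_plus. ring.
    + intros l _. apply (HthZ q). rewrite Hq, mult_IZR, HN. ring.
  - assert (H := Cexp_geometric th h).
    replace (th * RtoC (INR h + 1))%C with (- (th * RtoC (INR h)) + Ci * PI * RtoC (IZR (2 * e)))%C in H.
    2:{ unfold th. rewrite mult_IZR, RtoC_mult, RtoC_div, !RtoC_plus by (unfold N; lra).
        unfold N. rewrite RtoC_plus, RtoC_mult. field.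
        cbv beta. rewrite <- RtoC_mult, <- RtoC_plus. apply RtoC_neq0; lra. }
    rewrite Cexp_add, Cexp_PI_Z in H. unfold sg in H. rewrite Z.even_mul in H.
    change (if (Z.even 2 || Z.even e)%bool then 1 else -1) with 1 in H.
    replace (Cexp (- (th * INR h)) * 1 - Cexp (- (th * INR h)))%C with (RtoC 0) in H by ring.
    destruct (classic ((Cexp th - 1)%C = 0%C)) as [H0|H0];
      [exfalso|apply NNPP; intros Hc; exact (Cmult_neq_0 _ _ H0 Hc H)].
    apply Hn. assert (H1 : Cexp th = 1%C) by (rewrite <- (Cplus_0_l 1), <- H0; ring).
    assert (Hx : sin (PI * (IZR e / N)) = 0).
    { apply (f_equal Re) in H1. unfold Cexp, th in H1.
      replace (Re (2 * PI * Ci * RtoC (IZR e / N))) with 0 in H1 by (simpl; ring).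
      replace (Im (2 * PI * Ci * RtoC (IZR e / N))) with (2 * (PI * (IZR e / N))) in H1
        by (simpl; ring).
      simpl in H1. rewrite exp_0, cos_2a_sin in H1. nra. }
    destruct (sin_eq_0_0 _ Hx) as [k Hk]. exists k. apply eq_IZR. rewrite mult_IZR, HN.
    pose proof PI_RGT_0.
    assert (HeN : IZR e / N = IZR k) by (apply Rmult_eq_reg_l with PI; lra).
    rewrite <- HeN. field. unfold N; lra.
Qed.

(** Poisson summation on [Z / N], [N = 2h + 1], for the trigonometric polynomial
    [sin cos^(2M)]. The sign [(-1)^l] moves the frequency [s + 1/2] by [N / 2] to the integer
    [s + h + 1], and averaging over [l] retains the multiples of [N], that is
    [s = N j + h]. *)
Lemma theta_finite h M (X : C) :
  has_sum (fun j : Z =>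
     RtoC ((2 * INR h + 1) * ((cosc M ((2 * Z.of_nat h + 1) * j + Z.of_nat h)
        - cosc M ((2 * Z.of_nat h + 1) * j + Z.of_nat h + 1)) / 2)) / Ci
     * Cexp (2 * PI * Ci * RtoC (IZR j + 1 / 2) * X))%C
   (csum (fun l => RtoC (sg l) *
      (Csin (PI * (X + RtoC (IZR l)) / RtoC (2 * INR h + 1))
       * Ccos (PI * (X + RtoC (IZR l)) / RtoC (2 * INR h + 1)) ^ (2 * M)))%C (zlist h)).
Proof.
  pose proof (pos_INR h) as Hh. set (N := 2 * INR h + 1) in *.
  set (NZ := (2 * Z.of_nat h + 1)%Z).
  assert (HN : IZR NZ = N).
  { unfold N, NZ. rewrite plus_IZR, mult_IZR, <- INR_IZR_INZ. ring. }
  assert (HN0 : RtoC N <> 0%C) by (apply RtoC_neq0; unfold N; lra).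
  set (phi := fun l : Z => (PI * (X + RtoC (IZR l)) / RtoC N)%C).
  assert (H := has_sum_csum (fun (l : Z) s => RtoC (sg l) * (RtoC ((cosc M s - cosc M (s + 1)) / 2) / Ci
     * Cexp (Ci * RtoC (2 * IZR s + 1) * phi l)))%C _ (zlist h)
     (fun l => has_sum_scal (RtoC (sg l)) _ _ (sin_cosc_has_sum M (phi l)))).
  cbv beta in H.
  apply (has_sum_ext _ (fun s => RtoC ((cosc M s - cosc M (s + 1)) / 2) / Ci
     * (Cexp (PI * Ci * RtoC ((2 * IZR s + 1) / N) * X) *
      (if Zdivide_dec NZ (s + Z.of_nat h + 1) then RtoC N else 0)))%C) in H.
  - apply (has_sum_inj (fun j => (NZ * j + Z.of_nat h)%Z)) in H.
    + revert H. apply has_sum_ext. intros j. cbv beta.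
      destruct (Zdivide_dec NZ (NZ * j + Z.of_nat h + Z.of_nat h + 1)) as [_|Hn].
      * replace (PI * Ci * RtoC ((2 * IZR (NZ * j + Z.of_nat h) + 1) / N) * X)%C
          with (2 * PI * Ci * RtoC (IZR j + 1 / 2) * X)%C.
        -- rewrite RtoC_mult. unfold Cdiv. ring.
        -- replace ((2 * IZR (NZ * j + Z.of_nat h) + 1) / N) with (2 * (IZR j + 1 / 2)).
           ++ rewrite RtoC_mult. ring.
           ++ rewrite plus_IZR, mult_IZR, HN, <- INR_IZR_INZ. unfold N. field. lra.
      * exfalso. apply Hn. exists (j + 1)%Z. unfold NZ. lia.
    + intros a b Hab. unfold NZ in Hab. nia.
    + intros s Hs. destruct (Zdivide_dec NZ (s + Z.of_nat h + 1)) as [[q Hq]|_]; [|ring].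
      exfalso. apply (Hs (q - 1)%Z). unfold NZ in *. lia.
  - intros s. assert (Hrf := root_filter h (s + Z.of_nat h + 1)). fold N NZ in Hrf.
    rewrite <- Hrf. rewrite <- !csum_scal. apply csum_ext. intros l _.
    rewrite <- Cexp_PI_Z.
    replace (Cexp (Ci * RtoC (2 * IZR s + 1) * phi l))%C with
      (Cexp (PI * Ci * RtoC ((2 * IZR s + 1) / N) * X) *
       Cexp (PI * Ci * RtoC ((2 * IZR s + 1) / N) * IZR l))%C.
    2:{ rewrite <- Cexp_add. f_equal. unfold phi. rewrite RtoC_div by (unfold N; lra).
        field. auto. }
    replace (Cexp (2 * PI * Ci * RtoC (IZR (s + Z.of_nat h + 1) / N) * IZR l))%C
     with (Cexp (Ci * PI * IZR l) * Cexp (PI * Ci * RtoC ((2 * IZR s + 1) / N) * IZR l))%C.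
    2:{ rewrite <- Cexp_add. f_equal.
        replace (IZR (s + Z.of_nat h + 1) / N) with (1 / 2 + (2 * IZR s + 1) / N / 2).
        - rewrite RtoC_plus, !(RtoC_div _ 2) by lra. field.
        - rewrite !plus_IZR, <- INR_IZR_INZ. unfold N. field. lra. }
    unfold Cdiv. ring.
Qed.

(** ** Asymptotics of the binomial coefficients *)

Lemma cosc_center_rec M :
  cosc (S M) 0 = cosc M 0 * ((2 * INR M + 1) / (2 * INR M + 2)).
Proof.
  cbn [cosc]. change (0 - 1)%Z with (- (1))%Z. rewrite cosc_opp.
  change (0 + 1)%Z with 1%Z. assert (H := cosc_ratio M 0). change (0 + 1)%Z with 1%Z in H.
  pose proof (pos_INR M).
  assert (E : cosc M 1 = INR M / (INR M + 1) * cosc M 0).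
  { apply Rmult_eq_reg_l with (INR M + 1); [|lra]. 
    replace ((INR M + 1) * (INR M / (INR M + 1) * cosc M 0)) with (INR M * cosc M 0) by (field; lra).
    lra. }
  rewrite E. field. lra.
Qed.

Lemma cosc_center_pos M : 0 < cosc M 0.
Proof.
  induction M as [|M IH]; [simpl; lra|]. rewrite cosc_center_rec.
  pose proof (pos_INR M). apply Rmult_lt_0_compat; auto. apply Rdiv_lt_0_compat; lra.
Qed.

Lemma cosc_center_decr M :
  (2 * INR (S M) + 1) * cosc (S M) 0 ^ 2 <= (2 * INR M + 1) * cosc M 0 ^ 2.
Proof.
  rewrite cosc_center_rec, S_INR. pose proof (pos_INR M) as HM. set (x := INR M) in *.
  pose proof (pow2_ge_0 (cosc M 0)) as Hp. set (p := cosc M 0) in *.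
  replace ((2 * (x + 1) + 1) * (p * ((2 * x + 1) / (2 * x + 2))) ^ 2)
    with ((2 * x + 1) * p ^ 2 * ((2 * x + 3) * (2 * x + 1) / (2 * x + 2) ^ 2)) by (field; lra).
  rewrite <- (Rmult_1_r ((2 * x + 1) * p ^ 2)) at 2.
  apply Rmult_le_compat_l; [apply Rmult_le_pos; lra|].
  apply div_le; [apply pow_lt; lra|]. nra.
Qed.

Lemma cosc_center_le M : (2 * INR M + 1) * cosc M 0 ^ 2 <= 1.
Proof.
  induction M as [|M IH]; [simpl; lra|]. eapply Rle_trans; [apply cosc_center_decr|exact IH].
Qed.

(** Existence of the limit in Wallis' formula, by monotonicity. Its value is left open here; it
    enters the constant that [theta_transform] determines by duality. *)
Lemma cosc_center_lim : exists c, 0 <= c /\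
  is_lim_seq (fun M => (2 * INR M + 1) * cosc M 0 ^ 2) c.
Proof.
  assert (Hp : forall M, 0 <= (2 * INR M + 1) * cosc M 0 ^ 2).
  { intros M. pose proof (pos_INR M). apply Rmult_le_pos; [lra|apply pow2_ge_0]. }
  destruct (ex_finite_lim_seq_decr _ 0 cosc_center_decr Hp) as [c Hc].
  exists c. split; auto.
  apply (is_lim_seq_le (fun _ => 0) _ 0 c Hp (is_lim_seq_const 0) Hc).
Qed.

(** The ratio of neighbours at distance [n] from the centre is
    [1 - (2n + 1) / (M + n + 1) <= exp (- (2n + 1) / (M + s))], and the odd numbers [2n + 1] with
    [n < s] add up to [s^2]. *)
Lemma cosc_upper M s : cosc M (Z.of_nat s) <= cosc M 0 * exp (- (INR s ^ 2 / (INR M + INR s))).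
Proof.
  destruct (Nat.eq_dec s 0) as [->|Hs].
  { simpl. replace (- (0 * (0 * 1) / (INR M + 0))) with 0 by (unfold Rdiv; ring).
    rewrite exp_0. lra. }
  assert (HMs : 0 < INR M + INR s).
  { pose proof (pos_INR M). assert (0 < INR s) by (apply lt_0_INR; lia). lra. }
  assert (H : forall n, (n <= s)%nat ->
    cosc M (Z.of_nat n) <= cosc M 0 * exp (- (INR n ^ 2 / (INR M + INR s)))).
  { induction n as [|n IH]; intros Hn.
    - simpl. replace (- (0 * (0 * 1) / (INR M + INR s))) with 0 by (unfold Rdiv; ring).
      rewrite exp_0. lra.
    - specialize (IH ltac:(lia)). assert (Hr := cosc_ratio M (Z.of_nat n)).
      rewrite <- INR_IZR_INZ in Hr. replace (Z.of_nat n + 1)%Z with (Z.of_nat (S n)) in Hr by lia.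
      pose proof (pos_INR M) as HM. pose proof (pos_INR n) as Hn0.
      set (x := INR n) in *. set (m := INR M) in *.
      assert (Hns : x + 1 <= INR s) by (unfold x; rewrite <- S_INR; apply le_INR; lia).
      assert (E : cosc M (Z.of_nat (S n)) = (1 + - ((2 * x + 1) / (m + x + 1))) * cosc M (Z.of_nat n)).
      { apply Rmult_eq_reg_l with (m + x + 1); [|lra]. rewrite Hr. field. lra. }
      rewrite E.
      apply Rle_trans with (exp (- ((2 * x + 1) / (m + INR s))) * cosc M (Z.of_nat n)).
      + apply Rmult_le_compat_r; [apply cosc_nonneg|].
        eapply Rle_trans; [apply exp_ineq1_le|]. apply exp_le.
        apply Ropp_le_contravar. unfold Rdiv. apply Rmult_le_compat_l; [lra|].
        apply Rinv_le_contravar; lra.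
      + eapply Rle_trans; [apply Rmult_le_compat_l; [left; apply exp_pos|exact IH]|].
        right. rewrite S_INR. fold x.
        replace (- ((x + 1) ^ 2 / (m + INR s))) with
          (- ((2 * x + 1) / (m + INR s)) + - (x ^ 2 / (m + INR s))) by (field; lra).
        rewrite exp_plus. ring. }
  apply H; lia.
Qed.

(** As for [cosc_upper], from the inverse ratio [1 + (2n + 1) / (M - n)]. *)
Lemma cosc_lower M s : (s < M)%nat ->
  cosc M 0 * exp (- (INR s ^ 2 / (INR M - INR s))) <= cosc M (Z.of_nat s).
Proof.
  intros Hs. assert (HMs : 0 < INR M - INR s) by (apply lt_INR in Hs; lra).
  assert (H : forall n, (n <= s)%nat ->
    cosc M 0 * exp (- (INR n ^ 2 / (INR M - INR s))) <= cosc M (Z.of_nat n)).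
  { induction n as [|n IH]; intros Hn.
    - simpl. replace (- (0 * (0 * 1) / (INR M - INR s))) with 0 by (unfold Rdiv; ring).
      rewrite exp_0. lra.
    - specialize (IH ltac:(lia)). assert (Hr := cosc_ratio M (Z.of_nat n)).
      rewrite <- INR_IZR_INZ in Hr. replace (Z.of_nat n + 1)%Z with (Z.of_nat (S n)) in Hr by lia.
      pose proof (pos_INR M) as HM. pose proof (pos_INR n) as Hn0.
      set (x := INR n) in *. set (m := INR M) in *.
      assert (Hns : x + 1 <= INR s) by (unfold x; rewrite <- S_INR; apply le_INR; lia).
      assert (E : cosc M (Z.of_nat n) = (1 + (2 * x + 1) / (m - x)) * cosc M (Z.of_nat (S n))).
      { apply Rmult_eq_reg_l with (m - x); [|lra]. rewrite <- Hr. field. lra. }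
      assert (Hup : cosc M (Z.of_nat n) <=
         exp ((2 * x + 1) / (m - INR s)) * cosc M (Z.of_nat (S n))).
      { rewrite E. apply Rmult_le_compat_r; [apply cosc_nonneg|].
        eapply Rle_trans; [apply exp_ineq1_le|]. apply exp_le.
        unfold Rdiv. apply Rmult_le_compat_l; [lra|]. apply Rinv_le_contravar; lra. }
      assert (H2 := Rle_trans _ _ _ IH Hup).
      apply Rmult_le_compat_l with (r := exp (- ((2 * x + 1) / (m - INR s)))) in H2;
        [|left; apply exp_pos].
      rewrite <- (Rmult_assoc (exp _) (exp _)), <- exp_plus, Rplus_opp_l, exp_0, Rmult_1_l in H2.
      eapply Rle_trans; [|exact H2]. right. rewrite S_INR. fold x.
      replace (- ((x + 1) ^ 2 / (m - INR s))) with
          (- ((2 * x + 1) / (m - INR s)) + - (x ^ 2 / (m - INR s))) by (field; lra).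
      rewrite exp_plus. ring. }
  apply H; lia.
Qed.

(** With [N = 2h + 1] and [M] about [t N^2 / PI], the power [cos^(2M)] at [PI w / N] is close to
    [exp (- M (PI w / N)^2)], that is to [exp (- PI t w^2)]. *)
Definition deg (t : R) (h : nat) : nat := Z.to_nat (up (t * (2 * INR h + 1) ^ 2 / PI)).

Lemma deg_spec t h : 0 < t ->
  t * (2 * INR h + 1) ^ 2 / PI < INR (deg t h) <= t * (2 * INR h + 1) ^ 2 / PI + 1.
Proof.
  intros Ht. pose proof PI_RGT_0. pose proof (pow2_ge_0 (2 * INR h + 1)).
  assert (0 <= t * (2 * INR h + 1) ^ 2 / PI).
  { apply Rmult_le_pos; [apply Rmult_le_pos; lra|left; apply Rinv_0_lt_compat; lra]. }
  destruct (archimed (t * (2 * INR h + 1) ^ 2 / PI)) as [A1 A2].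
  unfold deg. rewrite (INR_IZR_INZ (Z.to_nat _)), Z2Nat.id; [lra|]. apply le_IZR. lra.
Qed.

Lemma is_lim_seq_invN : is_lim_seq (fun h => / (2 * INR h + 1)) 0.
Proof.
  apply (is_lim_seq_inv (fun h => 2 * INR h + 1) p_infty); [|easy].
  apply (is_lim_seq_le_p_loc INR); [|apply is_lim_seq_INR].
  exists 0%nat. intros n _. pose proof (pos_INR n). lra.
Qed.

Lemma is_lim_seq_deg t : 0 < t ->
  is_lim_seq (fun h => INR (deg t h) / (2 * INR h + 1) ^ 2) (t / PI).
Proof.
  intros Ht. pose proof PI_RGT_0 as HP.
  apply (is_lim_seq_le_le (fun _ => t / PI) _
     (fun h => t / PI + / (2 * INR h + 1) * / (2 * INR h + 1))).
  - intros h. destruct (deg_spec t h Ht) as [H1 H2]. pose proof (pos_INR h).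
    assert (HN : 0 < (2 * INR h + 1) ^ 2) by (apply pow_lt; lra).
    split.
    + apply le_div; [lra|]. replace (t / PI * (2 * INR h + 1) ^ 2) with
        (t * (2 * INR h + 1) ^ 2 / PI) by (field; lra). lra.
    + apply div_le; [lra|]. eapply Rle_trans; [exact H2|]. right. field. lra.
  - apply is_lim_seq_const.
  - replace (Finite (t / PI)) with (Finite (t / PI + 0 * 0)) by (f_equal; ring).
    apply is_lim_seq_plus'; [apply is_lim_seq_const|].
    apply is_lim_seq_mult'; apply is_lim_seq_invN.
Qed.

Lemma deg_infty t : 0 < t -> filterlim (deg t) eventually eventually.
Proof.
  intros Ht P [n Hn]. pose proof PI_RGT_0 as HP.
  exists (Z.to_nat (up (INR n * PI / t))). intros h Hh. apply Hn.
  apply INR_le. destruct (deg_spec t h Ht) as [H1 _].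
  destruct (archimed (INR n * PI / t)) as [A1 _].
  assert (H0 : INR n * PI / t <= INR h).
  { apply Rle_trans with (IZR (up (INR n * PI / t))); [lra|].
    rewrite (INR_IZR_INZ h). apply IZR_le. lia. }
  apply Rle_div_l in H0; [|lra]. left. eapply Rle_lt_trans; [|exact H1].
  apply le_div; [lra|]. pose proof (pos_INR h).
  assert (INR h * t <= t * (2 * INR h + 1) ^ 2) by nra. lra.
Qed.

(** The coefficients of [theta_finite] multiplied by [N / PI], the factor for which
    [sin (PI w / N)] tends to [w]. *)
Definition delta (t : R) (h : nat) (j : Z) : R :=
  (2 * INR h + 1) ^ 2 / PI *
  ((cosc (deg t h) ((2 * Z.of_nat h + 1) * j + Z.of_nat h)
    - cosc (deg t h) ((2 * Z.of_nat h + 1) * j + Z.of_nat h + 1)) / 2).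

Lemma delta_opp t h j : delta t h (- j - 1) = - delta t h j.
Proof.
  unfold delta.
  replace ((2 * Z.of_nat h + 1) * (- j - 1) + Z.of_nat h)%Z with
    (- ((2 * Z.of_nat h + 1) * j + Z.of_nat h + 1))%Z by lia.
  replace (- ((2 * Z.of_nat h + 1) * j + Z.of_nat h + 1) + 1)%Z with
    (- ((2 * Z.of_nat h + 1) * j + Z.of_nat h))%Z by lia.
  rewrite !cosc_opp. lra.
Qed.

(** By [cosc_ratio] the difference of neighbours is [(2s + 1) / (M + s + 1)] times the first, and
    [2s + 1 = 2 N (j + 1/2)]. *)
Lemma delta_nonneg_index t h (j : nat) : 0 < t ->
  delta t h (Z.of_nat j) =
  / (PI * ((INR (deg t h) + INR ((2 * h + 1) * j + h) + 1) / (2 * INR h + 1) ^ 2)) *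
  ((2 * INR h + 1) * cosc (deg t h) (Z.of_nat ((2 * h + 1) * j + h))) * (INR j + 1 / 2).
Proof.
  intros Ht. unfold delta. set (s := ((2 * h + 1) * j + h)%nat).
  replace ((2 * Z.of_nat h + 1) * Z.of_nat j + Z.of_nat h)%Z with (Z.of_nat s) by (unfold s; lia).
  assert (Hr := cosc_ratio (deg t h) (Z.of_nat s)). rewrite <- INR_IZR_INZ in Hr.
  set (M := INR (deg t h)) in *. pose proof (pos_INR s). pose proof (pos_INR (deg t h)) as HM.
  fold M in HM. pose proof (pos_INR h). pose proof PI_RGT_0.
  assert (E : cosc (deg t h) (Z.of_nat s + 1)
    = (M - INR s) / (M + INR s + 1) * cosc (deg t h) (Z.of_nat s)).
  { apply Rmult_eq_reg_l with (M + INR s + 1); [|lra]. rewrite Hr. field. lra. }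
  rewrite E.
  assert (Es : INR j = (INR s - INR h) / (2 * INR h + 1)).
  { unfold s. rewrite plus_INR, mult_INR, plus_INR, mult_INR. simpl. field. lra. }
  rewrite Es. field. repeat split; lra.
Qed.

(** [cosc_upper] at [s = N j + h], where [s / N] is close to [j + 1/2] and [M] is of the order
    of [N^2]; beyond [s = M] the coefficients vanish. *)
Lemma delta_bound t : 0 < t -> exists K c, 0 <= K /\ 0 < c /\
  forall h j, (1 <= h)%nat ->
  Rabs (delta t h j) <= K * (Rabs (IZR j + 1 / 2) * exp (- (c * (IZR j + 1 / 2) ^ 2))).
Proof.
  intros Ht. pose proof PI_RGT_0 as HP.
  set (K := / t * sqrt (PI / t)). set (c := / (8 * (t / PI + 1))).
  assert (HtP : 0 < t / PI) by (apply Rdiv_lt_0_compat; lra).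
  assert (HK : 0 <= K).
  { apply Rmult_le_pos; [left; now apply Rinv_0_lt_compat|apply sqrt_pos]. }
  exists K, c. split; [exact HK|]. split; [apply Rinv_0_lt_compat; lra|].
  assert (Hn : forall h (j : nat), (1 <= h)%nat -> Rabs (delta t h (Z.of_nat j)) <=
     K * ((INR j + 1 / 2) * exp (- (c * (INR j + 1 / 2) ^ 2)))).
  { intros h j Hh. rewrite delta_nonneg_index by exact Ht.
    destruct (deg_spec t h Ht) as [H1 H2].
    set (s := ((2 * h + 1) * j + h)%nat).
    assert (Hs : INR s = (2 * INR h + 1) * (INR j + 1 / 2) - 1 / 2).
    { unfold s. rewrite plus_INR, mult_INR, plus_INR, mult_INR. simpl. field. }
    assert (HN : 3 <= 2 * INR h + 1) by (apply le_INR in Hh; simpl in Hh; lra).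
    set (N := 2 * INR h + 1) in *. set (k := INR j + 1 / 2) in *.
    assert (Hk : 1 / 2 <= k) by (unfold k; pose proof (pos_INR j); lra).
    pose proof (cosc_center_le (deg t h)) as Hc1. pose proof (cosc_center_pos (deg t h)) as Hc0.
    pose proof (cosc_upper (deg t h) s) as Hup. pose proof (cosc_nonneg (deg t h) (Z.of_nat s)) as Hnn.
    assert (Hsup : (deg t h < s)%nat -> cosc (deg t h) (Z.of_nat s) = 0)
      by (intros; apply cosc_support; lia).
    assert (HsM : ~ (deg t h < s)%nat -> INR s <= INR (deg t h)) by (intros; apply le_INR; lia).
    set (M := INR (deg t h)) in *. set (p0 := cosc (deg t h) 0) in *.
    set (p := cosc (deg t h) (Z.of_nat s)) in *.
    assert (HN2 : 0 < N ^ 2) by (apply pow_lt; lra).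
    assert (HMlow : t * N ^ 2 / PI = t / PI * N ^ 2) by (field; lra). rewrite HMlow in H1, H2.
    assert (HN9 : 1 <= N ^ 2) by nra.
    assert (HtN : 0 < t / PI * N ^ 2) by (now apply Rmult_lt_0_compat).
    assert (Hsk : N * k / 2 <= INR s) by nra.
    assert (Hs0 : 0 <= INR s) by apply pos_INR.
    assert (Hfac : 0 < / (PI * ((M + INR s + 1) / N ^ 2)) <= / t).
    { assert (t <= PI * ((M + INR s + 1) / N ^ 2)).
      { replace t with (PI * (t / PI)) at 1 by (field; lra).
        apply Rmult_le_compat_l; [lra|]. apply le_div; lra. }
      split; [apply Rinv_0_lt_compat; lra|apply Rinv_le_contravar; lra]. }
    assert (Hp0 : N * p0 <= sqrt (PI / t)).
    { rewrite <- (sqrt_Rsqr (N * p0)) by nra. apply sqrt_le_1_alt. unfold Rsqr.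
      apply le_div; [lra|].
      assert (2 * (t / PI * N ^ 2) * p0 ^ 2 <= 1).
      { eapply Rle_trans; [|exact Hc1]. apply Rmult_le_compat_r; [apply pow2_ge_0|lra]. }
      replace (2 * (t / PI * N ^ 2) * p0 ^ 2) with ((N * p0 * (N * p0) * t) * (2 / PI)) in H
        by (field; lra).
      assert (E2 : 0 <= N * p0 * (N * p0) * t).
      { apply Rmult_le_pos; [|lra]. apply Rmult_le_pos; nra. }
      apply Rmult_le_reg_r with (2 / PI); [apply Rdiv_lt_0_compat; lra|].
      replace (PI * (2 / PI)) with 2 by (field; lra). lra. }
    assert (Hp : N * p <= sqrt (PI / t) * exp (- (c * k ^ 2))).
    { destruct (lt_dec (deg t h) s) as [Hlt|Hge].
      - rewrite Hsup, Rmult_0_r by exact Hlt. apply Rmult_le_pos; [apply sqrt_pos|left; apply exp_pos].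
      - specialize (HsM Hge).
        apply Rle_trans with (N * p0 * exp (- (INR s ^ 2 / (M + INR s)))).
        { rewrite Rmult_assoc. apply Rmult_le_compat_l; [lra|exact Hup]. }
        apply Rmult_le_compat; [nra|left; apply exp_pos|exact Hp0|].
        apply exp_le, Ropp_le_contravar.
        assert (0 < M) by lra.
        apply le_div; [lra|].
        apply Rle_trans with (c * k ^ 2 * (2 * ((t / PI + 1) * N ^ 2))).
        + apply Rmult_le_compat_l.
          { apply Rmult_le_pos; [left; apply Rinv_0_lt_compat; lra|apply pow2_ge_0]. }
          nra.
        + replace (c * k ^ 2 * (2 * ((t / PI + 1) * N ^ 2))) with ((N * k / 2) ^ 2).
          * apply pow_incr. split; [nra|exact Hsk].
          * unfold c. field. split; lra. }
    rewrite Rabs_pos_eq.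
    - replace (K * (k * exp (- (c * k ^ 2)))) with
       (/ t * (sqrt (PI / t) * exp (- (c * k ^ 2))) * k) by (unfold K; ring).
      apply Rmult_le_compat_r; [lra|]. apply Rmult_le_compat; [lra| |lra|exact Hp].
      apply Rmult_le_pos; lra.
    - apply Rmult_le_pos; [|lra]. apply Rmult_le_pos; [lra|]. apply Rmult_le_pos; lra. }
  intros h j Hh. destruct (Z_le_dec 0 j) as [Hj|Hj].
  - specialize (Hn h (Z.to_nat j) Hh). rewrite (INR_IZR_INZ (Z.to_nat _)), Z2Nat.id in Hn by exact Hj.
    assert (0 <= IZR j) by now apply IZR_le.
    rewrite (Rabs_pos_eq (IZR j + 1 / 2)) by lra. exact Hn.
  - specialize (Hn h (Z.to_nat (- j - 1)) Hh).
    rewrite (INR_IZR_INZ (Z.to_nat _)), Z2Nat.id, delta_opp, Rabs_Ropp in Hn by lia.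
    rewrite minus_IZR, opp_IZR in Hn.
    assert (IZR j <= -1) by (apply IZR_le; lia).
    rewrite (Rabs_left (IZR j + 1 / 2)) by lra.
    replace (- IZR j - 1 + 1 / 2) with (- (IZR j + 1 / 2)) in Hn by lra.
    replace ((- (IZR j + 1 / 2)) ^ 2) with ((IZR j + 1 / 2) ^ 2) in Hn by ring. exact Hn.
Qed.

(** [cosc_lower] and [cosc_upper] enclose the coefficient between two sequences with the same
    limit. The constant [kappa] involves the limit of [cosc_center_lim]. *)
Lemma delta_lim : exists kappa, 0 <= kappa /\ forall t j, 0 < t ->
  is_lim_seq (fun h => delta t h j)
    (kappa / (t * sqrt t) * ((IZR j + 1 / 2) * exp (- (PI * (IZR j + 1 / 2) ^ 2 / t)))).
Proof.
  destruct cosc_center_lim as (c & Hc & Hlc). pose proof PI_RGT_0 as HP.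
  exists (sqrt (PI * c / 2)). split; [apply sqrt_pos|].
  set (kappa := sqrt (PI * c / 2)).
  assert (Hn : forall t (j : nat), 0 < t -> is_lim_seq (fun h => delta t h (Z.of_nat j))
    (kappa / (t * sqrt t) * ((INR j + 1 / 2) * exp (- (PI * (INR j + 1 / 2) ^ 2 / t))))).
  { intros t j Ht. set (k := INR j + 1 / 2).
    set (s := fun h => ((2 * h + 1) * j + h)%nat).
    set (N := fun h => 2 * INR h + 1).
    assert (HN : forall h, 0 < N h) by (intros h; unfold N; pose proof (pos_INR h); lra).
    assert (Hs : forall h, INR (s h) = N h * k - 1 / 2).
    { intros h. unfold s, N, k. rewrite plus_INR, mult_INR, plus_INR, mult_INR. simpl. field. }
    assert (LI : is_lim_seq (fun h => / N h) 0) by apply is_lim_seq_invN.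
    assert (LM : is_lim_seq (fun h => INR (deg t h) / N h ^ 2) (t / PI)) by now apply is_lim_seq_deg.
    assert (HtP : 0 < t / PI) by (apply Rdiv_lt_0_compat; lra).
    assert (L1 : is_lim_seq (fun h => INR (s h) / N h) k).
    { apply (is_lim_seq_ext (fun h => k - 1 / 2 * / N h)).
      - intros h. rewrite Hs. specialize (HN h). field. lra.
      - replace (Finite k) with (Finite (k - 1 / 2 * 0)) by (f_equal; ring).
        apply is_lim_seq_minus'; [apply is_lim_seq_const|].
        apply is_lim_seq_mult'; [apply is_lim_seq_const|exact LI]. }
    assert (L2 : is_lim_seq (fun h => INR (s h) / N h ^ 2) 0).
    { apply (is_lim_seq_ext (fun h => INR (s h) / N h * / N h)).
      - intros h. specialize (HN h). field. lra.
      - replace (Finite 0) with (Finite (k * 0)) by (f_equal; ring).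
        apply is_lim_seq_mult'; auto. }
    assert (L0 : is_lim_seq (fun h => / N h ^ 2) 0).
    { apply (is_lim_seq_ext (fun h => / N h * / N h)).
      - intros h. specialize (HN h). field. lra.
      - replace (Finite 0) with (Finite (0 * 0)) by (f_equal; ring).
        apply is_lim_seq_mult'; auto. }
    assert (Lfac : is_lim_seq (fun h => / (PI * ((INR (deg t h) + INR (s h) + 1) / N h ^ 2))) (/ t)).
    { replace (Finite (/ t)) with (Rbar_inv (Finite (PI * (t / PI + 0 + 0)))).
      - apply is_lim_seq_inv.
        + apply is_lim_seq_mult'; [apply is_lim_seq_const|].
          apply (is_lim_seq_ext (fun h => INR (deg t h) / N h ^ 2 + INR (s h) / N h ^ 2 + / N h ^ 2)).
          * intros h. specialize (HN h). field. lra.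
          * apply is_lim_seq_plus'; [apply is_lim_seq_plus'|]; auto.
        + intros E. injection E. replace (PI * (t / PI + 0 + 0)) with t by (field; lra). lra.
      - simpl. f_equal. f_equal. field. lra. }
    assert (Lp0 : is_lim_seq (fun h => N h * cosc (deg t h) 0) (kappa / sqrt t)).
    { replace (kappa / sqrt t) with (sqrt (c * / (2 * (t / PI) + 0))).
      2:{ unfold kappa. rewrite <- sqrt_div_alt by lra. f_equal. field. lra. }
      apply (is_lim_seq_ext (fun h => sqrt ((2 * INR (deg t h) + 1) * cosc (deg t h) 0 ^ 2 *
         / (2 * (INR (deg t h) / N h ^ 2) + / N h ^ 2)))).
      - intros h. specialize (HN h). pose proof (pos_INR (deg t h)).
        replace ((2 * INR (deg t h) + 1) * cosc (deg t h) 0 ^ 2 *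
         / (2 * (INR (deg t h) / N h ^ 2) + / N h ^ 2)) with ((N h * cosc (deg t h) 0)²).
        + apply sqrt_Rsqr. pose proof (cosc_center_pos (deg t h)). apply Rmult_le_pos; lra.
        + unfold Rsqr. field. split; lra.
      - apply (is_lim_seq_continuous sqrt).
        + apply continuity_pt_sqrt. apply Rmult_le_pos; [exact Hc|].
          left. apply Rinv_0_lt_compat. lra.
        + apply is_lim_seq_mult'.
          * exact (is_lim_seq_subseq _ _ _ (deg_infty t Ht) Hlc).
          * replace (Finite (/ (2 * (t / PI) + 0))) with (Rbar_inv (Finite (2 * (t / PI) + 0)))
              by reflexivity.
            apply is_lim_seq_inv; [|intros E; injection E; lra].
            apply is_lim_seq_plus'; auto. apply is_lim_seq_mult'; [apply is_lim_seq_const|auto]. }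
    assert (Lexp : forall eps : R, (eps = 1 \/ eps = -1) ->
      is_lim_seq (fun h => N h * cosc (deg t h) 0 *
          exp (- (INR (s h) ^ 2 / (INR (deg t h) + eps * INR (s h)))))
        (kappa / sqrt t * exp (- (PI * k ^ 2 / t)))).
    { intros eps Heps. apply is_lim_seq_mult'; auto.
      apply (is_lim_seq_continuous exp).
      { apply derivable_continuous_pt, derivable_pt_exp. }
      replace (- (PI * k ^ 2 / t)) with (-1 * (k * k * / (t / PI + eps * 0))) by (field; lra).
      apply (is_lim_seq_ext (fun h => -1 * (INR (s h) / N h * (INR (s h) / N h) *
        / (INR (deg t h) / N h ^ 2 + eps * (INR (s h) / N h ^ 2))))).
      - intros h. specialize (HN h).
        replace (INR (deg t h) / N h ^ 2 + eps * (INR (s h) / N h ^ 2))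
          with ((INR (deg t h) + eps * INR (s h)) * / N h ^ 2) by (field; lra).
        rewrite Rinv_mult, Rinv_inv. unfold Rdiv.
        set (Y := / (INR (deg t h) + eps * INR (s h))). field. lra.
      - apply is_lim_seq_mult'; [apply is_lim_seq_const|].
        apply is_lim_seq_mult'; [apply is_lim_seq_mult'; auto|].
        replace (Finite (/ (t / PI + eps * 0))) with (Rbar_inv (Finite (t / PI + eps * 0)))
          by reflexivity.
        apply is_lim_seq_inv; [|intros E; injection E; lra].
        apply is_lim_seq_plus'; auto. apply is_lim_seq_mult'; [apply is_lim_seq_const|auto]. }
    assert (Lp : is_lim_seq (fun h => N h * cosc (deg t h) (Z.of_nat (s h)))
      (kappa / sqrt t * exp (- (PI * k ^ 2 / t)))).
    { apply (is_lim_seq_le_le_loc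
        (fun h => N h * cosc (deg t h) 0 *
          exp (- (INR (s h) ^ 2 / (INR (deg t h) + -1 * INR (s h))))) _
        (fun h => N h * cosc (deg t h) 0 *
          exp (- (INR (s h) ^ 2 / (INR (deg t h) + 1 * INR (s h)))))); auto.
      (* s/N^2 tends to 0 while deg/N^2 tends to t/PI, so s < deg eventually *)
      assert (Hev : eventually (fun h => (s h < deg t h)%nat)).
      { assert (L3 : is_lim_seq (fun h => INR (deg t h) / N h ^ 2 - INR (s h) / N h ^ 2) (t / PI - 0))
          by now apply is_lim_seq_minus'.
        rewrite Rminus_0_r in L3.
        assert (H := proj2 (is_lim_seq_spec _ _) L3 (mkposreal _ HtP)).
        revert H. apply filter_imp. intros h Hh. cbn [pos] in Hh. apply Rabs_def2 in Hh.
        apply INR_lt. specialize (HN h).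
        assert (0 < (INR (deg t h) - INR (s h)) / N h ^ 2).
        { replace ((INR (deg t h) - INR (s h)) / N h ^ 2) with
            (INR (deg t h) / N h ^ 2 - INR (s h) / N h ^ 2) by (field; lra). lra. }
        apply Rlt_div_r in H; [lra|apply pow_lt; lra]. }
      revert Hev. apply filter_imp. intros h Hh. specialize (HN h).
      replace (INR (deg t h) + -1 * INR (s h)) with (INR (deg t h) - INR (s h)) by ring.
      replace (INR (deg t h) + 1 * INR (s h)) with (INR (deg t h) + INR (s h)) by ring.
      rewrite !Rmult_assoc. split; apply Rmult_le_compat_l; try lra.
      - now apply cosc_lower.
      - apply cosc_upper. }
    apply (is_lim_seq_ext (fun h => / (PI * ((INR (deg t h) + INR (s h) + 1) / N h ^ 2)) *
       (N h * cosc (deg t h) (Z.of_nat (s h))) * k)).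
    - intros h. symmetry. now apply delta_nonneg_index.
    - replace (kappa / (t * sqrt t) * (k * exp (- (PI * k ^ 2 / t)))) with
        (/ t * (kappa / sqrt t * exp (- (PI * k ^ 2 / t))) * k).
      + apply is_lim_seq_mult'; [apply is_lim_seq_mult'; auto|apply is_lim_seq_const].
      + field. pose proof (sqrt_lt_R0 t Ht). split; lra. }
  intros t j Ht. destruct (Z_le_dec 0 j) as [Hj|Hj].
  - specialize (Hn t (Z.to_nat j) Ht).
    rewrite (INR_IZR_INZ (Z.to_nat j)), Z2Nat.id in Hn by exact Hj. exact Hn.
  - specialize (Hn t (Z.to_nat (- j - 1)) Ht).
    rewrite (INR_IZR_INZ (Z.to_nat _)), Z2Nat.id, minus_IZR, opp_IZR in Hn by lia.
    apply is_lim_seq_opp in Hn.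
    apply (is_lim_seq_ext _ (fun h => delta t h j)) in Hn.
    2:{ intros h. rewrite delta_opp. ring. }
    replace (Finite (kappa / (t * sqrt t) * ((IZR j + 1 / 2) * exp (- (PI * (IZR j + 1 / 2) ^ 2 / t)))))
      with (Rbar_opp (kappa / (t * sqrt t) * ((- IZR j - 1 + 1 / 2) *
         exp (- (PI * (- IZR j - 1 + 1 / 2) ^ 2 / t))))); [exact Hn|].
    unfold Rbar_opp. f_equal.
    replace (- IZR j - 1 + 1 / 2) with (- (IZR j + 1 / 2)) by lra.
    replace ((- (IZR j + 1 / 2)) ^ 2) with ((IZR j + 1 / 2) ^ 2) by ring. ring.
Qed.

(** ** The limit of the finite inversion formulas *)

(** The exact value [|cos u|^2 = 1 - sin^2 (Re u) + sinh^2 (Im u)] gives [cos^(2M)] a Gaussian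
    decay in the real direction, as required to dominate the sums over [l]. *)
Lemma Ccos_pow_bound u M : Rabs (Re u) <= 2 -> Rabs (Im u) <= 1 ->
  Cmod (Ccos u ^ (2 * M)) <= exp (INR M * (9 * Im u ^ 2 - Re u ^ 2 / 16)).
Proof.
  intros H1 H2. apply sin_lower in H1. apply sinh_upper in H2.
  rewrite Cmod_pow, pow_mult, Ccos_mod2.
  pose proof (pow2_ge_0 (sinh (Im u))).
  assert (0 <= 1 - sin (Re u) ^ 2) by (pose proof (SIN_bound (Re u)); nra).
  rewrite <- exp_pow_nat. apply pow_incr. split; [lra|].
  eapply Rle_trans; [|apply exp_ineq1_le]. lra.
Qed.

Lemma Cpow_diff_le x y R n : Cmod x <= R -> Cmod y <= R -> 1 <= R ->
  Cmod (x ^ n - y ^ n) <= INR n * Cmod (x - y) * R ^ n.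
Proof.
  intros Hx Hy HR. induction n as [|n IH].
  - simpl. replace (1 - 1)%C with (RtoC 0) by ring. rewrite Cmod_0. lra.
  - rewrite S_INR. cbn [Cpow pow].
    replace (x * x ^ n - y * y ^ n)%C with (x * (x ^ n - y ^ n) + (x - y) * y ^ n)%C by ring.
    eapply Rle_trans; [apply Cmod_triangle|]. rewrite !Cmod_mult, Cmod_pow.
    assert (Hyn : Cmod y ^ n <= R ^ n) by (apply pow_incr; split; [apply Cmod_ge_0|auto]).
    assert (HRn : 0 < R ^ n) by (apply pow_lt; lra).
    pose proof (Cmod_ge_0 (x - y)). pose proof (Cmod_ge_0 x). pose proof (Cmod_ge_0 (x ^ n - y ^ n)).
    pose proof (pos_INR n).
    assert (Cmod x * Cmod (x ^ n - y ^ n) <= R * (INR n * Cmod (x - y) * R ^ n))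
      by (apply Rmult_le_compat; auto).
    assert (Cmod (x - y) * Cmod y ^ n <= Cmod (x - y) * (R * R ^ n)).
    { apply Rmult_le_compat_l; auto. nra. }
    lra.
Qed.

(** The cosine and the Gaussian [exp (- u^2 / 2)] have the same expansion up to the third order;
    with [u] of size [1 / N] the [2M]-th powers therefore differ by [O (M / N^3) = O (1 / N)]. *)
Lemma Ccos_gauss_diff u : Cmod u <= 1 -> 
  Cmod (Ccos u - Cexp (- (u * u / 2))) <= 6 * Cmod u ^ 3.
Proof.
  intros Hu. pose proof (Cmod_ge_0 u) as H0.
  assert (H1 := Ccos_near u). assert (H2 := Cexp_taylor2 (- (u * u / 2))).
  assert (Em : Cmod (- (u * u / 2)) = Cmod u ^ 2 / 2).
  { rewrite Cmod_opp, Cmod_div, Cmod_mult, Cmod_R, Rabs_pos_eq by (apply C2_neq0 || lra).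
    field. }
  rewrite Em in H2.
  assert (E1 : exp (Cmod u) <= 3) by (eapply Rle_trans; [apply exp_le; exact Hu|apply exp_le_3]).
  assert (E2 : exp (Cmod u ^ 2 / 2) <= 3).
  { eapply Rle_trans; [apply exp_le|apply exp_le_3]. nra. }
  replace (Ccos u - Cexp (- (u * u / 2)))%C with
    ((Ccos u - (1 - u * u / 2)) + - (Cexp (- (u * u / 2)) - 1 - - (u * u / 2)))%C by ring.
  eapply Rle_trans; [apply Cmod_triangle|]. rewrite Cmod_opp.
  assert (0 <= Cmod u ^ 3) by (apply pow_le; auto).
  assert (Cmod u ^ 3 * exp (Cmod u) <= Cmod u ^ 3 * 3) by (apply Rmult_le_compat_l; auto).
  assert ((Cmod u ^ 2 / 2) ^ 2 * exp (Cmod u ^ 2 / 2) <= (Cmod u ^ 2 / 2) ^ 2 * 3)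
    by (apply Rmult_le_compat_l; [apply pow2_ge_0|auto]).
  assert ((Cmod u ^ 2 / 2) ^ 2 <= Cmod u ^ 3) by (replace ((Cmod u ^ 2 / 2) ^ 2) with (Cmod u ^ 3 * (Cmod u / 4)) by field; nra).
  lra.
Qed.

Lemma Ccos_upper u : Cmod u <= 1 -> Cmod (Ccos u) <= exp (9 * Cmod u ^ 2).
Proof.
  intros Hu. assert (H := Ccos_mod2 u).
  assert (Hi : Rabs (Im u) <= 1) by (eapply Rle_trans; [apply im_le_Cmod|auto]).
  apply sinh_upper in Hi.
  assert (Im u ^ 2 <= Cmod u ^ 2).
  { rewrite <- (pow2_abs (Im u)). apply pow_incr. split; [apply Rabs_pos|apply im_le_Cmod]. }
  pose proof (pow2_ge_0 (sin (Re u))). pose proof (Cmod_ge_0 (Ccos u)).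
  pose proof (pow2_ge_0 (Cmod u)).
  eapply Rle_trans; [|apply exp_ineq1_le].
  destruct (Rle_dec (Cmod (Ccos u)) 1); [lra|].
  assert (Cmod (Ccos u) <= Cmod (Ccos u) ^ 2) by nra. lra.
Qed.

Lemma Ccos_pow_lim t (w : C) : 0 < t ->
  Clim eventually (fun h => Ccos (PI * w / RtoC (2 * INR h + 1)) ^ (2 * deg t h))%C
    (Cexp (- (PI * RtoC t * (w * w)))).
Proof.
  intros Ht. pose proof PI_RGT_0 as HP.
  set (N := fun h => 2 * INR h + 1). fold (N 0%nat).
  assert (HN : forall h, 1 <= N h) by (intros h; unfold N; pose proof (pos_INR h); lra).
  set (u := fun h => (PI * w / RtoC (N h))%C).
  set (b := PI * Cmod w). assert (Hb : 0 <= b) by (apply Rmult_le_pos; [lra|apply Cmod_ge_0]).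
  assert (Hu : forall h, Cmod (u h) = b / N h).
  { intros h. specialize (HN h). unfold u, b.
    rewrite Cmod_div, Cmod_mult, !Cmod_R, !Rabs_pos_eq by (try apply RtoC_neq0; lra). easy. }
  assert (HtP : 0 < t / PI) by (apply Rdiv_lt_0_compat; lra).
  assert (HM : forall h, INR (deg t h) <= (t / PI + 1) * N h ^ 2).
  { intros h. destruct (deg_spec t h Ht) as [_ H]. fold (N h) in H. specialize (HN h).
    replace (t * N h ^ 2 / PI) with (t / PI * N h ^ 2) in H by (field; lra). nra. }
  assert (L1 : Clim eventually (fun h => Cexp (- (u h * u h / 2)) ^ (2 * deg t h))%C
     (Cexp (- (PI * RtoC t * (w * w))))).
  { apply (Clim_ext eventually (fun h =>
       Cexp (RtoC (INR (deg t h) / N h ^ 2) * (- (PI * PI * (w * w)))))%C).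
    - intros h. rewrite Cexp_pow. f_equal. unfold u. rewrite mult_INR.
      rewrite RtoC_div, RtoC_pow, RtoC_mult by (apply pow_nonzero; specialize (HN h); lra).
      replace (INR 2) with 2 by (simpl; ring). cbn [Cpow]. field.
      apply RtoC_neq0. specialize (HN h); lra.
    - replace (- (PI * t * (w * w)))%C with (RtoC (t / PI) * (- (PI * PI * (w * w))))%C.
      2:{ rewrite RtoC_div by lra. field. apply RtoC_neq0; lra. }
      apply Clim_Cexp; [apply _|]. apply Clim_mult; [apply _| |apply Clim_const, _].
      apply Clim_RtoC; [apply _|]. exact (is_lim_seq_deg t Ht). }
  assert (L2 : Clim eventually (fun h => Ccos (u h) ^ (2 * deg t h) - Cexp (- (u h * u h / 2)) ^ (2 * deg t h))%C 0%C).
  { set (K := 12 * (t / PI + 1) * b ^ 3 * exp (18 * (t / PI + 1) * b ^ 2)).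
    apply (Clim_dominated eventually _ _ (fun h => K * / N h)).
    - exists (Z.to_nat (up b)). intros h Hh.
      match goal with |- Cmod (?x - RtoC 0)%C <= _ => replace (x - 0)%C with x by ring end.
      assert (HbN : b <= N h).
      { destruct (archimed b) as [A1 _]. apply Rle_trans with (INR h).
        - apply Rle_trans with (IZR (up b)); [lra|]. rewrite INR_IZR_INZ. apply IZR_le. lia.
        - unfold N. pose proof (pos_INR h). lra. }
      specialize (HN h). specialize (HM h). specialize (Hu h).
      assert (Hu1 : Cmod (u h) <= 1) by (rewrite Hu; apply div_le; lra).
      set (R := exp (9 * Cmod (u h) ^ 2)).
      assert (HR : 1 <= R) by (apply exp_ge_1; pose proof (pow2_ge_0 (Cmod (u h))); lra).
      eapply Rle_trans; [apply (Cpow_diff_le _ _ R)|].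
      + now apply Ccos_upper.
      + eapply Rle_trans; [apply Cexp_mod_le|]. apply exp_le.
        rewrite Cmod_opp, Cmod_div, Cmod_mult, Cmod_R, Rabs_pos_eq by (apply C2_neq0 || lra).
        pose proof (pow2_ge_0 (Cmod (u h))). simpl in *. lra.
      + exact HR.
      + assert (ER : R ^ (2 * deg t h) <= exp (18 * (t / PI + 1) * b ^ 2)).
        { unfold R. rewrite exp_pow_nat, mult_INR. apply exp_le. rewrite Hu. simpl (INR 2).
          apply Rle_trans with (2 * ((t / PI + 1) * N h ^ 2) * (9 * (b / N h) ^ 2)).
          - apply Rmult_le_compat_r; [|lra]. pose proof (pow2_ge_0 (b / N h)); lra.
          - right. field. lra. }
        pose proof (Ccos_gauss_diff (u h) Hu1) as Hd. rewrite Hu in Hd.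
        rewrite mult_INR. simpl (INR 2). pose proof (pos_INR (deg t h)).
        pose proof (Cmod_ge_0 (Ccos (u h) - Cexp (- (u h * u h / 2)))).
        apply Rle_trans with ((1 + 1) * ((t / PI + 1) * N h ^ 2) * (6 * (b / N h) ^ 3)
           * exp (18 * (t / PI + 1) * b ^ 2)).
        * apply Rmult_le_compat; [|apply pow_le; lra| |exact ER].
          -- apply Rmult_le_pos; [|auto]. lra.
          -- apply Rmult_le_compat; auto; lra.
        * right. unfold K. field. lra.
    - replace 0 with (K * 0) by ring.
      apply (is_lim_seq_mult' (fun _ => K) (fun h => / N h) K 0);
        [apply is_lim_seq_const|apply is_lim_seq_invN]. }
  apply (Clim_ext eventually (fun h => (Ccos (u h) ^ (2 * deg t h) - Cexp (- (u h * u h / 2)) ^ (2 * deg t h))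
     + Cexp (- (u h * u h / 2)) ^ (2 * deg t h))%C).
  { intros h. unfold u, N. ring. }
  pose proof (Clim_plus eventually _ _ _ _ L2 L1) as L. now rewrite Cplus_0_l in L.
Qed.

(** The form in which Gaussian decay is used: a polynomial and an exponential factor cost
    nothing, and the result is dominated by the summable majorant. *)
Lemma gauss_bound c b : 0 < c -> exists B, 0 < B /\
  forall x, (1 + Rabs x) * exp (b * Rabs x - c * x ^ 2) <= B / (1 + x ^ 2).
Proof.
  intros Hc. destruct (exp_poly_bound (c / 2) 2) as (B & HB & H); [lra|].
  exists (2 * exp (b ^ 2 / (2 * c)) * B). split.
  { apply Rmult_lt_0_compat; [|auto]. apply Rmult_lt_0_compat; [lra|apply exp_pos]. }
  intros x. specialize (H (x ^ 2) (pow2_ge_0 x)). pose proof (pow2_ge_0 x) as Hx.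
  apply le_div; [lra|].
  assert (E : exp (b * Rabs x - c * x ^ 2) <= exp (b ^ 2 / (2 * c)) * exp (- (c / 2 * x ^ 2))).
  { rewrite <- exp_plus. apply exp_le. rewrite <- (pow2_abs x).
    assert (0 <= (b - c * Rabs x) ^ 2 / (2 * c)).
    { apply Rmult_le_pos; [apply pow2_ge_0|left; apply Rinv_0_lt_compat; lra]. }
    replace ((b - c * Rabs x) ^ 2 / (2 * c)) with
      (b ^ 2 / (2 * c) - b * Rabs x + c / 2 * Rabs x ^ 2) in H0 by (field; lra). lra. }
  assert (Ha : 1 + Rabs x <= 2 * (1 + x ^ 2)).
  { rewrite <- (pow2_abs x). nra. }
  pose proof (exp_pos (b ^ 2 / (2 * c))). pose proof (Rabs_pos x).
  apply Rle_trans with ((2 * (1 + x ^ 2)) * (exp (b ^ 2 / (2 * c)) * exp (- (c / 2 * x ^ 2))) * (1 + x ^ 2)).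
  - apply Rmult_le_compat_r; [lra|]. apply Rmult_le_compat; auto; [lra|left; apply exp_pos].
  - replace ((2 * (1 + x ^ 2)) * (exp (b ^ 2 / (2 * c)) * exp (- (c / 2 * x ^ 2))) * (1 + x ^ 2))
      with (2 * exp (b ^ 2 / (2 * c)) * ((1 + x ^ 2) ^ 2 * exp (- (c / 2 * x ^ 2)))) by ring.
    apply Rmult_le_compat_l; lra.
Qed.

Lemma half_index_bound (j : Z) : / (1 + (IZR j + 1 / 2) ^ 2) <= 2 * / (1 + IZR j ^ 2).
Proof.
  pose proof (pow2_ge_0 (IZR j)). pose proof (pow2_ge_0 (IZR j + 1 / 2)).
  apply Rmult_le_reg_r with ((1 + (IZR j + 1 / 2) ^ 2) * (1 + IZR j ^ 2)).
  - apply Rmult_lt_0_compat; lra.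
  - field_simplify; [|lra|lra]. nra.
Qed.

Lemma inv_sq_pos (n : Z) : 0 < / (1 + IZR n ^ 2).
Proof. apply Rinv_0_lt_compat. pose proof (pow2_ge_0 (IZR n)). lra. Qed.

Lemma Cexp_mod_im (k : R) (X : C) : Cmod (Cexp (2 * PI * Ci * RtoC k * X)) <= exp (2 * PI * Cmod X * Rabs k).
Proof.
  eapply Rle_trans; [apply Cexp_mod_le|]. apply exp_le. pose proof PI_RGT_0.
  rewrite !Cmod_mult, Cmod_Ci, !Cmod_R, (Rabs_pos_eq 2), (Rabs_pos_eq PI) by lra.
  right; ring.
Qed.

Definition theta_src (t : R) (X : C) (n : Z) : C :=
  (RtoC (sg n) * ((X + RtoC (IZR n)) *
     Cexp (- (PI * RtoC t * ((X + RtoC (IZR n)) * (X + RtoC (IZR n)))))))%C.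

Definition theta_dst (t : R) (X : C) (j : Z) : C :=
  (RtoC ((IZR j + 1 / 2) * exp (- (PI * (IZR j + 1 / 2) ^ 2 / t)))
   * Cexp (2 * PI * Ci * RtoC (IZR j + 1 / 2) * X))%C.

Definition theta_approx (t : R) (X : C) (h : nat) (l : Z) : C :=
  (RtoC (sg l) * ((RtoC ((2 * INR h + 1) / PI) *
      Csin (PI * (X + RtoC (IZR l)) / RtoC (2 * INR h + 1)))
   * Ccos (PI * (X + RtoC (IZR l)) / RtoC (2 * INR h + 1)) ^ (2 * deg t h)))%C.

Lemma theta_approx_bound t X : 0 < t -> exists B, 0 < B /\
  eventually (fun h => forall l, In l (zlist h) ->
    Cmod (theta_approx t X h l) <= B * / (1 + IZR l ^ 2)).
Proof.
  intros Ht. pose proof PI_RGT_0 as HP. pose proof PI_upper as HP'.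
  assert (HtP : 0 < t / PI) by (apply Rdiv_lt_0_compat; lra).
  destruct (gauss_bound (PI * t / 32) 0) as (B0 & HB0 & HG).
  { apply Rdiv_lt_0_compat; [|lra]. apply Rmult_lt_0_compat; lra. }
  pose proof (Cmod_ge_0 X) as HX0.
  set (k1 := 9 * (PI * Cmod X) ^ 2 * (t / PI + 1)).
  set (k2 := PI * t * Cmod X ^ 2 / 16).
  exists (9 * (Cmod X + 1) * exp (k1 + k2) * B0). split.
  { apply Rmult_lt_0_compat; auto. apply Rmult_lt_0_compat; [lra|apply exp_pos]. }
  exists (Z.to_nat (up (100 * (Cmod X + 1)))). intros h Hh l Hl.
  apply zlist_In in Hl.
  assert (HN : 100 * (Cmod X + 1) <= 2 * INR h + 1).
  { destruct (archimed (100 * (Cmod X + 1))) as [A1 _]. apply Rle_trans with (INR h).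
    - apply Rle_trans with (IZR (up (100 * (Cmod X + 1)))); [lra|].
      rewrite INR_IZR_INZ. apply IZR_le. lia.
    - pose proof (pos_INR h). lra. }
  assert (Hlh : Rabs (IZR l) <= INR h).
  { rewrite <- abs_IZR, INR_IZR_INZ. apply IZR_le. lia. }
  destruct (deg_spec t h Ht) as [HM1 HM2].
  unfold theta_approx. set (N := 2 * INR h + 1) in *.
  assert (HlN : Rabs (IZR l) <= N / 2) by (unfold N; lra).
  set (w := (X + IZR l)%C). set (u := (PI * w / RtoC N)%C).
  assert (HNC : RtoC N <> 0%C) by (apply RtoC_neq0; lra).
  assert (Hw : Cmod w <= Cmod X + Rabs (IZR l)).
  { unfold w. eapply Rle_trans; [apply Cmod_triangle|]. rewrite Cmod_R. lra. }
  assert (Hu : Cmod u = PI * Cmod w / N).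
  { unfold u. rewrite Cmod_div, Cmod_mult, !Cmod_R, !Rabs_pos_eq by (auto; lra). easy. }
  pose proof (Cmod_ge_0 w) as Hw0.
  assert (Hu2 : Cmod u <= 2).
  { rewrite Hu. apply div_le; [lra|]. nra. }
  assert (Hre : Re u = PI * Re w / N).
  { unfold u. destruct w; unfold Cdiv, Cinv, Cmult, RtoC, Re; simpl. field; lra. }
  assert (Him : Im u = PI * Im X / N).
  { unfold u, w. destruct X; unfold Cdiv, Cinv, Cmult, RtoC, Im; simpl. field; lra. }
  assert (Hre2 : Rabs (Re u) <= 2) by (eapply Rle_trans; [apply re_le_Cmod|auto]).
  assert (HimX : Rabs (Im X) <= Cmod X) by apply im_le_Cmod.
  assert (Him1 : Rabs (Im u) <= 1).
  { rewrite Him. unfold Rdiv. rewrite !Rabs_mult, (Rabs_pos_eq PI), (Rabs_pos_eq (/ N)) by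
      (try left; try apply Rinv_0_lt_compat; lra).
    apply div_le; [lra|]. pose proof (Rabs_pos (Im X)). nra. }
  assert (HN2 : 0 < N ^ 2) by (apply pow_lt; lra).
  assert (HN1 : 1 <= N ^ 2) by nra.
  replace (t * N ^ 2 / PI) with (t / PI * N ^ 2) in HM1, HM2 by (field; lra).
  assert (Hsin : Cmod (RtoC (N / PI) * Csin u) <= 9 * ((Cmod X + 1) * (1 + Rabs (IZR l)))).
  { rewrite Cmod_mult, Cmod_R, Rabs_pos_eq by (left; apply Rdiv_lt_0_compat; lra).
    apply Rle_trans with (N / PI * (Cmod u * 9)).
    - apply Rmult_le_compat_l; [left; apply Rdiv_lt_0_compat; lra|].
      eapply Rle_trans; [apply Csin_le|]. apply Rmult_le_compat_l; [apply Cmod_ge_0|].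
      apply Rle_trans with (exp (1 + 1)); [apply exp_le; lra|].
      rewrite exp_plus. pose proof exp_le_3. pose proof (exp_pos 1). nra.
    - rewrite Hu. replace (N / PI * (PI * Cmod w / N * 9)) with (9 * Cmod w) by (field; lra).
      pose proof (Rabs_pos (IZR l)). nra. }
  assert (Hcos : Cmod (Ccos u ^ (2 * deg t h)) <=
     exp (k1 + k2) * exp (- (PI * t / 32 * IZR l ^ 2))).
  { eapply Rle_trans; [apply Ccos_pow_bound; auto|]. rewrite <- exp_plus. apply exp_le.
    rewrite Hre, Him.
    replace (Re w) with (Re X + IZR l) by (unfold w; destruct X; reflexivity).
    set (M := INR (deg t h)) in *.
    assert (H1 : M * (9 * (PI * Im X / N) ^ 2) <= k1).
    { apply Rle_trans with ((t / PI + 1) * N ^ 2 * (9 * (PI * Im X / N) ^ 2)).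
      - apply Rmult_le_compat_r; [pose proof (pow2_ge_0 (PI * Im X / N)); lra|]. lra.
      - replace ((t / PI + 1) * N ^ 2 * (9 * (PI * Im X / N) ^ 2))
          with (9 * (PI ^ 2 * Im X ^ 2) * (t / PI + 1)) by (field; lra).
        unfold k1. apply Rmult_le_compat_r; [lra|]. apply Rmult_le_compat_l; [lra|].
        rewrite Rpow_mult_distr. apply Rmult_le_compat_l; [apply pow2_ge_0|].
        rewrite <- (pow2_abs (Im X)). apply pow_incr. split; [apply Rabs_pos|auto]. }
    assert (H2 : PI * t / 16 * (Re X + IZR l) ^ 2 <= M * ((PI * (Re X + IZR l) / N) ^ 2 / 16)).
    { apply Rle_trans with (t / PI * N ^ 2 * ((PI * (Re X + IZR l) / N) ^ 2 / 16)).
      - right. field. lra.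
      - apply Rmult_le_compat_r; [pose proof (pow2_ge_0 (PI * (Re X + IZR l) / N)); lra|]. lra. }
    assert (H3 : IZR l ^ 2 / 2 - Cmod X ^ 2 <= (Re X + IZR l) ^ 2).
    { assert (Re X ^ 2 <= Cmod X ^ 2).
      { rewrite <- (pow2_abs (Re X)). apply pow_incr. split; [apply Rabs_pos|apply re_le_Cmod]. }
      pose proof (pow2_ge_0 (IZR l + 2 * Re X)). nra. }
    assert (H4 : PI * t / 16 * (IZR l ^ 2 / 2 - Cmod X ^ 2) <= PI * t / 16 * (Re X + IZR l) ^ 2).
    { apply Rmult_le_compat_l; [|exact H3].
      left. apply Rdiv_lt_0_compat; [|lra]. apply Rmult_lt_0_compat; lra. }
    unfold k2. lra. }
  rewrite Cmod_mult, sg_Cmod, Rmult_1_l, Cmod_mult.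
  specialize (HG (IZR l)). rewrite Rmult_0_l, Rminus_0_l in HG.
  apply Rle_trans with (9 * ((Cmod X + 1) * (1 + Rabs (IZR l))) *
     (exp (k1 + k2) * exp (- (PI * t / 32 * IZR l ^ 2)))).
  - apply Rmult_le_compat; auto; apply Cmod_ge_0.
  - replace (9 * ((Cmod X + 1) * (1 + Rabs (IZR l))) *
     (exp (k1 + k2) * exp (- (PI * t / 32 * IZR l ^ 2)))) with
     (9 * (Cmod X + 1) * exp (k1 + k2) * ((1 + Rabs (IZR l)) * exp (- (PI * t / 32 * IZR l ^ 2))))
     by ring.
    rewrite (Rmult_assoc _ B0). apply Rmult_le_compat_l; [|exact HG].
    apply Rmult_le_pos; [lra|left; apply exp_pos].
Qed.

(** Dominated convergence on both sides of [theta_finite]. The factor [kappa] comes from the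
    asymptotics of the binomial coefficients. *)
Lemma theta_transform_const : exists kappa, 0 <= kappa /\ forall t (X : C), 0 < t ->
  exists S, has_sum (theta_dst t X) S /\
    has_sum (theta_src t X) (RtoC (kappa / (t * sqrt t)) / Ci * S)%C.
Proof.
  destruct delta_lim as (kappa & Hk & Hlim). exists kappa. split; auto.
  intros t X Ht. pose proof PI_RGT_0 as HP.
  set (A := fun h l => if in_dec eqdec l (zlist h) then theta_approx t X h l else 0%C).
  set (D := fun h j => (RtoC (delta t h j) / Ci
     * Cexp (2 * PI * Ci * RtoC (IZR j + 1 / 2) * X))%C).
  set (S := fun h => csum (theta_approx t X h) (zlist h)).
  assert (HSA : forall h, has_sum (A h) (S h)) by (intros h; apply has_sum_zlist_finite).
  assert (HSD : forall h, has_sum (D h) (S h)).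
  { intros h. pose proof (pos_INR h).
    assert (H1 := has_sum_scal (RtoC ((2 * INR h + 1) / PI)) _ _ (theta_finite h (deg t h) X)).
    rewrite <- csum_scal in H1. unfold S.
    rewrite (csum_ext (theta_approx t X h) (fun l => RtoC ((2 * INR h + 1) / PI) *
      (RtoC (sg l) * (Csin (PI * (X + RtoC (IZR l)) / RtoC (2 * INR h + 1))
       * Ccos (PI * (X + RtoC (IZR l)) / RtoC (2 * INR h + 1)) ^ (2 * deg t h))))%C).
    - revert H1. apply has_sum_ext. intros j. unfold D, delta.
      match goal with |- (_ * (RtoC (_ * ?y) / _ * ?z))%C = _ => set (Y := y); set (Z := z) end.
      replace ((2 * INR h + 1) ^ 2 / PI * Y) with ((2 * INR h + 1) / PI * ((2 * INR h + 1) * Y))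
        by (field; lra).
      rewrite (RtoC_mult ((2 * INR h + 1) / PI)). unfold Cdiv. ring.
    - intros l _. unfold theta_approx. ring. }
  (* the finite sum over residues, extended by 0: its terms are those of sin cos^(2M) *)
  destruct (theta_approx_bound t X Ht) as (B & HB & HbA).
  assert (HgA : summable (fun n : Z => B * / (1 + IZR n ^ 2)))
    by (apply summable_scal; [lra|apply summable_inv_sq]).
  assert (HbA' : eventually (fun h => forall l, Cmod (A h l) <= B * / (1 + IZR l ^ 2))).
  { revert HbA. apply filter_imp. intros h Hh l. unfold A.
    destruct (in_dec eqdec l (zlist h)) as [Hl|Hl]; [auto|].
    rewrite Cmod_0. apply Rmult_le_pos; [lra|left; apply inv_sq_pos]. }
  assert (HlA : forall l, Clim eventually (fun h => A h l) (theta_src t X l)).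
  { intros l. apply (Clim_zlist_indicator eventually (theta_approx t X) (fun h => h)).
    - apply filterlim_id.
    - unfold theta_src, theta_approx. apply Clim_scal; [apply _|].
      apply Clim_mult; [apply _| |].
      + apply (Clim_Csin_scale eventually (fun h => 2 * INR h + 1)).
        * apply filter_forall. intros h. pose proof (pos_INR h). lra.
        * exact is_lim_seq_invN.
      + now apply Ccos_pow_lim. }
  assert (HbA0 : forall l, Cmod (theta_src t X l) <= B * / (1 + IZR l ^ 2)).
  { intros l. apply (Clim_bound eventually (fun h => A h l)); auto.
    revert HbA'. apply filter_imp. auto. }
  destruct (summable_has_sum _ _ HgA HbA0) as [S1 HS1].
  assert (L1 : Clim eventually S S1).
  { apply (has_sum_lim eventually A (theta_src t X) _ S S1 HgA); auto.
    now apply filter_forall. }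
  (* the Fourier coefficients decay fast enough to absorb the growth of the exponentials in X *)
  destruct (delta_bound t Ht) as (K & c & HK & Hc & HbD).
  destruct (gauss_bound c (2 * PI * Cmod X) Hc) as (B2 & HB2 & HG).
  set (B3 := K * B2 * 2).
  assert (HB3 : 0 <= B3) by (unfold B3; apply Rmult_le_pos; [apply Rmult_le_pos|]; lra).
  assert (HgD : summable (fun n : Z => B3 * / (1 + IZR n ^ 2)))
    by (apply summable_scal; [exact HB3|apply summable_inv_sq]).
  assert (HbD' : eventually (fun h => forall j, Cmod (D h j) <= B3 * / (1 + IZR j ^ 2))).
  { exists 1%nat. intros h Hh j. specialize (HbD h j Hh). specialize (HG (IZR j + 1 / 2)).
    unfold D. rewrite Cmod_mult, Cmod_div, Cmod_Ci, Cmod_R by apply Ci_neq0.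
    pose proof (Cexp_mod_im (IZR j + 1 / 2) X) as HE.
    pose proof (half_index_bound j) as Hj.
    set (k := IZR j + 1 / 2) in *. pose proof (Rabs_pos k).
    apply Rle_trans with (K * (Rabs k * exp (- (c * k ^ 2))) * exp (2 * PI * Cmod X * Rabs k)).
    - apply Rmult_le_compat; auto; try apply Cmod_ge_0.
      + unfold Rdiv. rewrite Rinv_1, Rmult_1_r. apply Rabs_pos.
      + unfold Rdiv. now rewrite Rinv_1, Rmult_1_r.
    - replace (K * (Rabs k * exp (- (c * k ^ 2))) * exp (2 * PI * Cmod X * Rabs k))
        with (K * (Rabs k * exp (2 * PI * Cmod X * Rabs k - c * k ^ 2)))
        by (unfold Rminus; rewrite exp_plus; ring).
      replace (B3 * / (1 + IZR j ^ 2)) with (K * (B2 * (2 * / (1 + IZR j ^ 2)))) by (unfold B3; ring).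
      apply Rmult_le_compat_l; [exact HK|].
      eapply Rle_trans; [|eapply Rle_trans; [exact HG|]].
      + apply Rmult_le_compat_r; [left; apply exp_pos|lra].
      + unfold Rdiv. apply Rmult_le_compat_l; lra. }
  set (lam := RtoC (kappa / (t * sqrt t))).
  assert (HlD : forall j, Clim eventually (fun h => D h j) (lam / Ci * theta_dst t X j)%C).
  { intros j. unfold D, theta_dst.
    replace (lam / Ci * (RtoC ((IZR j + 1 / 2) * exp (- (PI * (IZR j + 1 / 2) ^ 2 / t))) *
       Cexp (2 * PI * Ci * RtoC (IZR j + 1 / 2) * X)))%C with
      (RtoC (kappa / (t * sqrt t) * ((IZR j + 1 / 2) * exp (- (PI * (IZR j + 1 / 2) ^ 2 / t)))) / Ci *
       Cexp (2 * PI * Ci * RtoC (IZR j + 1 / 2) * X))%C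
      by (rewrite (RtoC_mult (kappa / _)); unfold lam, Cdiv; ring).
    unfold Cdiv. apply Clim_mult; [apply _| |apply Clim_const, _].
    apply Clim_mult; [apply _| |apply Clim_const, _].
    apply Clim_RtoC; [apply _|]. exact (Hlim t j Ht). }
  assert (HgT : exists B4, 0 <= B4 /\ forall j, Cmod (theta_dst t X j) <= B4 * / (1 + IZR j ^ 2)).
  { destruct (gauss_bound (PI / t) (2 * PI * Cmod X)) as (B4 & HB4 & HG4);
      [apply Rdiv_lt_0_compat; lra|].
    exists (B4 * 2). split; [lra|]. intros j. specialize (HG4 (IZR j + 1 / 2)).
    pose proof (Cexp_mod_im (IZR j + 1 / 2) X) as HE.
    pose proof (half_index_bound j) as Hj.
    unfold theta_dst. rewrite Cmod_mult, Cmod_R. set (k := IZR j + 1 / 2) in *.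
    rewrite Rabs_mult, (Rabs_pos_eq (exp _)) by (left; apply exp_pos).
    pose proof (Rabs_pos k).
    apply Rle_trans with (Rabs k * exp (- (PI * k ^ 2 / t)) * exp (2 * PI * Cmod X * Rabs k)).
    - apply Rmult_le_compat_l; [|exact HE]. apply Rmult_le_pos; [auto|left; apply exp_pos].
    - rewrite Rmult_assoc, <- exp_plus.
      replace (- (PI * k ^ 2 / t) + 2 * PI * Cmod X * Rabs k)
        with (2 * PI * Cmod X * Rabs k - PI / t * k ^ 2) by (field; lra).
      eapply Rle_trans; [|eapply Rle_trans; [exact HG4|]].
      + apply Rmult_le_compat_r; [left; apply exp_pos|lra].
      + unfold Rdiv. rewrite Rmult_assoc. apply Rmult_le_compat_l; lra. }
  destruct HgT as (B4 & HB4 & HbT).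
  destruct (summable_has_sum (theta_dst t X) (fun n : Z => B4 * / (1 + IZR n ^ 2))) as [S2 HS2]; auto.
  { apply summable_scal; [exact HB4|apply summable_inv_sq]. }
  exists S2. split; auto.
  replace (lam / Ci * S2)%C with S1; [exact HS1|].
  apply (Clim_unique eventually S); auto.
  apply (has_sum_lim eventually D (fun j => lam / Ci * theta_dst t X j)%C _ S _ HgD); auto.
  - now apply filter_forall.
  - now apply has_sum_scal.
Qed.

Lemma theta_src_half t n : theta_src t (RtoC (1 / 2)) n =
  RtoC (sg n * ((IZR n + 1 / 2) * exp (- (PI * t * (IZR n + 1 / 2) ^ 2)))).
Proof.
  unfold theta_src. rewrite <- RtoC_plus, <- !RtoC_mult, <- RtoC_opp.
  replace (1 / 2 + IZR n) with (IZR n + 1 / 2) by ring.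
  replace (Cexp (RtoC (- (PI * t * ((IZR n + 1 / 2) * (IZR n + 1 / 2))))))
    with (RtoC (exp (- (PI * t * (IZR n + 1 / 2) ^ 2)))).
  - now rewrite <- !RtoC_mult.
  - unfold Cexp, RtoC. simpl. rewrite cos_0, sin_0. f_equal; [|ring].
    rewrite Rmult_1_r. f_equal. ring.
Qed.

Lemma theta_dst_half t j : 0 < t ->
  theta_dst t (RtoC (1 / 2)) j = (Ci * theta_src (/ t) (RtoC (1 / 2)) j)%C.
Proof.
  intros Ht. rewrite theta_src_half. unfold theta_dst.
  replace (2 * PI * Ci * RtoC (IZR j + 1 / 2) * RtoC (1 / 2))%C
    with (Ci * PI * RtoC (IZR j) + Ci * RtoC (PI / 2))%C.
  - rewrite Cexp_add, Cexp_PI_Z.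
    assert (E : Cexp (Ci * RtoC (PI / 2)) = Ci).
    { unfold Cexp. replace (Re (Ci * RtoC (PI / 2))) with 0 by (simpl; ring).
      replace (Im (Ci * RtoC (PI / 2))) with (PI / 2) by (simpl; ring).
      rewrite exp_0, cos_PI2, sin_PI2. unfold Ci. f_equal; ring. }
    rewrite E. replace (PI * / t * (IZR j + 1 / 2) ^ 2) with (PI * (IZR j + 1 / 2) ^ 2 / t)
      by (field; lra).
    rewrite (RtoC_mult (sg j)). ring.
  - rewrite RtoC_plus, !RtoC_div by lra. field.
Qed.

(** After multiplication by [exp (PI t / 4)] only the terms of index 0 and [- 1], both equal to
    [1/2], survive as [t] tends to infinity, so the sum is close to 1 for large [t]. *)
Lemma theta_half_nonzero : exists t, 0 < t /\ forall V,
  has_sum (theta_src t (RtoC (1 / 2))) V -> V <> 0%C.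
Proof.
  pose proof PI_RGT_0 as HP.
  set (f := fun t n => RtoC (sg n * ((IZR n + 1 / 2) * exp (- (PI * t * (IZR n ^ 2 + IZR n)))))).
  set (f0 := fun n : Z => if in_dec Z.eq_dec n [0%Z; (-1)%Z] then RtoC (1 / 2) else 0%C).
  destruct (gauss_bound PI 0 HP) as (B & HB & HG).
  assert (Hg : summable (fun n : Z => exp (PI / 4) * B * 2 * / (1 + IZR n ^ 2))).
  { apply summable_scal; [|apply summable_inv_sq]. pose proof (exp_pos (PI / 4)).
    apply Rmult_le_pos; [apply Rmult_le_pos|]; lra. }
  assert (Hint : forall n : Z, n <> 0%Z -> n <> (-1)%Z -> 1 <= IZR n ^ 2 + IZR n).
  { intros n H0 H1. replace (IZR n ^ 2 + IZR n) with (IZR (n * n + n)).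
    - apply IZR_le. nia.
    - rewrite plus_IZR, mult_IZR. ring. }
  assert (Hint0 : forall n : Z, 0 <= IZR n ^ 2 + IZR n).
  { intros n. replace (IZR n ^ 2 + IZR n) with (IZR (n * n + n)).
    - apply IZR_le. nia.
    - rewrite plus_IZR, mult_IZR. ring. }
  assert (Hb : forall t, 1 <= t -> forall n, Cmod (f t n) <= exp (PI / 4) * B * 2 * / (1 + IZR n ^ 2)).
  { intros t Ht n. unfold f. rewrite Cmod_R, !Rabs_mult, sg_abs, Rmult_1_l.
    rewrite (Rabs_pos_eq (exp _)) by (left; apply exp_pos).
    specialize (HG (IZR n + 1 / 2)). pose proof (half_index_bound n) as Hj.
    specialize (Hint0 n). set (k := IZR n + 1 / 2) in *. pose proof (Rabs_pos k).
    replace (exp (PI / 4) * B * 2 * / (1 + IZR n ^ 2)) with (exp (PI / 4) * (B * (2 * / (1 + IZR n ^ 2)))) by ring.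
    apply Rle_trans with (exp (PI / 4) * ((1 + Rabs k) * exp (0 * Rabs k - PI * k ^ 2))).
    - replace (exp (PI / 4) * ((1 + Rabs k) * exp (0 * Rabs k - PI * k ^ 2)))
        with ((1 + Rabs k) * exp (PI / 4 + (0 * Rabs k - PI * k ^ 2))) by (rewrite exp_plus; ring).
      apply Rmult_le_compat; [auto|left; apply exp_pos|lra|]. apply exp_le.
      replace (PI / 4 + (0 * Rabs k - PI * k ^ 2)) with (- (PI * (IZR n ^ 2 + IZR n)))
        by (unfold k; field).
      apply Ropp_le_contravar. apply Rmult_le_compat_r; [auto|]. nra.
    - apply Rmult_le_compat_l; [left; apply exp_pos|]. eapply Rle_trans; [exact HG|].
      apply Rmult_le_compat_l; lra. }
  assert (Hl : forall n, Clim (Rbar_locally p_infty) (fun t => f t n) (f0 n)).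
  { intros n. unfold f0. destruct (in_dec Z.eq_dec n [0%Z; (-1)%Z]) as [Hin|Hin].
    - assert (E : forall t, f t n = RtoC (1 / 2)).
      { intros t. unfold f. destruct Hin as [<-|[<-|[]]]; unfold sg; simpl; f_equal.
        - replace (- (PI * t * (0 * (0 * 1) + 0))) with 0 by ring. rewrite exp_0. lra.
        - replace (- (PI * t * (-1 * (-1 * 1) + -1))) with 0 by ring. rewrite exp_0. lra. }
      apply (Clim_ext (Rbar_locally p_infty) (fun _ => RtoC (1 / 2))); [auto|].
      apply Clim_const, _.
    - apply (Clim_dominated (Rbar_locally p_infty) _ _ (fun t => Rabs (IZR n + 1 / 2) * / t)).
      + exists 0. intros t Ht. unfold f.
        match goal with |- Cmod (?x - RtoC 0)%C <= _ => replace (x - 0)%C with x by ring end.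
        rewrite Cmod_R, !Rabs_mult, sg_abs, Rmult_1_l.
        apply Rmult_le_compat_l; [apply Rabs_pos|].
        rewrite (Rabs_pos_eq (exp _)) by (left; apply exp_pos).
        rewrite exp_Ropp. apply Rinv_le_contravar; [auto|].
        assert (Hn : 1 <= IZR n ^ 2 + IZR n).
        { apply Hint; intros ->; apply Hin; simpl; auto. }
        apply Rle_trans with (1 + PI * t * (IZR n ^ 2 + IZR n)); [|apply exp_ineq1_le].
        assert (1 <= PI) by (pose proof PI2_3_2; lra).
        assert (t <= PI * t) by nra. nra.
      + assert (Hi : filterlim Rinv (Rbar_locally p_infty) (Rbar_locally 0))
          by exact (filterlim_Rbar_inv p_infty ltac:(easy)).
        replace 0 with (Rabs (IZR n + 1 / 2) * 0) at 1 by ring.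
        apply (filterlim_comp _ _ _ Rinv (fun x => Rabs (IZR n + 1 / 2) * x) _ (locally 0)); auto.
        apply (filterlim_scal_r (K := R_AbsRing) (V := R_NormedModule) (Rabs (IZR n + 1 / 2)) 0). }
  assert (H0 : has_sum f0 (RtoC 1)).
  { replace (RtoC 1) with (csum f0 [0%Z; (-1)%Z]).
    - apply has_sum_finite.
      + repeat constructor; simpl; intuition easy.
      + intros n Hn. unfold f0. now destruct (in_dec Z.eq_dec n [0%Z; (-1)%Z]).
    - unfold f0. simpl. rewrite Cplus_0_r, <- RtoC_plus. f_equal. lra. }
  assert (Hsum : forall t, exists s, 1 <= t -> has_sum (f t) s).
  { intros t. destruct (Rle_dec 1 t) as [Ht|Ht].
    - destruct (summable_has_sum (f t) _ Hg (Hb t Ht)) as [s Hs]. exists s; auto.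
    - exists 0%C. intros; lra. }
  set (S := fun t => proj1_sig (constructive_indefinite_description _ (Hsum t))).
  assert (HS : forall t, 1 <= t -> has_sum (f t) (S t)).
  { intros t Ht. unfold S. destruct (constructive_indefinite_description _ (Hsum t)); auto. }
  assert (L : Clim (Rbar_locally p_infty) S 1%C).
  { apply (has_sum_lim (Rbar_locally p_infty) f f0 _ S 1%C Hg); auto.
    - exists 1. intros t Ht. apply Hb. lra.
    - exists 1. intros t Ht. apply HS. lra. }
  destruct (L (1 / 2) ltac:(lra)) as [T HT].
  set (t := Rmax T 1 + 1).
  assert (Ht1 : T < t) by (unfold t; pose proof (Rmax_l T 1); lra).
  assert (Ht2 : 1 < t) by (unfold t; pose proof (Rmax_r T 1); lra).
  exists t. split; [lra|]. intros V HV E. subst V.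
  apply (has_sum_scal (RtoC (exp (PI * t / 4)))) in HV.
  assert (E0 : S t = 0%C).
  { apply (has_sum_unique (f t)); [apply HS; lra|].
    replace (RtoC 0) with (RtoC (exp (PI * t / 4)) * 0)%C by ring.
    revert HV. apply has_sum_ext. intros n. rewrite theta_src_half, <- RtoC_mult. unfold f. f_equal.
    replace (- (PI * t * (IZR n ^ 2 + IZR n))) with (PI * t / 4 + - (PI * t * (IZR n + 1 / 2) ^ 2))
      by field.
    rewrite exp_plus. ring. }
  specialize (HT t Ht1). rewrite E0 in HT.
  replace (0 - 1)%C with (- (1))%C in HT by ring. rewrite Cmod_opp, Cmod_1 in HT. lra.
Qed.

(** At [X = 1/2] both sides are the same theta function, at [t] and [1/t]. Applying the
    transformation twice shows that [kappa] squares to one, as soon as this theta function is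
    not zero at some [t]. *)
Lemma theta_transform t (X : C) : 0 < t -> exists S,
  has_sum (theta_dst t X) S /\ has_sum (theta_src t X) (RtoC (/ (t * sqrt t)) / Ci * S)%C.
Proof.
  destruct theta_transform_const as (kappa & Hk & H).
  assert (Hk1 : kappa = 1).
  { destruct theta_half_nonzero as (s & Hs & Hnz).
    assert (Hs' : 0 < / s) by now apply Rinv_0_lt_compat.
    destruct (H s (RtoC (1 / 2)) Hs) as (S1 & D1 & E1).
    destruct (H (/ s) (RtoC (1 / 2)) Hs') as (S2 & D2 & E2).
    assert (Hci := Ci_neq0).
    assert (F1 : has_sum (theta_src (/ s) (RtoC (1 / 2))) (S1 / Ci)%C).
    { apply (has_sum_scal (/ Ci)) in D1. unfold Cdiv. rewrite Cmult_comm.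
      revert D1. apply has_sum_ext. intros j. rewrite theta_dst_half by auto. field. auto. }
    assert (F2 : has_sum (theta_src s (RtoC (1 / 2))) (S2 / Ci)%C).
    { apply (has_sum_scal (/ Ci)) in D2. unfold Cdiv. rewrite Cmult_comm.
      revert D2. apply has_sum_ext. intros j. rewrite theta_dst_half by auto.
      rewrite Rinv_inv. field. auto. }
    assert (G1 := has_sum_unique _ _ _ E1 F2). assert (G2 := has_sum_unique _ _ _ E2 F1).
    assert (Hnz1 := Hnz _ F2).
    assert (Hq : 0 < sqrt s) by now apply sqrt_lt_R0.
    assert (Hprod : kappa / (s * sqrt s) * (kappa / (/ s * sqrt (/ s))) = kappa * kappa).
    { rewrite sqrt_inv. field. split; lra. }
    assert (G3 : (S2 / Ci)%C = (RtoC (kappa * kappa) * (S2 / Ci))%C).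
    { rewrite <- Hprod, RtoC_mult. rewrite <- G1 at 1.
      replace (RtoC (kappa / (s * sqrt s)) / Ci * S1)%C
        with (RtoC (kappa / (s * sqrt s)) * (S1 / Ci))%C by (unfold Cdiv; ring).
      rewrite <- G2. unfold Cdiv. ring. }
    assert (G4 : ((RtoC (kappa * kappa) - 1) * (S2 / Ci))%C = 0%C).
    { replace ((RtoC (kappa * kappa) - 1) * (S2 / Ci))%C
        with (RtoC (kappa * kappa) * (S2 / Ci) - S2 / Ci)%C by ring.
      rewrite <- G3. ring. }
    assert (G5 : kappa * kappa = 1).
    { apply NNPP. intros Hne. apply (Cmult_neq_0 (RtoC (kappa * kappa) - 1) (S2 / Ci)); auto.
      rewrite <- RtoC_minus. apply RtoC_neq0. lra. }
    nra. }
  intros Ht. destruct (H t X Ht) as (S & D & E). exists S. split; auto.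
  rewrite Hk1 in E. unfold Rdiv in E. rewrite Rmult_1_l in E. exact E.
Qed.

(** * Euler's pentagonal number theorem *)

Lemma qpow_add r s z : qpow (r + s) z = (qpow r z * qpow s z)%C.
Proof.
  unfold qpow. rewrite <- Cexp_add. f_equal.
  rewrite Rmult_plus_distr_l, RtoC_plus. ring.
Qed.

Lemma qpow_0 z : qpow 0 z = 1%C.
Proof. unfold qpow. rewrite <- Cexp_0. f_equal. rewrite Rmult_0_r. ring. Qed.

Lemma qpow_neq0 r z : qpow r z <> 0%C.
Proof. apply Cexp_neq0. Qed.

Lemma qpow_mod r z : Cmod (qpow r z) = exp (- (2 * PI * r * Im z)).
Proof.
  unfold qpow. rewrite Cexp_mod. f_equal. destruct z; simpl. ring.
Qed.

Lemma qq_pow z n : (qq z ^ n)%C = qpow (INR n) z.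
Proof.
  unfold qq, qpow. rewrite Cexp_pow. f_equal. rewrite Rmult_1_r, (RtoC_mult (2 * PI)). ring.
Qed.

Fixpoint tri (n : nat) : nat := match n with O => 0 | S m => tri m + S m end.

Definition qprod (q : C) (n : nat) : C := Cprod (fun i => (1 - q ^ (S i))%C) n.

Lemma qprod_S q n : qprod q (S n) = (qprod q n * (1 - q ^ (S n)))%C.
Proof. reflexivity. Qed.

Lemma qprod_upper (q : C) (Hq : Cmod q < 1) n :
  Cmod (qprod q n) <= exp ((Cmod q - Cmod q ^ (S n)) / (1 - Cmod q)).
Proof.
  set (r := Cmod q). assert (Hr : 0 <= r < 1) by (split; [apply Cmod_ge_0|exact Hq]).
  induction n as [|n IH].
  - change (qprod q 0) with (RtoC 1). simpl. rewrite Cmod_1. apply exp_ge_1. replace (r - r * 1) with 0 by ring.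
    unfold Rdiv; lra.
  - rewrite qprod_S, Cmod_mult.
    replace ((r - r ^ S (S n)) / (1 - r)) with ((r - r ^ S n) / (1 - r) + r ^ S n).
    2:{ simpl. field. lra. }
    rewrite exp_plus. apply Rmult_le_compat; auto using Cmod_ge_0.
    eapply Rle_trans; [apply Cmod_triangle|]. rewrite Cmod_opp, Cmod_1, Cmod_pow.
    apply exp_ineq1_le.
Qed.

(** From [1 - x >= exp (- x / (1 - x))], with [x] running over a geometric progression. *)
Lemma qprod_lower (q : C) (Hq : Cmod q < 1) n :
  exp (- ((Cmod q - Cmod q ^ (S n)) / (1 - Cmod q) / (1 - Cmod q))) <= Cmod (qprod q n).
Proof.
  set (r := Cmod q). assert (Hr : 0 <= r < 1) by (split; [apply Cmod_ge_0|exact Hq]).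
  induction n as [|n IH].
  - change (qprod q 0) with (RtoC 1). simpl. rewrite Cmod_1. replace (- ((r - r * 1) / (1 - r) / (1 - r))) with 0 by (field; lra).
    rewrite exp_0. lra.
  - rewrite qprod_S, Cmod_mult.
    assert (Hx : 0 <= r ^ S n <= r).
    { split; [apply pow_le; lra|]. simpl. pose proof (pow_le r n ltac:(lra)).
      assert (r ^ n <= 1) by (rewrite <- (pow1 n); apply pow_incr; lra). nra. }
    replace (- ((r - r ^ S (S n)) / (1 - r) / (1 - r))) with
      (- ((r - r ^ S n) / (1 - r) / (1 - r)) + - (r ^ S n / (1 - r))).
    2:{ simpl. field. lra. }
    rewrite exp_plus. apply Rmult_le_compat; auto; try (left; apply exp_pos).
    apply Rle_trans with (1 - r ^ S n).
    + rewrite exp_Ropp. apply Rmult_le_reg_r with (exp (r ^ S n / (1 - r))); [apply exp_pos|].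
      rewrite Rinv_l by (pose proof (exp_pos (r ^ S n / (1 - r))); lra).
      set (x := r ^ S n) in *.
      apply Rle_trans with ((1 - x) * (1 + x / (1 - x))); [right; field; lra|].
      apply Rmult_le_compat_l; [lra|]. eapply Rle_trans; [apply exp_ineq1_le|].
      apply exp_le. unfold Rdiv. apply Rmult_le_compat_l; [lra|]. apply Rinv_le_contravar; lra.
    + unfold r. rewrite <- Cmod_pow. rewrite <- Cmod_1 at 1.
      pose proof (Cmod_triangle (1 - q ^ S n) (q ^ S n)) as H.
      replace (1 - q ^ S n + q ^ S n)%C with (RtoC 1) in H by ring. lra.
Qed.

Lemma qprod_bounds (q : C) (Hq : Cmod q < 1) : exists a b, 0 < a /\ forall n, a <= Cmod (qprod q n) <= b.
Proof.
  set (r := Cmod q). assert (Hr : 0 <= r < 1) by (split; [apply Cmod_ge_0|exact Hq]).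
  exists (exp (- (r / (1 - r) / (1 - r)))), (exp (r / (1 - r))).
  split; [apply exp_pos|]. intros n.
  assert (Hx : 0 <= r ^ S n) by (apply pow_le; lra).
  assert (H1 : (r - r ^ S n) / (1 - r) <= r / (1 - r)).
  { unfold Rdiv. apply Rmult_le_compat_r; [left; apply Rinv_0_lt_compat; lra|lra]. }
  split.
  - eapply Rle_trans; [|now apply qprod_lower]. apply exp_le, Ropp_le_contravar.
    unfold Rdiv at 1 3. apply Rmult_le_compat_r; [left; apply Rinv_0_lt_compat; lra|exact H1].
  - eapply Rle_trans; [now apply qprod_upper|]. now apply exp_le.
Qed.

Lemma qprod_neq0 (q : C) (Hq : Cmod q < 1) n : qprod q n <> 0%C.
Proof.
  destruct (qprod_bounds q Hq) as (a & b & Ha & H). apply Cmod_gt_0. specialize (H n). lra.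
Qed.

Definition shanks (q : C) (n s : nat) : C :=
  (RtoC ((-1) ^ s) * (qprod q n / qprod q s) * q ^ (s * n + tri s))%C.

(** The heart of the identity: each term of index [n + 1] differs from that of index [n] by a
    difference of consecutive values of a single product. *)
Lemma shanks_telescope (q : C) (Hq : Cmod q < 1) n K :
  csum (fun s => shanks q (S n) s - shanks q n s)%C (seq 0 (S K)) =
  (- (RtoC ((-1) ^ K) * (qprod q n / qprod q K) * q ^ (S K * S n + tri K)))%C.
Proof.
  induction K as [|K IH].
  - simpl csum. unfold shanks. rewrite qprod_S.
    replace (0 * S n + tri 0)%nat with 0%nat by (simpl; lia).
    replace (0 * n + tri 0)%nat with 0%nat by (simpl; lia).
    replace (1 * S n + tri 0)%nat with (S n) by (simpl; lia).
    change (qprod q 0) with (RtoC 1). simpl pow. change (q ^ 0)%C with (RtoC 1). field.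
  - rewrite seq_S, csum_app, IH. cbn [csum Nat.add]. unfold shanks.
    rewrite !qprod_S.
    replace (S K * S n + tri (S K))%nat with (S K * n + tri K + S K + S K)%nat by (cbn [tri]; lia).
    replace (S K * n + tri (S K))%nat with (S K * n + tri K + S K)%nat by (cbn [tri]; lia).
    replace (S K * S n + tri K)%nat with (S K * n + tri K + S K)%nat by lia.
    replace (S (S K) * S n + tri (S K))%nat with (S K * n + tri K + S K + S K + S n)%nat
      by (cbn [tri]; lia).
    rewrite !Cpow_add_r.
    assert (H1 := qprod_neq0 q Hq K). assert (H2 := qprod_neq0 q Hq (S K)). rewrite qprod_S in H2.
    assert (H3 : (1 - q ^ S K)%C <> 0%C) by (intros E; apply H2; rewrite E; ring).
    replace (RtoC ((-1) ^ S K)) with (- RtoC ((-1) ^ K))%C.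
    2:{ rewrite <- RtoC_opp. f_equal. simpl. ring. }
    set (P := qprod q n). set (Q := qprod q K) in *. set (x := (q ^ S K)%C) in *.
    set (y := (q ^ S n)%C). set (u := (q ^ (S K * n))%C). set (v := (q ^ tri K)%C).
    set (e := RtoC ((-1) ^ K)). field. auto.
Qed.

(** The sum on the left interpolates between the product, which is its term [s = 0], and the
    partial theta series on the right; the remaining terms are divisible by [q^n]. *)
Lemma shanks_identity (q : C) (Hq : Cmod q < 1) n :
  csum (shanks q n) (seq 0 (S n)) =
  (1 + csum (fun s => RtoC ((-1) ^ (S s)) * (q ^ (S s * S s + tri s) + q ^ (S s * S s + tri (S s))))%C
        (seq 0 n))%C.
Proof.
  induction n as [|n IH].
  - simpl. unfold shanks. simpl. change (qprod q 0) with (RtoC 1). field.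
  - rewrite (seq_S (S n)), csum_app. cbn [csum Nat.add].
    assert (HT := shanks_telescope q Hq n n).
    assert (Hsplit : csum (shanks q (S n)) (seq 0 (S n)) =
      (csum (shanks q n) (seq 0 (S n)) + csum (fun s => shanks q (S n) s - shanks q n s)%C (seq 0 (S n)))%C).
    { rewrite <- csum_plus. apply csum_ext. intros i _. ring. }
    rewrite Hsplit, IH, HT, (seq_S n), csum_app. cbn [csum Nat.add].
    unfold shanks. pose proof (qprod_neq0 q Hq n). pose proof (qprod_neq0 q Hq (S n)).
    replace (RtoC ((-1) ^ S n)) with (- RtoC ((-1) ^ n))%C.
    2:{ rewrite <- RtoC_opp. f_equal. simpl. ring. }
    set (A := (q ^ (S n * S n + tri n))%C). set (B := (q ^ (S n * S n + tri (S n)))%C).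
    field. auto.
Qed.

Lemma shanks_error (q : C) (Hq : Cmod q < 1) : exists B, 0 <= B /\ forall n,
  Cmod (csum (shanks q n) (seq 0 (S n)) - qprod q n) <= B * Cmod q ^ n.
Proof.
  destruct (qprod_bounds q Hq) as (a & b & Ha & Hab).
  set (r := Cmod q). assert (Hr : 0 <= r < 1) by (split; [apply Cmod_ge_0|exact Hq]).
  assert (Hb : 0 <= b) by (destruct (Hab 0%nat); lra).
  exists (b / a / (1 - r)). split.
  { repeat apply Rmult_le_pos; auto; left; apply Rinv_0_lt_compat; lra. }
  intros n.
  assert (Hterm : forall s, (1 <= s)%nat -> Cmod (shanks q n s) <= b / a * r ^ n * r ^ (s - 1)).
  { intros s Hs. unfold shanks.
    rewrite !Cmod_mult, Cmod_div, Cmod_pow, Cmod_R, pow_1_abs, Rmult_1_l by now apply qprod_neq0.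
    fold r. rewrite Rmult_assoc. 
    pose proof (Hab n) as [_ Hn]. pose proof (Hab s) as [Hs1 _].
    apply Rmult_le_compat.
    - apply Rmult_le_pos; [apply Cmod_ge_0|left; apply Rinv_0_lt_compat; lra].
    - apply pow_le; lra.
    - unfold Rdiv. apply Rmult_le_compat; auto using Cmod_ge_0.
      + left; apply Rinv_0_lt_compat; lra.
      + apply Rinv_le_contravar; lra.
    - rewrite <- pow_add.
      replace (s * n + tri s)%nat with ((n + (s - 1)) + ((s - 1) * n + tri s - (s - 1)))%nat.
      + rewrite (pow_add r (n + (s - 1))).
        rewrite <- (Rmult_1_r (r ^ (n + (s - 1)))) at 2.
        apply Rmult_le_compat_l; [apply pow_le; lra|].
        rewrite <- (pow1 ((s - 1) * n + tri s - (s - 1))). apply pow_incr; lra.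
      + assert (s <= tri s)%nat by (destruct s; simpl; lia).
        destruct s; [lia|]. simpl in *. lia. }
  assert (H : forall K, Cmod (csum (shanks q n) (seq 0 (S K)) - qprod q n)
     <= b / a * r ^ n * ((1 - r ^ K) / (1 - r))).
  { induction K as [|K IH].
    - simpl. unfold shanks. change (qprod q 0) with (RtoC 1).
      replace (0 * n + tri 0)%nat with 0%nat by (simpl; lia). simpl.
      match goal with |- Cmod ?x <= _ => replace x with (RtoC 0) by field end.
      rewrite Cmod_0. replace (1 - 1) with 0 by ring. unfold Rdiv. lra.
    - rewrite (seq_S (S K)), csum_app. cbn [csum Nat.add].
      replace (csum (shanks q n) (seq 0 (S K)) + (shanks q n (S K) + 0) - qprod q n)%C
        with ((csum (shanks q n) (seq 0 (S K)) - qprod q n) + shanks q n (S K))%C by ring.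
      eapply Rle_trans; [apply Cmod_triangle|].
      specialize (Hterm (S K) ltac:(lia)). replace (S K - 1)%nat with K in Hterm by lia.
      replace (b / a * r ^ n * ((1 - r ^ S K) / (1 - r))) with
        (b / a * r ^ n * ((1 - r ^ K) / (1 - r)) + b / a * r ^ n * r ^ K)
        by (simpl; field; lra).
      lra. }
  eapply Rle_trans; [apply H|].
  assert (0 <= b / a * r ^ n).
  { apply Rmult_le_pos; [|apply pow_le; lra]. apply Rmult_le_pos; auto.
    left; apply Rinv_0_lt_compat; lra. }
  replace (b / a / (1 - r) * r ^ n) with (b / a * r ^ n * (1 / (1 - r))) by (field; lra).
  apply Rmult_le_compat_l; auto. unfold Rdiv. apply Rmult_le_compat_r.
  - left; apply Rinv_0_lt_compat; lra.
  - pose proof (pow_le r n ltac:(lra)). lra.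
Qed.

Lemma Cmod_qq z : 0 < Im z -> Cmod (qq z) < 1.
Proof.
  intros Hz. unfold qq. rewrite qpow_mod.
  pose proof PI_RGT_0. assert (0 < PI * Im z) by (now apply Rmult_lt_0_compat).
  apply Rlt_le_trans with (exp 0); [apply exp_increasing; lra|rewrite exp_0; lra].
Qed.

Lemma INR_tri n : INR (tri n) = INR n * (INR n + 1) / 2.
Proof.
  induction n as [|n IH]; [simpl; lra|]. cbn [tri]. rewrite plus_INR, IH, S_INR. lra.
Qed.

Definition pent (m : Z) : R := (3 * IZR m ^ 2 + IZR m) / 2.

Lemma pent_csum z n :
  csum (fun m => RtoC (sg m) * qpow (pent m) z)%C (zlist n) =
  (1 + csum (fun s => RtoC ((-1) ^ (S s)) * (qq z ^ (S s * S s + tri s)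
      + qq z ^ (S s * S s + tri (S s))))%C (seq 0 n))%C.
Proof.
  induction n as [|n IH].
  - cbn. unfold sg, pent; simpl. replace ((3 * (0 * (0 * 1)) + 0) / 2) with 0 by lra.
    rewrite qpow_0. ring.
  - rewrite csum_zlist_S, IH, (seq_S n), csum_app. cbn [csum Nat.add].
    rewrite !qq_pow, sg_pow, sg_opp.
    replace (pent (Z.of_nat (S n))) with (INR (S n * S n + tri (S n))).
    2:{ unfold pent. rewrite plus_INR, mult_INR, INR_tri, <- INR_IZR_INZ. field. }
    replace (pent (- Z.of_nat (S n))) with (INR (S n * S n + tri n)).
    2:{ unfold pent. rewrite plus_INR, mult_INR, INR_tri, opp_IZR, <- INR_IZR_INZ, S_INR. field. }
    ring.
Qed.

Lemma pent_bound z : 0 < Im z -> exists B, 0 < B /\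
  forall m, Cmod (RtoC (sg m) * qpow (pent m) z) <= B * / (1 + IZR m ^ 2).
Proof.
  intros Hz. pose proof PI_RGT_0. assert (Hc : 0 < PI * Im z) by (now apply Rmult_lt_0_compat).
  destruct (gauss_bound (3 * (PI * Im z)) (PI * Im z)) as (B & HB & HG); [lra|].
  exists B. split; auto. intros m. specialize (HG (IZR m)).
  rewrite Cmod_mult, sg_Cmod, Rmult_1_l, qpow_mod.
  eapply Rle_trans; [|exact HG]. pose proof (Rabs_pos (IZR m)).
  rewrite <- (Rmult_1_l (exp (- _))). apply Rmult_le_compat; try lra.
  - left; apply exp_pos.
  - apply exp_le. unfold pent.
    replace (- (2 * PI * ((3 * IZR m ^ 2 + IZR m) / 2) * Im z)) with
      (PI * Im z * (- IZR m) - 3 * (PI * Im z) * IZR m ^ 2) by field.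
    apply Rplus_le_compat_r. apply Rmult_le_compat_l; [lra|].
    rewrite <- Rabs_Ropp. apply Rle_abs.
Qed.

Lemma pentagonal_limit z : 0 < Im z -> exists E,
  has_sum (fun m => RtoC (sg m) * qpow (pent m) z)%C E /\ Clim eventually (qprod (qq z)) E.
Proof.
  intros Hz. assert (Hq := Cmod_qq z Hz).
  destruct (pent_bound z Hz) as (B & HB & Hb).
  destruct (summable_has_sum _ (fun m : Z => B * / (1 + IZR m ^ 2))
     ltac:(apply summable_scal; [lra|apply summable_inv_sq]) Hb) as [E HE].
  exists E. split; auto.
  destruct (shanks_error (qq z) Hq) as (K & HK & HS).
  apply (Clim_ext eventually (fun n => csum (fun m => RtoC (sg m) * qpow (pent m) z)%C (zlist n)
     - (csum (shanks (qq z) n) (seq 0 (S n)) - qprod (qq z) n))%C).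
  { intros n. rewrite pent_csum, shanks_identity by exact Hq. ring. }
  replace E with (E - 0)%C at 1 by ring.
  apply Clim_minus; [apply _|now apply has_sum_zlist|].
  apply (Clim_dominated eventually _ _ (fun n => K * Cmod (qq z) ^ n)).
  - exists 0%nat. intros n _.
    match goal with |- Cmod (?x - RtoC 0)%C <= _ => replace (x - 0)%C with x by ring end.
    apply HS.
  - replace 0 with (K * 0) by ring.
    apply (is_lim_seq_mult' (fun _ => K) (fun n => Cmod (qq z) ^ n) K 0).
    + apply is_lim_seq_const.
    + apply is_lim_seq_geom. rewrite Rabs_pos_eq; auto. apply Cmod_ge_0.
Qed.

Lemma pentagonal z : 0 < Im z ->
  has_sum (fun m => RtoC (sg m) * qpow (pent m) z)%C (qPoch_inf (qq z)).
Proof.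
  intros Hz. destruct (pentagonal_limit z Hz) as (E & HE & HL).
  change (qPoch_inf (qq z)) with (CLim_seq (qprod (qq z))). now rewrite (Clim_seq_correct _ _ HL).
Qed.

Lemma qPoch_neq0 z : 0 < Im z -> qPoch_inf (qq z) <> 0%C.
Proof.
  intros Hz. destruct (pentagonal_limit z Hz) as (E & HE & HL).
  change (qPoch_inf (qq z)) with (CLim_seq (qprod (qq z))). rewrite (Clim_seq_correct _ _ HL).
  intros ->. destruct (qprod_bounds (qq z) (Cmod_qq z Hz)) as (a & b & Ha & Hab).
  destruct (HL a Ha) as [n Hn]. specialize (Hn n (le_n n)).
  replace (qprod (qq z) n - 0)%C with (qprod (qq z) n) in Hn by ring.
  specialize (Hab n). lra.
Qed.

Lemma eta_neq0 z : 0 < Im z -> eta z <> 0%C.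
Proof. intros Hz. apply Cmult_neq_0; [apply qpow_neq0|now apply qPoch_neq0]. Qed.

Lemma eta_has_sum z : 0 < Im z ->
  has_sum (fun m => RtoC (sg m) * qpow (3 / 2 * (IZR m + 1 / 6) ^ 2) z)%C (eta z).
Proof.
  intros Hz. assert (H := has_sum_scal (qpow (1 / 24) z) _ _ (pentagonal z Hz)).
  revert H. apply has_sum_ext. intros m.
  replace (3 / 2 * (IZR m + 1 / 6) ^ 2) with (1 / 24 + pent m) by (unfold pent; field).
  rewrite qpow_add. ring.
Qed.

(** * The holomorphic part as a cosecant series *)

(** The base point of the row of index [m] in the coset [Z z + Z + alpha]. *)
Definition row (alpha : R) (z : C) (m : Z) : C := (RtoC (IZR m) * z + RtoC alpha)%C.

Definition csc_term (alpha : R) (z : C) (m : Z) : C :=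
  (RtoC (sg m) * qpow (3 / 2 * IZR m ^ 2) z / Csin (PI * row alpha z m))%C.

Definition not_integer (alpha : R) : Prop := forall k : Z, alpha <> IZR k.

Lemma row_Im alpha z m : Im (row alpha z m) = IZR m * Im z.
Proof. destruct z. unfold row, RtoC, Cmult, Cplus, Im; simpl. ring. Qed.

Lemma row_Re alpha z m : Re (row alpha z m) = IZR m * Re z + alpha.
Proof. destruct z. unfold row, RtoC, Cmult, Cplus, Re; simpl. ring. Qed.

Lemma row_away alpha z : not_integer alpha -> 0 < Im z ->
  exists d, 0 < d <= 1 /\ forall m, away d (row alpha z m).
Proof.
  intros Ha Hz. destruct (away_exists (RtoC alpha)) as (d0 & Hd0 & H0).
  { intros k E. rewrite <- RtoC_plus in E. injection E. intros E1.
    apply (Ha (- k)%Z). rewrite opp_IZR. lra. }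
  exists (Rmin d0 (Im z)). split.
  { split; [apply Rmin_pos; lra|]. eapply Rle_trans; [apply Rmin_l|lra]. }
  intros m n. destruct (Z.eq_dec m 0) as [->|Hm].
  - eapply Rle_trans; [apply Rmin_l|]. unfold row.
    replace (0 * z + alpha + IZR n)%C with (alpha + IZR n)%C by ring. apply H0.
  - eapply Rle_trans; [apply Rmin_r|]. eapply Rle_trans; [|apply im_le_Cmod].
    replace (Im (row alpha z m + IZR n)) with (IZR m * Im z).
    2:{ rewrite <- (row_Im alpha). destruct (row alpha z m); simpl; ring. }
    rewrite Rabs_mult, (Rabs_pos_eq (Im z)) by lra.
    assert (1 <= Rabs (IZR m)) by (rewrite <- abs_IZR; apply IZR_le; lia). nra.
Qed.

Lemma away_neq0 d X n : 0 < d -> away d X -> (X + RtoC (IZR n))%C <> 0%C.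
Proof. intros Hd H. apply Cmod_gt_0. specialize (H n). lra. Qed.

Lemma row_csc_neq0 alpha z m : not_integer alpha -> 0 < Im z ->
  Csin (PI * row alpha z m) <> 0%C.
Proof.
  intros Ha Hz. destruct (row_away alpha z Ha Hz) as (d & Hd & H).
  apply Csin_PI_neq0. intros k. apply away_neq0 with d; [lra|auto].
Qed.

Lemma Csin_PI_row_0 alpha z : Csin (PI * row alpha z 0) = RtoC (sin (alpha * PI)).
Proof.
  unfold row. replace (PI * (0 * z + alpha))%C with (RtoC (alpha * PI)) by (rewrite RtoC_mult; ring).
  apply Csin_RtoC.
Qed.

Lemma pent_div n : (n * (3 * n + 1) / 2 = n * n + tri n)%nat.
Proof.
  symmetry. apply Nat.div_unique_exact; [lia|]. induction n as [|n IH]; [reflexivity|].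
  cbn [tri]. nia.
Qed.

(** The product of [sin (PI (alpha + m z))] and [sin (PI (alpha - m z))] is
    [(1 - 2 cos (2 PI alpha) q^m + q^(2m)) / (4 q^m)], which is where the denominators of [NN]
    come from. *)
Lemma csc_term_pair l p z n : not_integer (ratio l p) -> 0 < Im z ->
  (csc_term (ratio l p) z (Z.of_nat (S n)) + csc_term (ratio l p) z (- Z.of_nat (S n)))%C =
  (RtoC (/ sin (ratio l p * PI)) * NN_term l p (qq z) (S n))%C.
Proof.
  intros Ha Hz. set (alpha := ratio l p) in *.
  assert (N1 := row_csc_neq0 alpha z (Z.of_nat (S n)) Ha Hz).
  assert (N2 := row_csc_neq0 alpha z (- Z.of_nat (S n)) Ha Hz).
  assert (N0 := row_csc_neq0 alpha z 0 Ha Hz). 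
  assert (Hs := Csin_PI_row_0 alpha z).
  unfold csc_term, NN_term. fold alpha. cbv zeta. rewrite sg_opp, sg_pow.
  rewrite RtoC_inv by (intros E; apply N0; rewrite Hs, E; reflexivity). rewrite <- Hs.
  rewrite pent_div, !qq_pow.
  set (e := Cexp (Ci * (PI * RtoC alpha))). set (a := Cexp (Ci * (PI * RtoC (INR (S n)) * z))).
  assert (He : e <> 0%C) by apply Cexp_neq0. assert (Hapos : a <> 0%C) by apply Cexp_neq0.
  assert (Q1 : qpow (INR (S n)) z = (a * a)%C).
  { unfold qpow, a. rewrite <- Cexp_add. f_equal. rewrite !RtoC_mult. ring. }
  assert (Q2 : qpow (INR (2 * S n)) z = (a * a * (a * a))%C).
  { rewrite <- Q1, <- qpow_add. f_equal. rewrite mult_INR. simpl (INR 2). ring. }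
  assert (Q3 : qpow (INR (S n * S n + tri (S n))) z = (qpow (3 / 2 * IZR (Z.of_nat (S n)) ^ 2) z * a)%C).
  { replace a with (qpow (INR (S n) / 2) z).
    - rewrite <- qpow_add. f_equal. rewrite plus_INR, mult_INR, INR_tri, <- INR_IZR_INZ. field.
    - unfold qpow, a. f_equal. rewrite RtoC_mult, RtoC_div, RtoC_mult by lra. field. }
  assert (Q4 : qpow (3 / 2 * IZR (- Z.of_nat (S n)) ^ 2) z = qpow (3 / 2 * IZR (Z.of_nat (S n)) ^ 2) z).
  { f_equal. rewrite opp_IZR. ring. }
  assert (S1 : Csin (PI * row alpha z (Z.of_nat (S n))) = ((a * e - / (a * e)) / (2 * Ci))%C).
  { unfold Csin. rewrite Cexp_opp. do 2 f_equal; [|f_equal]; unfold a, e;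
    rewrite <- Cexp_add; f_equal; unfold row; rewrite <- INR_IZR_INZ; ring. }
  assert (S2 : Csin (PI * row alpha z (- Z.of_nat (S n))) = ((e / a - a / e) / (2 * Ci))%C).
  { unfold Csin.
    replace (e / a)%C with (Cexp (Ci * (PI * row alpha z (- Z.of_nat (S n))))).
    - replace (a / e)%C with (Cexp (- (Ci * (PI * row alpha z (- Z.of_nat (S n)))))); [easy|].
      unfold Cdiv, a, e. rewrite <- Cexp_opp, <- Cexp_add. f_equal. unfold row.
      rewrite opp_IZR, <- INR_IZR_INZ, RtoC_opp. ring.
    - unfold Cdiv, a, e. rewrite <- Cexp_opp, <- Cexp_add. f_equal. unfold row.
      rewrite opp_IZR, <- INR_IZR_INZ, RtoC_opp. ring. }
  assert (S0 : Csin (PI * row alpha z 0) = ((e - / e) / (2 * Ci))%C).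
  { unfold Csin. rewrite Cexp_opp. do 2 f_equal; [|f_equal]; unfold e; f_equal; unfold row; ring. }
  assert (Hx : RtoC (2 * cos (2 * PI * alpha)) = (e * e + / (e * e))%C).
  { assert (E : (e * e)%C = Cexp (Ci * RtoC (2 * PI * alpha))).
    { unfold e. rewrite <- Cexp_add. f_equal. rewrite !RtoC_mult. ring. }
    rewrite E, <- Cexp_opp.
    replace (- (Ci * RtoC (2 * PI * alpha)))%C with (Ci * RtoC (- (2 * PI * alpha)))%C
      by (rewrite RtoC_opp; ring).
    rewrite !Cexp_Ci, cos_neg, sin_neg. unfold RtoC, Cplus; simpl. f_equal; ring. }
  rewrite Q1, Q2, Q3, Q4, S0, Hx. rewrite S0 in N0. rewrite S1 in *. rewrite S2 in *.
  assert (M1 : (a * a * (e * e) - 1)%C <> 0%C).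
  { intros E. apply N1. replace (a * e - / (a * e))%C with ((a * a * (e * e) - 1) / (a * e))%C
      by (field; auto). rewrite E. field. repeat split; auto using C2_neq0, Ci_neq0. }
  assert (M2 : (e * e - a * a)%C <> 0%C).
  { intros E. apply N2. replace (e / a - a / e)%C with ((e * e - a * a) / (a * e))%C
      by (field; auto). rewrite E. field. repeat split; auto using C2_neq0, Ci_neq0. }
  assert (M0 : (e * e - 1)%C <> 0%C).
  { intros E. apply N0. replace (e - / e)%C with ((e * e - 1) / e)%C
      by (field; auto). rewrite E. field. repeat split; auto using C2_neq0, Ci_neq0. }
  set (G := qpow (3 / 2 * IZR (Z.of_nat (S n)) ^ 2) z). set (sgn := RtoC (sg (Z.of_nat (S n)))).
  assert (D1 : (1 - (e * e + / (e * e)) * (a * a) + a * a * (a * a))%C =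
    (- ((a * a * (e * e) - 1) * (e * e - a * a)) / (e * e))%C) by (field; auto).
  rewrite D1.
  replace ((a * e - / (a * e)) / (2 * Ci))%C with ((a * a * (e * e) - 1) / (a * e * (2 * Ci)))%C
    by (field; repeat split; auto using C2_neq0, Ci_neq0).
  replace ((e / a - a / e) / (2 * Ci))%C with ((e * e - a * a) / (a * e * (2 * Ci)))%C
    by (field; repeat split; auto using C2_neq0, Ci_neq0).
  replace ((e - / e) / (2 * Ci))%C with ((e * e - 1) / (e * (2 * Ci)))%C
    by (field; repeat split; auto using C2_neq0, Ci_neq0).
  set (u := (a * a * (e * e) - 1)%C) in *. set (v := (e * e - a * a)%C) in *.
  set (w := (e * e - 1)%C) in *.
  replace (2 - (e * e + / (e * e)))%C with (- (w * w) / (e * e))%C by (unfold w; field; auto).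
  replace (1 + a * a)%C with ((u + v) / w)%C by (unfold u, v, w; field; auto).
  field. repeat split; auto using C2_neq0, Ci_neq0.
Qed.

(** The sines are bounded below, for [m <> 0] because [|sin u| >= |Im u|]. *)
Lemma csc_term_bound alpha z : not_integer alpha -> 0 < Im z -> exists B, 0 < B /\
  forall m, Cmod (csc_term alpha z m) <= B * / (1 + IZR m ^ 2).
Proof.
  intros Ha Hz. pose proof PI_RGT_0 as HP.
  assert (Hpy : 0 < PI * Im z) by (now apply Rmult_lt_0_compat).
  assert (H0 : 0 < Cmod (Csin (PI * row alpha z 0))) by (apply Cmod_gt_0, row_csc_neq0; auto).
  set (s0 := Rmin (Cmod (Csin (PI * row alpha z 0))) (PI * Im z)).
  assert (Hs0 : 0 < s0) by (apply Rmin_pos; lra).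
  assert (Hlow : forall m, s0 <= Cmod (Csin (PI * row alpha z m))).
  { intros m. destruct (Z.eq_dec m 0) as [->|Hm]; [apply Rmin_l|].
    eapply Rle_trans; [apply Rmin_r|].
    apply Rsqr_incr_0; [|lra|apply Cmod_ge_0]. rewrite !Rsqr_pow2, Csin_mod2.
    replace (Im (PI * row alpha z m)) with (IZR m * (PI * Im z)).
    2:{ replace (Im (PI * row alpha z m)) with (PI * Im (row alpha z m))
          by (destruct (row alpha z m); simpl; ring). rewrite row_Im. ring. }
    pose proof (sinh_lower (IZR m * (PI * Im z))). pose proof (pow2_ge_0 (sin (Re (PI * row alpha z m)))).
    rewrite Rpow_mult_distr in H.
    assert (1 <= IZR m ^ 2).
    { rewrite <- (pow2_abs (IZR m)), <- abs_IZR.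
      assert (1 <= IZR (Z.abs m)) by (apply IZR_le; lia). nra. }
    pose proof (pow2_ge_0 (PI * Im z)). nra. }
  destruct (gauss_bound (3 * (PI * Im z)) 0) as (B & HB & HG); [lra|].
  exists (B * / s0). split; [apply Rmult_lt_0_compat; auto; now apply Rinv_0_lt_compat|].
  intros m. specialize (HG (IZR m)). specialize (Hlow m).
  unfold csc_term. rewrite Cmod_div, Cmod_mult, sg_Cmod, Rmult_1_l, qpow_mod
    by now apply row_csc_neq0.
  replace (B * / s0 * / (1 + IZR m ^ 2)) with (B / (1 + IZR m ^ 2) * / s0) by (unfold Rdiv; ring).
  apply Rmult_le_compat.
  - left; apply exp_pos.
  - left; apply Rinv_0_lt_compat; lra.
  - eapply Rle_trans; [|exact HG]. pose proof (Rabs_pos (IZR m)).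
    rewrite <- (Rmult_1_l (exp (- _))). apply Rmult_le_compat; try lra.
    + left; apply exp_pos.
    + apply exp_le. right. field.
  - apply Rinv_le_contravar; lra.
Qed.

(** The factor [eta] cancels the prefactor of [NN]; the term of index 0 gives the 1 and the
    pairs of indices [m] and [- m] give the series. *)
Lemma eta_NN l p z : not_integer (ratio l p) -> 0 < Im z ->
  has_sum (csc_term (ratio l p) z) (eta z * NN l p z)%C.
Proof.
  intros Ha Hz.
  destruct (csc_term_bound _ z Ha Hz) as (B & HB & Hb).
  destruct (summable_has_sum _ (fun m : Z => B * / (1 + IZR m ^ 2))
     ltac:(apply summable_scal; [lra|apply summable_inv_sq]) Hb) as [W HW].
  replace (eta z * NN l p z)%C with W; [exact HW|].
  assert (N0 := row_csc_neq0 (ratio l p) z 0 Ha Hz). rewrite Csin_PI_row_0 in N0.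
  assert (Hs : sin (ratio l p * PI) <> 0) by (intros E; apply N0; now rewrite E).
  set (a := fun n => NN_term l p (qq z) (S n)).
  assert (Hpart : forall n, csum (csc_term (ratio l p) z) (zlist n) =
     (RtoC (/ sin (ratio l p * PI)) * (1 + csum a (seq 0 n)))%C).
  { induction n as [|n IH].
    - replace (csum (csc_term (ratio l p) z) (zlist 0)) with (csc_term (ratio l p) z 0)
        by (cbn; ring).
      unfold csc_term. rewrite Csin_PI_row_0.
      replace (3 / 2 * 0 ^ 2) with 0 by ring. rewrite qpow_0, RtoC_inv by exact Hs.
      unfold sg; simpl. field. auto.
    - rewrite csum_zlist_S, csc_term_pair, IH, (seq_S n), csum_app by auto.
      cbn [csum Nat.add]. fold (a n). ring. }
  assert (HL := has_sum_zlist _ _ HW).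
  assert (HC : CSeries a = (RtoC (sin (ratio l p * PI)) * W - 1)%C).
  { apply Clim_seq_correct.
    apply (Clim_ext eventually (fun n =>
       RtoC (sin (ratio l p * PI)) * csum (csc_term (ratio l p) z) (zlist (S n)) - 1)%C).
    - intros n. rewrite Hpart, sum_n_csum, RtoC_inv by exact Hs. field. auto.
    - apply Clim_minus; [apply _| |apply Clim_const, _].
      apply Clim_scal; [apply _|].
      intros eps He. destruct (HL eps He) as [M HM]. exists M. intros n Hn. apply HM. lia. }
  unfold eta, NN. cbv zeta. fold a. rewrite HC, RtoC_inv by exact Hs.
  assert (Hq : (qpow (1 / 24) z * qpow (- (1 / 24)) z)%C = 1%C).
  { rewrite <- qpow_add, <- (qpow_0 z). f_equal. ring. }
  assert (HP := qPoch_neq0 z Hz).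
  transitivity ((qpow (1 / 24) z * qpow (- (1 / 24)) z) * W)%C; [rewrite Hq; ring|field; auto].
Qed.

(** * The interpolating lattice sum *)

Lemma Rbar_locally'_0_intro (P : R -> Prop) d : 0 < d ->
  (forall h, Rabs h < d -> h <> 0 -> P h) -> Rbar_locally' 0 P.
Proof.
  intros Hd H. exists (mkposreal d Hd). intros h Hh Hh0. apply H; auto.
  assert (Hh' : Rabs (h - 0) < d) by exact Hh. now rewrite Rminus_0_r in Hh'.
Qed.

(** Differentiation under the sum: by [Cmean_value] the bound on the derivatives dominates the
    difference quotients, to which [has_sum_lim] applies. *)
Lemma has_sum_derive {I} (f df : I -> R -> C) (g : I -> R) (S : R -> C) S' s d :
  0 < d -> summable g ->
  (forall i t, Rabs (t - s) < d -> Cis_derive (f i) t (df i t)) ->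
  (forall i t, Rabs (t - s) < d -> Cmod (df i t) <= g i) ->
  (forall t, Rabs (t - s) < d -> has_sum (fun i => f i t) (S t)) ->
  has_sum (fun i => df i s) S' -> Cis_derive S s S'.
Proof.
  intros Hd Hg Hf Hb HS HS'. apply Cis_derive_quotient.
  apply (has_sum_lim (Rbar_locally' 0)
    (fun h i => ((f i (s + h)%R - f i s) / RtoC h)%C) (fun i => df i s) g _ S' Hg); auto.
  - apply Rbar_locally'_0_intro with d; auto. intros h Hh Hh0 i.
    assert (Hne : RtoC h <> 0%C) by now apply RtoC_neq0.
    rewrite Cmod_div, Cmod_R by auto. apply div_le; [now apply Rabs_pos_lt|].
    apply Rabs_def2 in Hh. destruct (Rle_dec 0 h) as [H|H].
    + assert (E := Cmean_value (f i) (df i) (g i) s (s + h)).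
      rewrite (Rabs_pos_eq h) by auto. replace h with (s + h - s) at 2 by ring.
      apply E; [lra| |]; intros t Ht; [apply Hf|apply Hb]; apply Rabs_def1; lra.
    + assert (E := Cmean_value (f i) (df i) (g i) (s + h) s).
      rewrite (Rabs_left h) by lra. replace (- h) with (s - (s + h)) by ring.
      replace (f i (s + h)%R - f i s)%C with (- (f i s - f i (s + h)%R))%C by ring.
      rewrite Cmod_opp.
      apply E; [lra| |]; intros t Ht; [apply Hf|apply Hb]; apply Rabs_def1; lra.
  - intros i. apply Cis_derive_quotient, Hf. rewrite Rminus_diag, Rabs_R0. exact Hd.
  - apply Rbar_locally'_0_intro with d; auto. intros h Hh Hh0.
    assert (H1 : has_sum (fun i => f i (s + h)) (S (s + h)))
      by (apply HS; now replace (s + h - s) with h by ring).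
    assert (H0 : has_sum (fun i => f i s) (S s))
      by (apply HS; rewrite Rminus_diag, Rabs_R0; exact Hd).
    assert (H2 := has_sum_scal (/ RtoC h) _ _ (has_sum_minus _ _ _ _ H1 H0)).
    unfold Cdiv. rewrite Cmult_comm. revert H2. apply has_sum_ext. intros i. apply Cmult_comm.
Qed.

(** A Gaussian whose centre in [n] moves linearly with [m]. As
    [n^2 <= 3 ((m x + a + n)^2 + m^2 x^2 + a^2)], half of the decay in [m] pays for centring it
    at a fixed point. *)
Lemma lattice_gauss c1 c2 x a : 0 < c1 -> 0 < c2 -> exists B, 0 < B /\ forall m n : Z,
  (1 + Rabs (IZR m)) * (1 + Rabs (IZR n)) *
    exp (- (c1 * IZR m ^ 2) - c2 * (IZR m * x + a + IZR n) ^ 2)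
  <= B * (/ (1 + IZR m ^ 2) * / (1 + IZR n ^ 2)).
Proof.
  intros H1 H2. pose proof (pow2_ge_0 x) as Hx.
  set (c4 := Rmin c2 (c1 / (2 * (x ^ 2 + 1)))).
  assert (Hq : 0 < c1 / (2 * (x ^ 2 + 1))) by (apply Rdiv_lt_0_compat; lra).
  assert (Hc4 : 0 < c4) by (apply Rmin_pos; auto).
  assert (Hc2 : c4 <= c2) by apply Rmin_l.
  assert (Hc1 : c4 * (x ^ 2 + 1) <= c1 / 2).
  { apply Rle_trans with (c1 / (2 * (x ^ 2 + 1)) * (x ^ 2 + 1)).
    - apply Rmult_le_compat_r; [lra|apply Rmin_r].
    - right. field. lra. }
  destruct (gauss_bound (c1 / 2) 0) as (B1 & HB1 & HG1); [lra|].
  destruct (gauss_bound (c4 / 3) 0) as (B2 & HB2 & HG2); [lra|].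
  exists (exp (c4 * a ^ 2) * B1 * B2). split.
  { repeat apply Rmult_lt_0_compat; auto. apply exp_pos. }
  intros m n. specialize (HG1 (IZR m)). specialize (HG2 (IZR n)).
  rewrite Rmult_0_l, Rminus_0_l in HG1, HG2.
  assert (E : exp (- (c1 * IZR m ^ 2) - c2 * (IZR m * x + a + IZR n) ^ 2) <=
    exp (c4 * a ^ 2) * (exp (- (c1 / 2 * IZR m ^ 2)) * exp (- (c4 / 3 * IZR n ^ 2)))).
  { rewrite <- !exp_plus. apply exp_le.
    set (p := IZR m * x + a + IZR n).
    assert (Hn : IZR n ^ 2 <= 3 * (p ^ 2 + IZR m ^ 2 * x ^ 2 + a ^ 2)).
    { replace (IZR n) with (p - IZR m * x - a) by (unfold p; ring).
      pose proof (pow2_ge_0 (p + IZR m * x)). pose proof (pow2_ge_0 (p + a)).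
      pose proof (pow2_ge_0 (IZR m * x - a)). nra. }
    assert (Hp : c4 * p ^ 2 <= c2 * p ^ 2) by (apply Rmult_le_compat_r; [apply pow2_ge_0|auto]).
    assert (Hm : c4 * (x ^ 2 + 1) * IZR m ^ 2 <= c1 / 2 * IZR m ^ 2)
      by (apply Rmult_le_compat_r; [apply pow2_ge_0|auto]).
    assert (Hm0 : 0 <= c4 * IZR m ^ 2) by (apply Rmult_le_pos; [lra|apply pow2_ge_0]).
    assert (Hnn : c4 / 3 * IZR n ^ 2 <= c4 / 3 * (3 * (p ^ 2 + IZR m ^ 2 * x ^ 2 + a ^ 2)))
      by (apply Rmult_le_compat_l; [lra|auto]).
    lra. }
  pose proof (Rabs_pos (IZR m)). pose proof (Rabs_pos (IZR n)).
  eapply Rle_trans.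
  - apply Rmult_le_compat_l; [apply Rmult_le_pos; lra|exact E].
  - replace ((1 + Rabs (IZR m)) * (1 + Rabs (IZR n)) *
      (exp (c4 * a ^ 2) * (exp (- (c1 / 2 * IZR m ^ 2)) * exp (- (c4 / 3 * IZR n ^ 2)))))
     with (exp (c4 * a ^ 2) * (((1 + Rabs (IZR m)) * exp (- (c1 / 2 * IZR m ^ 2))) *
       ((1 + Rabs (IZR n)) * exp (- (c4 / 3 * IZR n ^ 2))))) by ring.
    replace (exp (c4 * a ^ 2) * B1 * B2 * (/ (1 + IZR m ^ 2) * / (1 + IZR n ^ 2)))
     with (exp (c4 * a ^ 2) * ((B1 / (1 + IZR m ^ 2)) * (B2 / (1 + IZR n ^ 2))))
     by (unfold Rdiv; ring).
    apply Rmult_le_compat_l; [left; apply exp_pos|].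
    apply Rmult_le_compat; auto; apply Rmult_le_pos; try lra; left; apply exp_pos.
Qed.

Lemma summable_lattice B : 0 <= B ->
  summable (fun p : Z * Z => B * (/ (1 + IZR (fst p) ^ 2) * / (1 + IZR (snd p) ^ 2))).
Proof.
  intros HB. apply summable_scal; auto.
  exact (summable_prod _ _ summable_inv_sq summable_inv_sq).
Qed.

Definition lat (alpha : R) (z : C) (p : Z * Z) : C :=
  (row alpha z (fst p) + RtoC (IZR (snd p)))%C.

Definition weight (z : C) (p : Z * Z) : C :=
  (RtoC (sg (fst p + snd p)) * qpow (3 / 2 * IZR (fst p) ^ 2) z)%C.

Definition gauss (s : R) (w : C) : C := Cexp (RtoC (- (PI / s)) * (w * w)).

(** The parameter [s] interpolates between the value [2 Im z / 3], where the term depends on the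
    lattice point only through quantities that transform well under modular substitutions, and
    infinity, where it is the term of a partial fraction expansion. *)
Definition lterm (alpha : R) (z : C) (s : R) (p : Z * Z) : C :=
  (weight z p * (gauss s (lat alpha z p) / lat alpha z p))%C.

(** The derivative of [lterm] in [s]; the denominator has cancelled. *)
Definition dlterm (alpha : R) (z : C) (s : R) (p : Z * Z) : C :=
  (weight z p * (RtoC (PI / s ^ 2) * (lat alpha z p * gauss s (lat alpha z p))))%C.

Lemma lat_Re alpha z p : Re (lat alpha z p) = IZR (fst p) * Re z + alpha + IZR (snd p).
Proof. rewrite <- row_Re. unfold lat. destruct (row alpha z (fst p)); reflexivity. Qed.

Lemma lat_Im alpha z p : Im (lat alpha z p) = IZR (fst p) * Im z.
Proof. rewrite <- (row_Im alpha). unfold lat. destruct (row alpha z (fst p)); simpl; ring. Qed.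

Lemma lat_neq0 alpha z p : not_integer alpha -> 0 < Im z -> lat alpha z p <> 0%C.
Proof.
  intros Ha Hz. destruct (row_away alpha z Ha Hz) as (d & Hd & H).
  apply away_neq0 with d; [lra|auto].
Qed.

Lemma lterm_derive alpha z p s : not_integer alpha -> 0 < Im z -> 0 < s ->
  Cis_derive (fun s => lterm alpha z s p) s (dlterm alpha z s p).
Proof.
  intros Ha Hz Hs. assert (Hw := lat_neq0 alpha z p Ha Hz).
  unfold lterm, dlterm. apply Cis_derive_scal.
  set (w := lat alpha z p) in *.
  apply Cis_derive_ext with (fun s => / w * gauss s w)%C.
  { intros t. unfold Cdiv. apply Cmult_comm. }
  replace (RtoC (PI / s ^ 2) * (w * gauss s w))%C
    with (/ w * (RtoC (PI / s ^ 2) * (w * w) * gauss s w))%C by (field; auto).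
  apply Cis_derive_scal. unfold gauss. apply Cis_derive_Cexp.
  apply Cis_derive_ext with (fun t => w * w * RtoC (- (PI / t)))%C.
  { intros t. apply Cmult_comm. }
  replace (RtoC (PI / s ^ 2) * (w * w))%C with (w * w * RtoC (PI / s ^ 2))%C by ring.
  apply Cis_derive_scal, Cis_derive_RtoC.
  auto_derive; [lra|]. field. lra.
Qed.

(** On the row of index [m] the Gaussian is as large as [exp (PI m^2 y^2 / s)], with [y = Im z],
    and the weight is [exp (- 3 PI m^2 y)]; the condition [s > y / 3] makes the latter win. *)
Lemma gauss_weight_bound z alpha s1 s2 : 0 < Im z -> Im z / 3 < s1 ->
  exists c1 c2, 0 < c1 /\ 0 < c2 /\ forall s p, s1 <= s <= s2 ->
  Cmod (weight z p) * Cmod (gauss s (lat alpha z p)) <=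
  exp (- (c1 * IZR (fst p) ^ 2) - c2 * (IZR (fst p) * Re z + alpha + IZR (snd p)) ^ 2).
Proof.
  intros Hz Hs1. pose proof PI_RGT_0 as HP. set (y := Im z) in *.
  exists (PI * y * (3 - y / s1)), (PI / (Rmax s1 s2)).
  assert (Hy : y / s1 < 3) by (apply Rlt_div_l; lra).
  assert (Hm : s1 <= Rmax s1 s2) by apply Rmax_l.
  split; [|split].
  - apply Rmult_lt_0_compat; [now apply Rmult_lt_0_compat|lra].
  - apply Rdiv_lt_0_compat; lra.
  - intros s [m n] Hs. cbn [fst snd].
    assert (Hs2 : s <= Rmax s1 s2) by (eapply Rle_trans; [apply Hs|apply Rmax_r]).
    unfold weight. rewrite Cmod_mult, sg_Cmod, Rmult_1_l, qpow_mod.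
    cbn [fst snd]. unfold gauss. rewrite Cexp_mod, <- exp_plus. apply exp_le.
    set (w := lat alpha z (m, n)).
    assert (Hre : Re w = IZR m * Re z + alpha + IZR n) by apply lat_Re.
    assert (Him : Im w = IZR m * y) by apply lat_Im.
    replace (Re (RtoC (- (PI / s)) * (w * w))) with (- (PI / s) * (Re w ^ 2 - Im w ^ 2)).
    2:{ destruct w; simpl; ring. }
    rewrite Hre, Him. set (q := IZR m * Re z + alpha + IZR n). fold y.
    assert (Hi1 : / s <= / s1) by (apply Rinv_le_contravar; lra).
    assert (Hi2 : / Rmax s1 s2 <= / s) by (apply Rinv_le_contravar; lra).
    pose proof (pow2_ge_0 q). pose proof (pow2_ge_0 (IZR m)).
    assert (A1 : PI * (/ Rmax s1 s2 * q ^ 2) <= PI * (/ s * q ^ 2)).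
    { apply Rmult_le_compat_l; [lra|]. apply Rmult_le_compat_r; auto. }
    assert (A2 : PI * (/ s * (IZR m * y) ^ 2) <= PI * (/ s1 * (IZR m * y) ^ 2)).
    { apply Rmult_le_compat_l; [lra|]. apply Rmult_le_compat_r; [apply pow2_ge_0|auto]. }
    unfold Rdiv in *. lra.
Qed.

Lemma lat_upper alpha z p : 
  Cmod (lat alpha z p) <= (1 + Cmod z + Rabs alpha) * ((1 + Rabs (IZR (fst p))) * (1 + Rabs (IZR (snd p)))).
Proof.
  destruct p as [m n]. cbn [fst snd]. unfold lat, row. cbn [fst snd].
  eapply Rle_trans; [apply Cmod_triangle|].
  eapply Rle_trans; [apply Rplus_le_compat_r, Cmod_triangle|].
  rewrite Cmod_mult, !Cmod_R.
  pose proof (Rabs_pos (IZR m)). pose proof (Rabs_pos (IZR n)). pose proof (Rabs_pos alpha).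
  pose proof (Cmod_ge_0 z).
  set (a := Rabs (IZR m)) in *. set (b := Rabs (IZR n)) in *. set (c := Rabs alpha) in *.
  set (d := Cmod z) in *.
  assert (0 <= a * b) by now apply Rmult_le_pos. assert (0 <= d * b) by now apply Rmult_le_pos.
  assert (0 <= d * (a * b)) by now apply Rmult_le_pos.
  assert (0 <= c * (a * b)) by now apply Rmult_le_pos.
  assert (0 <= c * b) by now apply Rmult_le_pos.
  assert (0 <= c * a) by now apply Rmult_le_pos. nra.
Qed.

Lemma dlterm_bound alpha z s1 s2 : 0 < Im z -> Im z / 3 < s1 ->
  exists B, 0 < B /\ forall s p, s1 <= s <= s2 ->
  Cmod (dlterm alpha z s p) <= B * (/ (1 + IZR (fst p) ^ 2) * / (1 + IZR (snd p) ^ 2)).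
Proof.
  intros Hz Hs1. destruct (gauss_weight_bound z alpha s1 s2 Hz Hs1) as (c1 & c2 & H1 & H2 & H).
  destruct (lattice_gauss c1 c2 (Re z) alpha H1 H2) as (B & HB & HG).
  pose proof PI_RGT_0 as HP. set (K := 1 + Cmod z + Rabs alpha).
  assert (HK : 0 < K) by (unfold K; pose proof (Cmod_ge_0 z); pose proof (Rabs_pos alpha); lra).
  assert (Hp : 0 < PI / s1 ^ 2) by (apply Rdiv_lt_0_compat; [lra|apply pow_lt; lra]).
  exists (PI / s1 ^ 2 * K * B). split.
  { apply Rmult_lt_0_compat; auto. now apply Rmult_lt_0_compat. }
  intros s p Hs. specialize (H s p Hs). specialize (HG (fst p) (snd p)).
  pose proof (lat_upper alpha z p) as HU. fold K in HU.
  unfold dlterm. rewrite !Cmod_mult, Cmod_R.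
  assert (Hps : 0 < PI / s ^ 2) by (apply Rdiv_lt_0_compat; [lra|apply pow_lt; lra]).
  rewrite Rabs_pos_eq by lra.
  assert (Hle : PI / s ^ 2 <= PI / s1 ^ 2).
  { unfold Rdiv. apply Rmult_le_compat_l; [lra|]. apply Rinv_le_contravar.
    - apply pow_lt; lra.
    - apply pow_incr; lra. }
  set (U := Cmod (weight z p)) in *. set (G := Cmod (gauss s (lat alpha z p))) in *.
  replace (U * (PI / s ^ 2 * (Cmod (lat alpha z p) * G))) with
    (PI / s ^ 2 * Cmod (lat alpha z p) * (U * G)) by ring.
  set (V := (1 + Rabs (IZR (fst p))) * (1 + Rabs (IZR (snd p)))) in *.
  assert (HV : 0 <= V).
  { apply Rmult_le_pos; [pose proof (Rabs_pos (IZR (fst p)))|pose proof (Rabs_pos (IZR (snd p)))]; lra. }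
  apply Rle_trans with (PI / s1 ^ 2 * (K * V) *
    exp (- (c1 * IZR (fst p) ^ 2) - c2 * (IZR (fst p) * Re z + alpha + IZR (snd p)) ^ 2)).
  - apply Rmult_le_compat; auto.
    + apply Rmult_le_pos; [lra|apply Cmod_ge_0].
    + apply Rmult_le_pos; apply Cmod_ge_0.
    + apply Rmult_le_compat; auto; [lra|apply Cmod_ge_0].
  - replace (PI / s1 ^ 2 * (K * V) *
      exp (- (c1 * IZR (fst p) ^ 2) - c2 * (IZR (fst p) * Re z + alpha + IZR (snd p)) ^ 2))
     with (PI / s1 ^ 2 * K * (V *
      exp (- (c1 * IZR (fst p) ^ 2) - c2 * (IZR (fst p) * Re z + alpha + IZR (snd p)) ^ 2))) by ring.
    rewrite (Rmult_assoc _ B). apply Rmult_le_compat_l; auto.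
    apply Rmult_le_pos; lra.
Qed.

Lemma lterm_bound alpha z s : not_integer alpha -> 0 < Im z -> Im z / 3 < s ->
  exists B, 0 < B /\ forall p,
  Cmod (lterm alpha z s p) <= B * (/ (1 + IZR (fst p) ^ 2) * / (1 + IZR (snd p) ^ 2)).
Proof.
  intros Ha Hz Hs. destruct (gauss_weight_bound z alpha s s Hz Hs) as (c1 & c2 & H1 & H2 & H).
  destruct (lattice_gauss c1 c2 (Re z) alpha H1 H2) as (B & HB & HG).
  destruct (row_away alpha z Ha Hz) as (d & Hd & Hda).
  exists (/ d * B). split.
  { apply Rmult_lt_0_compat; auto. apply Rinv_0_lt_compat; lra. }
  intros p. specialize (H s p ltac:(lra)). specialize (HG (fst p) (snd p)).
  unfold lterm. rewrite Cmod_mult, Cmod_div by now apply lat_neq0.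
  assert (Hw : d <= Cmod (lat alpha z p)) by apply Hda.
  assert (Hi : / Cmod (lat alpha z p) <= / d) by (apply Rinv_le_contravar; lra).
  set (U := Cmod (weight z p)) in *. set (G := Cmod (gauss s (lat alpha z p))) in *.
  assert (HUG : 0 <= U * G) by (apply Rmult_le_pos; apply Cmod_ge_0).
  replace (U * (G / Cmod (lat alpha z p))) with (/ Cmod (lat alpha z p) * (U * G))
    by (unfold Rdiv; ring).
  rewrite Rmult_assoc. apply Rmult_le_compat; auto.
  - left; apply Rinv_0_lt_compat; lra.
  - eapply Rle_trans; [exact H|]. eapply Rle_trans; [|exact HG].
    pose proof (Rabs_pos (IZR (fst p))). pose proof (Rabs_pos (IZR (snd p))).
    rewrite <- (Rmult_1_l (exp _)) at 1. apply Rmult_le_compat_r; [left; apply exp_pos|].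
    assert (0 <= Rabs (IZR (fst p)) * Rabs (IZR (snd p))) by now apply Rmult_le_pos. nra.
Qed.

Definition Psi (alpha : R) (z : C) (s : R) : C := hsum (lterm alpha z s).

Definition dPsi (alpha : R) (z : C) (s : R) : C := hsum (dlterm alpha z s).

Lemma Psi_has_sum alpha z s : not_integer alpha -> 0 < Im z -> Im z / 3 < s ->
  has_sum (lterm alpha z s) (Psi alpha z s).
Proof.
  intros Ha Hz Hs. apply hsum_correct.
  destruct (lterm_bound alpha z s Ha Hz Hs) as (B & HB & H).
  eapply summable_has_sum; [|exact H]. apply summable_lattice; lra.
Qed.

Lemma dPsi_has_sum alpha z s : 0 < Im z -> Im z / 3 < s ->
  has_sum (dlterm alpha z s) (dPsi alpha z s).
Proof.
  intros Hz Hs. apply hsum_correct.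
  destruct (dlterm_bound alpha z s s Hz Hs) as (B & HB & H).
  eapply summable_has_sum; [apply (summable_lattice B); lra|].
  intros p. apply H. lra.
Qed.

Lemma Psi_derive alpha z s : not_integer alpha -> 0 < Im z -> Im z / 3 < s ->
  Cis_derive (Psi alpha z) s (dPsi alpha z s).
Proof.
  intros Ha Hz Hs. set (d := (s - Im z / 3) / 2). assert (Hd : 0 < d) by (unfold d; lra).
  destruct (dlterm_bound alpha z (s - d) (s + d) Hz ltac:(unfold d; lra)) as (B & HB & H).
  apply (has_sum_derive (fun p t => lterm alpha z t p) (fun p t => dlterm alpha z t p)
    (fun p => B * (/ (1 + IZR (fst p) ^ 2) * / (1 + IZR (snd p) ^ 2))) _ _ s d Hd).
  - apply summable_lattice; lra.
  - intros p t Ht. apply Rabs_def2 in Ht. apply lterm_derive; auto. unfold d in *; lra.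
  - intros p t Ht. apply Rabs_def2 in Ht. apply H. lra.
  - intros t Ht. apply Rabs_def2 in Ht. apply Psi_has_sum; auto. unfold d in *; lra.
  - now apply dPsi_has_sum.
Qed.

Lemma dPsi_continuous alpha z s : 0 < Im z -> Im z / 3 < s ->
  Clim (locally s) (dPsi alpha z) (dPsi alpha z s).
Proof.
  intros Hz Hs. set (d := (s - Im z / 3) / 2). assert (Hd : 0 < d) by (unfold d; lra).
  destruct (dlterm_bound alpha z (s - d) (s + d) Hz ltac:(unfold d; lra)) as (B & HB & H).
  assert (Hloc : locally s (fun t => Rabs (t - s) < d)) by (exists (mkposreal d Hd); auto).
  apply (has_sum_lim (locally s) (dlterm alpha z) (dlterm alpha z s)
    (fun p => B * (/ (1 + IZR (fst p) ^ 2) * / (1 + IZR (snd p) ^ 2)))).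
  - apply summable_lattice; lra.
  - revert Hloc. apply filter_imp. intros t Ht p. apply Rabs_def2 in Ht. apply H. lra.
  - intros p. unfold dlterm, gauss. apply Clim_scal; [apply _|].
    assert (Hc : forall r : R -> R, continuity_pt r s ->
      Clim (locally s) (fun t => RtoC (r t)) (RtoC (r s))).
    { intros r Hr. apply Clim_RtoC; [apply _|]. now apply continuity_pt_filterlim. }
    apply Clim_mult; [apply _| |].
    + apply (Hc (fun t => PI / t ^ 2)). apply derivable_continuous_pt.
      exists (PI * (- 2 / s ^ 3)). apply is_derive_Reals. auto_derive.
      * assert (0 < s) by lra. nra.
      * field. lra.
    + apply Clim_scal; [apply _|]. apply Clim_Cexp; [apply _|].
      apply Clim_mult; [apply _| |apply Clim_const, _].
      apply (Hc (fun t => - (PI / t))). apply derivable_continuous_pt.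
      exists (PI / s ^ 2). apply is_derive_Reals. auto_derive; [lra|]. field. lra.
  - revert Hloc. apply filter_imp. intros t Ht. apply Rabs_def2 in Ht.
    apply dPsi_has_sum; auto. unfold d in *; lra.
  - now apply dPsi_has_sum.
Qed.

(** * The derivative of the interpolating sum *)

Definition half (j : Z) : R := IZR j + 1 / 2.

(** Completing the square in [m]: the frequency [k] of the row shifts the characteristic of the
    theta series in [m] to [k / 3]. *)
Lemma qpow_theta_mult alpha z m k :
  (qpow (3 / 2 * IZR m ^ 2) z * Cexp (2 * PI * Ci * RtoC k * row alpha z m))%C =
  (qpow (3 / 2 * (IZR m + k / 3) ^ 2) z *
    (qpow (- (k ^ 2 / 6)) z * Cexp (2 * PI * Ci * RtoC k * RtoC alpha)))%C.
Proof.
  rewrite Cmult_assoc, <- qpow_add. unfold qpow. rewrite <- !Cexp_add. f_equal. unfold row.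
  replace (3 / 2 * (IZR m + k / 3) ^ 2 + - (k ^ 2 / 6)) with (3 / 2 * IZR m ^ 2 + k * IZR m) by field.
  rewrite Rmult_plus_distr_l, RtoC_plus, (RtoC_mult (2 * PI) (k * _)), !RtoC_mult. ring.
Qed.

Lemma theta_row_summable z c : 0 < Im z -> exists S,
  has_sum (fun m => RtoC (sg m) * qpow (3 / 2 * (IZR m + c) ^ 2) z)%C S.
Proof.
  intros Hz. pose proof PI_RGT_0. assert (Hpy : 0 < PI * Im z) by now apply Rmult_lt_0_compat.
  destruct (gauss_bound (3 * (PI * Im z)) (6 * (PI * Im z) * Rabs c)) as (B & HB & HG); [lra|].
  apply (summable_has_sum _ (fun m : Z => B * / (1 + IZR m ^ 2))).
  { apply summable_scal; [lra|apply summable_inv_sq]. }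
  intros m. specialize (HG (IZR m)). rewrite Cmod_mult, sg_Cmod, Rmult_1_l, qpow_mod.
  eapply Rle_trans; [|exact HG]. pose proof (Rabs_pos (IZR m)).
  rewrite <- (Rmult_1_l (exp (- _))). apply Rmult_le_compat; try lra; [left; apply exp_pos|].
  apply exp_le.
  assert (H1 : - (c * IZR m) <= Rabs c * Rabs (IZR m)).
  { rewrite <- Rabs_mult, <- Rabs_Ropp. apply Rle_abs. }
  assert (H2 : PI * Im z * (- (c * IZR m)) <= PI * Im z * (Rabs c * Rabs (IZR m)))
    by (apply Rmult_le_compat_l; lra).
  assert (H3 : 0 <= PI * Im z * c ^ 2) by (apply Rmult_le_pos; [lra|apply pow2_ge_0]).
  replace (- (2 * PI * (3 / 2 * (IZR m + c) ^ 2) * Im z)) with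
    (6 * (PI * Im z * (- (c * IZR m))) - 3 * (PI * Im z) * IZR m ^ 2 - 3 * (PI * Im z * c ^ 2)) by field.
  lra.
Qed.

(** The characteristic [k / 3] with [k] in [Z + 1/2] is [1/6], [- 1/6] or [1/2] modulo 1. In the
    first case the series is that of the pentagonal number theorem. *)
Lemma theta_row_eta_plus z i : 0 < Im z ->
  has_sum (fun m => RtoC (sg m) * qpow (3 / 2 * (IZR m + half (3 * i) / 3) ^ 2) z)%C
    (RtoC (sg i) * eta z)%C.
Proof.
  intros Hz.
  assert (H := has_sum_bij (fun m => (m + i)%Z) (fun m => (m - i)%Z) _ _
     ltac:(intros; cbv beta; lia) ltac:(intros; cbv beta; lia) (eta_has_sum z Hz)).
  apply (has_sum_scal (RtoC (sg i))) in H. revert H. apply has_sum_ext. intros m. cbv beta.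
  rewrite Cmult_assoc, <- RtoC_mult, sg_add.
  replace (sg i * (sg m * sg i)) with (sg m) by (transitivity (sg m * (sg i * sg i)); [rewrite sg_sq; ring|ring]).
  do 3 f_equal. unfold half. rewrite plus_IZR, mult_IZR. field.
Qed.

(** The reflection of [m] turns the characteristic [- 1/6] into [1/6]. *)
Lemma theta_row_eta_minus z i : 0 < Im z ->
  has_sum (fun m => RtoC (sg m) * qpow (3 / 2 * (IZR m + half (3 * i - 1) / 3) ^ 2) z)%C
    (RtoC (sg i) * eta z)%C.
Proof.
  intros Hz.
  assert (H := has_sum_bij (fun m => (- m - i)%Z) (fun m => (- m - i)%Z) _ _
     ltac:(intros; cbv beta; lia) ltac:(intros; cbv beta; lia) (eta_has_sum z Hz)).
  apply (has_sum_scal (RtoC (sg i))) in H. revert H. apply has_sum_ext. intros m. cbv beta.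
  rewrite Cmult_assoc, <- RtoC_mult. unfold Z.sub at 1. rewrite sg_add, !sg_opp.
  replace (sg i * (sg m * sg i)) with (sg m) by (transitivity (sg m * (sg i * sg i)); [rewrite sg_sq; ring|ring]).
  do 2 f_equal. unfold half. rewrite !minus_IZR, opp_IZR, mult_IZR. field.
Qed.

(** The reflection about the half-integral centre of the square reverses the sign of every
    term. *)
Lemma theta_row_zero z i : 0 < Im z ->
  has_sum (fun m => RtoC (sg m) * qpow (3 / 2 * (IZR m + half (3 * i + 1) / 3) ^ 2) z)%C 0%C.
Proof.
  intros Hz. destruct (theta_row_summable z (half (3 * i + 1) / 3) Hz) as [S HS].
  assert (H := has_sum_bij (fun m => (- m - (2 * i + 1))%Z) (fun m => (- m - (2 * i + 1))%Z) _ _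
     ltac:(intros; cbv beta; lia) ltac:(intros; cbv beta; lia) HS).
  apply (has_sum_scal (RtoC (-1))) in H.
  assert (E : S = (RtoC (-1) * S)%C).
  { apply (has_sum_unique _ _ _ HS). revert H. apply has_sum_ext. intros m. cbv beta.
    rewrite Cmult_assoc, <- RtoC_mult.
    replace (-1 * sg (- m - (2 * i + 1))) with (sg m).
    - do 2 f_equal. unfold half. rewrite !minus_IZR, opp_IZR, !plus_IZR, !mult_IZR. field.
    - unfold Z.sub. rewrite sg_add, !sg_opp, sg_succ.
      replace (2 * i)%Z with (i + i)%Z by lia. rewrite sg_add, sg_sq. ring. }
  replace (RtoC 0) with S; [exact HS|].
  assert (E2 : (2 * S)%C = 0%C).
  { replace (2 * S)%C with (S + S)%C by ring. rewrite E at 1.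
    replace (RtoC (-1)) with (- (1))%C by (unfold Copp, RtoC; simpl; f_equal; ring). ring. }
  apply NNPP. intros Hn. exact (Cmult_neq_0 2 S C2_neq0 Hn E2).
Qed.

(** The coefficient left over in front of [eta] by the index [k = 3 i + 1/2] dual to [n]. *)
Definition period_term (alpha : R) (z : C) (s : R) (i : Z) : C :=
  (RtoC (sg i * (half (3 * i) * exp (- (PI * half (3 * i) ^ 2 * s)))) *
    (qpow (- (half (3 * i) ^ 2 / 6)) z * Cexp (2 * PI * Ci * RtoC (half (3 * i)) * RtoC alpha)))%C.

Lemma Cexp_mod_real k a : Cmod (Cexp (2 * PI * Ci * RtoC k * RtoC a)) = 1.
Proof.
  rewrite Cexp_mod, <- exp_0. f_equal. simpl. ring.
Qed.

Lemma period_term_bound alpha z s : 0 < Im z -> Im z / 3 < s -> exists B, 0 < B /\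
  forall i, Cmod (period_term alpha z s i) <= B * / (1 + IZR i ^ 2).
Proof.
  intros Hz Hs. pose proof PI_RGT_0.
  destruct (gauss_bound (PI * (s - Im z / 3)) 0) as (B & HB & HG).
  { apply Rmult_lt_0_compat; lra. }
  exists (B * 2). split; [lra|]. intros i. unfold period_term.
  specialize (HG (half (3 * i))).
  rewrite !Cmod_mult, Cexp_mod_real, Rmult_1_r, Cmod_R, !Rabs_mult, sg_abs, Rmult_1_l, qpow_mod.
  rewrite (Rabs_pos_eq (exp _)) by (left; apply exp_pos).
  assert (Hk : / (1 + half (3 * i) ^ 2) <= 2 * / (1 + IZR i ^ 2)).
  { unfold half. rewrite mult_IZR. set (x := IZR i). pose proof (pow2_ge_0 x).
    pose proof (pow2_ge_0 (3 * x + 1 / 2)).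
    apply Rmult_le_reg_r with ((1 + (3 * x + 1 / 2) ^ 2) * (1 + x ^ 2)).
    - apply Rmult_lt_0_compat; lra.
    - field_simplify; [|lra|lra]. nra. }
  set (k := half (3 * i)) in *. pose proof (Rabs_pos k).
  rewrite Rmult_assoc, <- exp_plus.
  replace (- (PI * k ^ 2 * s) + - (2 * PI * - (k ^ 2 / 6) * Im z)) with
    (0 * Rabs k - PI * (s - Im z / 3) * k ^ 2) by field.
  eapply Rle_trans; [|eapply Rle_trans; [exact HG|]].
  - apply Rmult_le_compat_r; [left; apply exp_pos|lra].
  - unfold Rdiv. rewrite Rmult_assoc. apply Rmult_le_compat_l; lra.
Qed.

(** The indices [k] and [- k] carry opposite coefficients and conjugate phases, whence the sine
    in [Theta1]; the Gaussians in [s] combine with the powers of [q] to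
    [exp (3 PI i tau (i + 1/6)^2)] at [tau = - Re z + i (3 s - Im z)]. *)
Lemma Theta1_period_terms l p z s A1 A2 : 0 < Im z -> Im z / 3 < s ->
  has_sum (period_term (ratio l p) z s) A1 -> has_sum (period_term (- ratio l p) z s) A2 ->
  Theta1 l p (- Re z, 3 * s - Im z) = ((A1 - A2) / Ci)%C.
Proof.
  intros Hz Hs H1 H2. unfold Theta1.
  destruct (period_term_bound (ratio l p) z s Hz Hs) as (B1 & HB1 & Hb1).
  destruct (period_term_bound (- ratio l p) z s Hz Hs) as (B2 & HB2 & Hb2).
  set (f := fun i => ((period_term (ratio l p) z s i - period_term (- ratio l p) z s i) / Ci)%C).
  assert (Hf : forall i, f i = (RtoC (powerRZ (-1) i * IZR (6 * i + 1)
           * sin (PI * IZR l * IZR (6 * i + 1) / IZR p))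
     * Cexp (3 * RtoC PI * Ci * (- Re z, 3 * s - Im z)%R * RtoC ((IZR i + 1 / 6) ^ 2)))%C).
  { intros i. unfold f, period_term. rewrite sg_powerRZ.
    assert (Hk : half (3 * i) = IZR (6 * i + 1) / 2).
    { unfold half. rewrite plus_IZR, !mult_IZR. field. }
    set (k := half (3 * i)) in *.
    assert (Hv : (IZR i + 1 / 6) ^ 2 = k ^ 2 / 9).
    { rewrite Hk, plus_IZR, mult_IZR. field. }
    assert (Hexp : (RtoC (exp (- (PI * k ^ 2 * s))) * qpow (- (k ^ 2 / 6)) z)%C =
      Cexp (3 * RtoC PI * Ci * (- Re z, 3 * s - Im z)%R * RtoC ((IZR i + 1 / 6) ^ 2))).
    { rewrite Hv.
      replace (RtoC (exp (- (PI * k ^ 2 * s)))) with (Cexp (RtoC (- (PI * k ^ 2 * s)))).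
      2:{ unfold Cexp, RtoC; simpl. rewrite cos_0, sin_0. f_equal; ring. }
      unfold qpow. rewrite <- Cexp_add. f_equal. destruct z as [x y].
      unfold Cplus, Cmult, RtoC, Ci, Re, Im; simpl. f_equal; field. }
    assert (Hsin : (Cexp (2 * PI * Ci * RtoC k * RtoC (ratio l p))
        - Cexp (2 * PI * Ci * RtoC k * RtoC (- ratio l p)))%C =
       (2 * Ci * RtoC (sin (PI * IZR l * IZR (6 * i + 1) / IZR p)))%C).
    { replace (2 * PI * Ci * RtoC k * RtoC (ratio l p))%C
        with (Ci * RtoC (2 * PI * k * ratio l p))%C by (rewrite !RtoC_mult; ring).
      replace (2 * PI * Ci * RtoC k * RtoC (- ratio l p))%C
        with (Ci * RtoC (- (2 * PI * k * ratio l p)))%C by (rewrite !RtoC_opp, !RtoC_mult; ring).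
      rewrite !Cexp_Ci, cos_neg, sin_neg.
      replace (2 * PI * k * ratio l p) with (PI * IZR l * IZR (6 * i + 1) / IZR p).
      - unfold Cminus, Cplus, Copp, Cmult, RtoC, Ci; simpl. f_equal; ring.
      - rewrite Hk. unfold ratio, Rdiv. set (ip := / IZR p). field. }
    rewrite <- Hexp, (RtoC_mult (sg i)), (RtoC_mult k).
    rewrite (RtoC_mult (sg i * _)), (RtoC_mult (sg i) (IZR _)).
    replace (RtoC (IZR (6 * i + 1))) with (2 * RtoC k)%C
      by (rewrite Hk, RtoC_div by lra; field).
    set (e := RtoC (exp (- (PI * k ^ 2 * s)))). set (q := qpow (- (k ^ 2 / 6)) z).
    replace (RtoC (sin (PI * IZR l * IZR (6 * i + 1) / IZR p))) with
      ((Cexp (2 * PI * Ci * RtoC k * RtoC (ratio l p))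
        - Cexp (2 * PI * Ci * RtoC k * RtoC (- ratio l p))) / (2 * Ci))%C.
    - field. repeat split; auto using Ci_neq0, C2_neq0.
    - rewrite Hsin. field. repeat split; auto using Ci_neq0, C2_neq0. }
  assert (HS : has_sum f ((A1 - A2) / Ci)%C).
  { assert (H := has_sum_scal (/ Ci) _ _ (has_sum_minus _ _ _ _ H1 H2)).
    unfold Cdiv. rewrite Cmult_comm. revert H. apply has_sum_ext. intros i. apply Cmult_comm. }
  apply (CSeriesZ_has_sum _ (fun i : Z => (B1 + B2) * / (1 + IZR i ^ 2))).
  - apply summable_scal; [lra|apply summable_inv_sq].
  - intros i. rewrite <- Hf. unfold f. rewrite Cmod_div, Cmod_Ci by apply Ci_neq0.
    unfold Rdiv. rewrite Rinv_1, Rmult_1_r. specialize (Hb1 i). specialize (Hb2 i).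
    eapply Rle_trans; [apply Cmod_triangle|]. rewrite Cmod_opp. lra.
  - revert HS. apply has_sum_ext. exact Hf.
Qed.

(** The terms obtained from [dlterm] by [theta_transform] on each row. Unlike the original ones
    they factor, by [dual_term_eq], into a part depending on [j] alone and a theta term in
    [m]. *)
Definition dual_term (alpha : R) (z : C) (s : R) (p : Z * Z) : C :=
  (RtoC (sg (fst p)) * qpow (3 / 2 * IZR (fst p) ^ 2) z
     * theta_dst (/ s) (row alpha z (fst p)) (snd p))%C.

Lemma dual_term_eq alpha z s m j :
  dual_term alpha z s (m, j) =
  (RtoC (half j * exp (- (PI * half j ^ 2 * s))) *
     (qpow (- (half j ^ 2 / 6)) z * Cexp (2 * PI * Ci * RtoC (half j) * RtoC alpha)) *
   (RtoC (sg m) * qpow (3 / 2 * (IZR m + half j / 3) ^ 2) z))%C.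
Proof.
  unfold dual_term, theta_dst. cbn [fst snd]. fold (half j).
  unfold Rdiv at 2. rewrite Rinv_inv.
  assert (H := qpow_theta_mult alpha z m (half j)).
  set (e := RtoC (half j * _)). set (q0 := qpow (3 / 2 * IZR m ^ 2) z) in *.
  set (E := Cexp (2 * PI * Ci * RtoC (half j) * row alpha z m)) in *.
  transitivity (RtoC (sg m) * e * (q0 * E))%C; [ring|]. rewrite H. ring.
Qed.

Lemma dual_term_bound alpha z s : 0 < Im z -> Im z / 3 < s -> exists B, 0 < B /\
  forall p, Cmod (dual_term alpha z s p) <=
    B * (/ (1 + IZR (fst p) ^ 2) * / (1 + IZR (snd p) ^ 2)).
Proof.
  intros Hz Hs. pose proof PI_RGT_0.
  assert (Hc : 0 < PI * (s - Im z / 3)) by (apply Rmult_lt_0_compat; lra).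
  assert (Hpy : 0 < PI * Im z) by now apply Rmult_lt_0_compat.
  destruct (lattice_gauss (PI * (s - Im z / 3) / 2) (3 * (PI * Im z)) (1 / 3) (1 / 6))
    as (B & HB & HG); [lra|lra|].
  exists (exp (PI * (s - Im z / 3) / 4) * B). split.
  { apply Rmult_lt_0_compat; auto. apply exp_pos. }
  intros [m j]. cbn [fst snd]. rewrite dual_term_eq.
  rewrite !Cmod_mult, Cexp_mod_real, Rmult_1_r, sg_Cmod, Rmult_1_l, Cmod_R, Rabs_mult, !qpow_mod.
  rewrite (Rabs_pos_eq (exp _)) by (left; apply exp_pos).
  specialize (HG j m). rewrite !(Rmult_assoc (Rabs _)), <- !exp_plus.
  rewrite (Rmult_comm (/ (1 + IZR m ^ 2))).
  eapply Rle_trans; [|rewrite Rmult_assoc; apply Rmult_le_compat_l; [left; apply exp_pos|exact HG]].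
  match goal with |- _ <= exp ?a * (?v * exp ?b) =>
    replace (exp a * (v * exp b)) with (v * exp (a + b)) by (rewrite exp_plus; ring) end.
  pose proof (Rabs_pos (IZR m)). pose proof (Rabs_pos (IZR j)).
  apply Rmult_le_compat; [apply Rabs_pos|left; apply exp_pos| |].
  - assert (Rabs (half j) <= Rabs (IZR j) + 1 / 2).
    { unfold half. eapply Rle_trans; [apply Rabs_triang|]. rewrite (Rabs_pos_eq (1 / 2)) by lra. lra. }
    assert (0 <= Rabs (IZR j) * Rabs (IZR m)) by now apply Rmult_le_pos. lra.
  - apply exp_le.
    replace (IZR j * (1 / 3) + 1 / 6 + IZR m) with (IZR m + half j / 3) by (unfold half; field).
    assert (Hj : IZR j ^ 2 / 2 - 1 / 4 <= half j ^ 2).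
    { unfold half. pose proof (pow2_ge_0 (IZR j + 1)). nra. }
    assert (Hk : PI * (s - Im z / 3) * (IZR j ^ 2 / 2 - 1 / 4) <= PI * (s - Im z / 3) * half j ^ 2)
      by (apply Rmult_le_compat_l; lra).
    set (k := half j) in *. set (v := (IZR m + k / 3) ^ 2). lra.
Qed.

Lemma theta_dst_row_has_sum alpha z s m : 0 < s -> exists T,
  has_sum (theta_dst (/ s) (row alpha z m)) T /\
  has_sum (fun n => dlterm alpha z s (m, n))
    (RtoC (PI / sqrt s) / Ci * (RtoC (sg m) * qpow (3 / 2 * IZR m ^ 2) z * T))%C.
Proof.
  intros Hs. assert (Hs' : 0 < / s) by now apply Rinv_0_lt_compat.
  destruct (theta_transform (/ s) (row alpha z m) Hs') as (T & HT & Hsrc).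
  exists T. split; auto.
  apply (has_sum_scal (RtoC (sg m) * qpow (3 / 2 * IZR m ^ 2) z * RtoC (PI / s ^ 2))%C) in Hsrc.
  assert (Hq : 0 < sqrt s) by now apply sqrt_lt_R0.
  assert (Ess : sqrt s * sqrt s = s) by (apply sqrt_sqrt; lra).
  replace (RtoC (PI / sqrt s)) with (RtoC (PI / s ^ 2) * RtoC (/ (/ s * sqrt (/ s))))%C.
  2:{ rewrite <- RtoC_mult. f_equal. rewrite sqrt_inv.
      replace (/ (/ s * / sqrt s)) with (s * sqrt s) by (field; split; lra).
      replace (PI / s ^ 2 * (s * sqrt s)) with (PI * sqrt s / s) by (field; lra).
      rewrite <- Ess at 2. field. lra. }
  match goal with |- has_sum _ ?x => match type of Hsrc with has_sum _ ?y =>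
    replace x with y by (unfold Cdiv; ring) end end.
  revert Hsrc. apply has_sum_ext. intros n. unfold theta_src, dlterm, weight, gauss, lat.
  cbn [fst snd]. rewrite sg_add, RtoC_mult.
  replace (- (PI * RtoC (/ s) * ((row alpha z m + IZR n) * (row alpha z m + IZR n))))%C
    with (RtoC (- (PI / s)) * ((row alpha z m + IZR n) * (row alpha z m + IZR n)))%C.
  - ring.
  - unfold Rdiv. rewrite RtoC_opp, RtoC_mult. ring.
Qed.

(** Summing over [m] first: the indices [j] congruent to 0 and [- 1] modulo 3 contribute [eta]
    times the two families of period terms, and those congruent to 1 contribute nothing. *)
Lemma dual_total alpha z s : 0 < Im z -> Im z / 3 < s -> exists Tot A1 A2,
  has_sum (dual_term alpha z s) Tot /\
  has_sum (period_term alpha z s) A1 /\ has_sum (period_term (- alpha) z s) A2 /\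
  Tot = (eta z * (A1 - A2))%C.
Proof.
  intros Hz Hs.
  destruct (dual_term_bound alpha z s Hz Hs) as (B & HB & Hb).
  destruct (summable_has_sum (dual_term alpha z s) _ (summable_lattice B ltac:(lra)) Hb) as [Tot HT].
  destruct (period_term_bound alpha z s Hz Hs) as (B1 & HB1 & Hb1).
  destruct (period_term_bound (- alpha) z s Hz Hs) as (B2 & HB2 & Hb2).
  destruct (summable_has_sum (period_term alpha z s) _
     (summable_scal B1 _ ltac:(lra) summable_inv_sq) Hb1) as [A1 H1].
  destruct (summable_has_sum (period_term (- alpha) z s) _
     (summable_scal B2 _ ltac:(lra) summable_inv_sq) Hb2) as [A2 H2].
  exists Tot, A1, A2. repeat split; auto.
  set (coef := fun j => (RtoC (half j * exp (- (PI * half j ^ 2 * s))) *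
     (qpow (- (half j ^ 2 / 6)) z * Cexp (2 * PI * Ci * RtoC (half j) * RtoC alpha)))%C).
  set (ths := fun j : Z => hsum (fun m => RtoC (sg m) * qpow (3 / 2 * (IZR m + half j / 3) ^ 2) z)%C).
  assert (Hths : forall j, has_sum (fun m => RtoC (sg m) * qpow (3 / 2 * (IZR m + half j / 3) ^ 2) z)%C (ths j))
    by (intros j; apply hsum_correct; now apply theta_row_summable).
  assert (HD : has_sum (fun j => coef j * ths j)%C Tot).
  { apply (has_sum_fubini _ _ _ (has_sum_swap _ _ HT)). intros j. cbn [fst snd].
    assert (H := has_sum_scal (coef j) _ _ (Hths j)). revert H. apply has_sum_ext.
    intros m. symmetry. apply dual_term_eq. }
  assert (E0 : forall i, ths (3 * i)%Z = (RtoC (sg i) * eta z)%C)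
    by (intros i; exact (has_sum_unique _ _ _ (Hths _) (theta_row_eta_plus z i Hz))).
  assert (E1 : forall i, ths (3 * i - 1)%Z = (RtoC (sg i) * eta z)%C)
    by (intros i; exact (has_sum_unique _ _ _ (Hths _) (theta_row_eta_minus z i Hz))).
  assert (E2 : forall i, ths (3 * i + 1)%Z = 0%C)
    by (intros i; exact (has_sum_unique _ _ _ (Hths _) (theta_row_zero z i Hz))).
  rewrite (has_sum_mod3 _ Tot (eta z * A1)%C (eta z * (-(1) * A2))%C 0%C HD); [ring| | |].
  - apply (has_sum_scal (eta z)) in H1. revert H1. apply has_sum_ext. intros i. cbv beta.
    rewrite E0. unfold coef, period_term. rewrite (RtoC_mult (sg i)). ring.
  (* the index 3 i - 1 is the dual index of 3 (- i), up to sign: half (3 i - 1) = - half (- 3 i) *)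
  - apply (has_sum_scal (-(1))) in H2. apply (has_sum_scal (eta z)) in H2.
    apply (has_sum_bij Z.opp Z.opp) in H2; try (intros; lia).
    revert H2. apply has_sum_ext. intros i. cbv beta.
    rewrite E1. unfold coef, period_term.
    replace (half (3 * i - 1)) with (- half (3 * - i))
      by (unfold half; rewrite minus_IZR, !mult_IZR, opp_IZR; lra).
    set (k := half (3 * - i)). rewrite sg_opp.
    replace ((- k) ^ 2) with (k ^ 2) by ring.
    replace (2 * PI * Ci * RtoC (- k) * RtoC alpha)%C with (2 * PI * Ci * RtoC k * RtoC (- alpha))%C
      by (rewrite !RtoC_opp; ring).
    rewrite (RtoC_mult (sg i)), (RtoC_mult k), (RtoC_mult (- k)), (RtoC_opp k). ring.
  - apply (has_sum_ext (fun _ : Z => 0%C)).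
    + intros i. rewrite E2. ring.
    + apply (has_sum_finite (fun _ : Z => 0%C) nil); [constructor|auto].
Qed.

(** The double family is summed along the rows [m] before and after the transformation. *)
Lemma dPsi_Theta1 l p z s : 0 < Im z -> Im z / 3 < s ->
  dPsi (ratio l p) z s =
  (RtoC (PI / sqrt s) * (eta z * Theta1 l p (- Re z, 3 * s - Im z)%R))%C.
Proof.
  intros Hz Hs. assert (Hs0 : 0 < s) by lra. set (alpha := ratio l p).
  destruct (dual_total alpha z s Hz Hs) as (Tot & A1 & A2 & HT & H1 & H2 & E).
  rewrite (Theta1_period_terms l p z s A1 A2 Hz Hs H1 H2).
  set (T := fun m => proj1_sig (constructive_indefinite_description _
     (theta_dst_row_has_sum alpha z s m Hs0))).
  assert (HTm : forall m, has_sum (theta_dst (/ s) (row alpha z m)) (T m) /\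
    has_sum (fun n => dlterm alpha z s (m, n))
    (RtoC (PI / sqrt s) / Ci * (RtoC (sg m) * qpow (3 / 2 * IZR m ^ 2) z * T m))%C).
  { intros m. unfold T. destruct (constructive_indefinite_description _ _); auto. }
  assert (F1 := has_sum_fubini _ _ _ (dPsi_has_sum alpha z s Hz Hs) (fun m => proj2 (HTm m))).
  assert (F2 : has_sum (fun m => RtoC (sg m) * qpow (3 / 2 * IZR m ^ 2) z * T m)%C Tot).
  { apply (has_sum_fubini _ _ _ HT). intros m.
    exact (has_sum_scal (RtoC (sg m) * qpow (3 / 2 * IZR m ^ 2) z)%C _ _ (proj1 (HTm m))). }
  assert (F3 := has_sum_scal (RtoC (PI / sqrt s) / Ci)%C _ _ F2).
  rewrite (has_sum_unique _ _ _ F1 F3), E. unfold Cdiv. ring.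
Qed.

(** * The limit of the interpolating sum *)

(** The Gaussians at [X + n] and [X - n] differ by the factor [exp (- 4 PI n X / s)], so the poles
    cancel to first order and the pair decays like [1 / n^2], uniformly for large [s]; the single
    terms have no summable majorant independent of [s]. *)
Lemma gauss_pair_bound d X n s : 0 < d <= 1 -> away d X -> 0 < s ->
  Cmod (gauss s (X + RtoC (IZR n)) / (X + RtoC (IZR n))
      + gauss s (X - RtoC (IZR n)) / (X - RtoC (IZR n))) <=
  40 / d ^ 2 * (Cmod X * (1 + Cmod X ^ 2) * exp (3 * PI * Cmod X ^ 2 / s)) * / (1 + IZR n ^ 2).
Proof.
  intros Hd Ha Hs. pose proof PI_RGT_0 as HP.
  assert (Np : (X + RtoC (IZR n))%C <> 0%C) by (apply away_neq0 with d; [lra|auto]).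
  assert (Nm : (X - RtoC (IZR n))%C <> 0%C).
  { unfold Cminus. rewrite <- RtoC_opp, <- opp_IZR. apply away_neq0 with d; [lra|auto]. }
  assert (Hpair := away_pair d X n Hd Ha).
  set (N := IZR n) in *. set (wp := (X + RtoC N)%C) in *. set (wm := (X - RtoC N)%C) in *.
  assert (Hwp : 0 < Cmod wp) by now apply Cmod_gt_0.
  assert (Hwm : 0 < Cmod wm) by now apply Cmod_gt_0.
  assert (HW : 0 < Cmod wp * Cmod wm) by now apply Rmult_lt_0_compat.
  set (A := (RtoC (2 * PI * N / s) * X)%C).
  set (E0 := Cexp (RtoC (- (PI / s)) * (X * X))%C). set (g := exp (- (PI * N ^ 2 / s))).
  assert (Gp : gauss s wp = (E0 * RtoC g * Cexp (- A))%C).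
  { unfold gauss, E0, g. rewrite <- Cexp_RtoC, <- !Cexp_add. f_equal. unfold wp, A, Rdiv.
    simpl (N ^ 2). rewrite !RtoC_opp, !RtoC_mult. ring. }
  assert (Gm : gauss s wm = (E0 * RtoC g * Cexp A)%C).
  { unfold gauss, E0, g. rewrite <- Cexp_RtoC, <- !Cexp_add. f_equal. unfold wm, A, Rdiv.
    simpl (N ^ 2). rewrite !RtoC_opp, !RtoC_mult. ring. }
  rewrite Gp, Gm.
  replace (E0 * RtoC g * Cexp (- A) / wp + E0 * RtoC g * Cexp A / wm)%C with
    (E0 * RtoC g * (X * (Cexp A + Cexp (- A)) + RtoC N * ((Cexp A - 1) - (Cexp (- A) - 1))) / (wp * wm))%C.
  2:{ replace (X * (Cexp A + Cexp (- A)) + RtoC N * ((Cexp A - 1) - (Cexp (- A) - 1)))%C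
       with (wm * Cexp (- A) + wp * Cexp A)%C by (unfold wm, wp; ring). field. auto. }
  rewrite Cmod_div, !Cmod_mult, Cmod_R by (apply Cmult_neq_0; auto).
  rewrite (Rabs_pos_eq g) by (left; apply exp_pos).
  set (x := Cmod X) in *. assert (Hx : 0 <= x) by apply Cmod_ge_0.
  assert (HA : Cmod A = 2 * PI / s * (Rabs N * x)).
  { unfold A. rewrite Cmod_mult, Cmod_R. unfold Rdiv. rewrite !Rabs_mult, (Rabs_pos_eq 2), (Rabs_pos_eq PI), (Rabs_pos_eq (/ s))
      by (try lra; left; apply Rinv_0_lt_compat; lra). fold x. ring. }
  assert (HE0 : Cmod E0 <= exp (PI * x ^ 2 / s)).
  { eapply Rle_trans; [apply Cexp_mod_le|]. apply exp_le. rewrite !Cmod_mult, Cmod_R, Rabs_Ropp.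
    rewrite Rabs_pos_eq by (left; apply Rdiv_lt_0_compat; lra). fold x. right. field. lra. }
  pose proof (Cmod_ge_0 A) as HA0. pose proof (exp_pos (Cmod A)) as HeA.
  assert (H1 : Cmod (Cexp A + Cexp (- A)) <= 2 * exp (Cmod A)).
  { eapply Rle_trans; [apply Cmod_triangle|].
    pose proof (Cexp_mod_le A). pose proof (Cexp_mod_le (- A)). rewrite Cmod_opp in *. lra. }
  assert (H2 : Cmod ((Cexp A - 1) - (Cexp (- A) - 1)) <= 2 * (Cmod A * exp (Cmod A))).
  { eapply Rle_trans; [apply Cmod_triangle|]. rewrite Cmod_opp.
    pose proof (Cexp_taylor1 A). pose proof (Cexp_taylor1 (- A)). rewrite Cmod_opp in *. lra. }
  pose proof (Rabs_pos N) as HN0.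
  assert (Hnum : Cmod (X * (Cexp A + Cexp (- A)) + RtoC N * ((Cexp A - 1) - (Cexp (- A) - 1))) <=
     2 * x * (1 + 2 * PI * N ^ 2 / s) * exp (Cmod A)).
  { eapply Rle_trans; [apply Cmod_triangle|]. rewrite !Cmod_mult, Cmod_R. fold x.
    apply Rle_trans with (x * (2 * exp (Cmod A)) + Rabs N * (2 * (Cmod A * exp (Cmod A)))).
    - apply Rplus_le_compat; apply Rmult_le_compat_l; auto.
    - right. rewrite HA at 2. rewrite <- (pow2_abs N). field. lra. }
  assert (Hg : g * ((1 + 2 * PI * N ^ 2 / s) * exp (Cmod A)) <= 4 * exp (2 * PI * x ^ 2 / s)).
  { assert (HPs : 0 < PI / s) by (apply Rdiv_lt_0_compat; lra).
    set (v := PI * N ^ 2 / s / 2).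
    assert (Hv : 0 <= v).
    { replace v with (PI / s / 2 * N ^ 2) by (unfold v; field; lra).
      apply Rmult_le_pos; [lra|apply pow2_ge_0]. }
    assert (Hsq : - (PI * N ^ 2 / s) + Cmod A <= - v + 2 * PI * x ^ 2 / s).
    { rewrite HA. unfold v.
      assert (0 <= PI / s * (Rabs N - 2 * x) ^ 2 / 2).
      { replace (PI / s * (Rabs N - 2 * x) ^ 2 / 2) with (PI / s / 2 * (Rabs N - 2 * x) ^ 2) by (field; lra).
        apply Rmult_le_pos; [lra|apply pow2_ge_0]. }
      replace (PI / s * (Rabs N - 2 * x) ^ 2 / 2) with
        (PI / s * (Rabs N ^ 2) / 2 - 2 * PI / s * (Rabs N * x) + 2 * PI * x ^ 2 / s) in H by (field; lra).
      rewrite pow2_abs in H.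
      replace (- (PI * N ^ 2 / s)) with (- (PI * N ^ 2 / s / 2) - PI / s * N ^ 2 / 2) by (field; lra).
      lra. }
    replace (1 + 2 * PI * N ^ 2 / s) with (1 + 4 * v) by (unfold v; field; lra).
    unfold g. replace (exp (- (PI * N ^ 2 / s)) * ((1 + 4 * v) * exp (Cmod A)))
      with ((1 + 4 * v) * exp (- (PI * N ^ 2 / s) + Cmod A)) by (rewrite exp_plus; ring).
    apply Rle_trans with ((1 + 4 * v) * (exp (- v) * exp (2 * PI * x ^ 2 / s))).
    - apply Rmult_le_compat_l; [lra|]. rewrite <- exp_plus. now apply exp_le.
    - rewrite <- Rmult_assoc. apply Rmult_le_compat_r; [left; apply exp_pos|].
      rewrite exp_Ropp. apply div_le; [apply exp_pos|].
      pose proof (exp_ineq1_le v). lra. }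
  apply Rle_trans with (exp (PI * x ^ 2 / s) * (2 * x * (4 * exp (2 * PI * x ^ 2 / s))) / (Cmod wp * Cmod wm)).
  - unfold Rdiv at 1. apply Rmult_le_compat_r; [left; now apply Rinv_0_lt_compat|].
    apply Rle_trans with (exp (PI * x ^ 2 / s) * g * (2 * x * (1 + 2 * PI * N ^ 2 / s) * exp (Cmod A))).
    + assert (0 < g) by apply exp_pos. apply Rmult_le_compat; auto.
      * apply Rmult_le_pos; [apply Cmod_ge_0|lra].
      * apply Cmod_ge_0.
      * apply Rmult_le_compat_r; [lra|auto].
    + rewrite Rmult_assoc. apply Rmult_le_compat_l; [left; apply exp_pos|].
      replace (g * (2 * x * (1 + 2 * PI * N ^ 2 / s) * exp (Cmod A))) with
        (2 * x * (g * ((1 + 2 * PI * N ^ 2 / s) * exp (Cmod A)))) by ring.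
      apply Rmult_le_compat_l; lra.
  - replace (exp (PI * x ^ 2 / s) * (2 * x * (4 * exp (2 * PI * x ^ 2 / s)))) with
      (8 * x * exp (3 * PI * x ^ 2 / s)).
    2:{ replace (3 * PI * x ^ 2 / s) with (PI * x ^ 2 / s + 2 * PI * x ^ 2 / s) by (field; lra).
        rewrite exp_plus. ring. }
    set (e := exp (3 * PI * x ^ 2 / s)). assert (He : 0 < e) by apply exp_pos.
    assert (Hd2 : 0 < d ^ 2) by (apply pow_lt; lra). pose proof (pow2_ge_0 N). pose proof (pow2_ge_0 x).
    apply Rmult_le_reg_r with (d ^ 2 * (1 + N ^ 2) * (Cmod wp * Cmod wm)).
    { apply Rmult_lt_0_compat; auto. apply Rmult_lt_0_compat; lra. }
    replace (8 * x * e / (Cmod wp * Cmod wm) * (d ^ 2 * (1 + N ^ 2) * (Cmod wp * Cmod wm)))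
      with (8 * x * e * (d ^ 2 * (1 + N ^ 2))) by (field; lra).
    replace (40 / d ^ 2 * (x * (1 + x ^ 2) * e) * / (1 + N ^ 2) * (d ^ 2 * (1 + N ^ 2) * (Cmod wp * Cmod wm)))
      with (8 * x * e * (5 * (1 + x ^ 2) * (Cmod wp * Cmod wm))) by (field; lra).
    apply Rmult_le_compat_l; [|exact Hpair].
    apply Rmult_le_pos; [|lra]. lra.
Qed.

(** [lterm] averaged over [n] and [- n]: the same total sum, but dominated as [s] tends to
    infinity. *)
Definition sym_term (alpha : R) (z : C) (s : R) (p : Z * Z) : C :=
  (weight z p *
    ((gauss s (row alpha z (fst p) + RtoC (IZR (snd p))) / (row alpha z (fst p) + RtoC (IZR (snd p)))
     + gauss s (row alpha z (fst p) - RtoC (IZR (snd p))) / (row alpha z (fst p) - RtoC (IZR (snd p)))) / 2))%C.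

Lemma sym_term_has_sum alpha z s : not_integer alpha -> 0 < Im z -> Im z / 3 < s ->
  has_sum (sym_term alpha z s) (Psi alpha z s).
Proof.
  intros Ha Hz Hs. assert (H1 := Psi_has_sum alpha z s Ha Hz Hs).
  assert (H2 := has_sum_bij (fun p : Z * Z => (fst p, - snd p)%Z) (fun p => (fst p, - snd p)%Z) _ _
     ltac:(intros [a b]; cbn [fst snd]; f_equal; lia)
     ltac:(intros [a b]; cbn [fst snd]; f_equal; lia) H1).
  assert (H := has_sum_scal (1 / 2) _ _ (has_sum_plus _ _ _ _ H1 H2)).
  replace (Psi alpha z s) with (1 / 2 * (Psi alpha z s + Psi alpha z s))%C by field.
  revert H. apply has_sum_ext. intros [m n]. unfold lterm, sym_term, weight, lat. cbn [fst snd].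
  rewrite !sg_add, sg_opp, opp_IZR, RtoC_opp. fold (Cminus (row alpha z m) (IZR n)).
  unfold Cdiv. ring.
Qed.

Lemma sym_term_bound alpha z : not_integer alpha -> 0 < Im z -> exists B s0, 0 < B /\ 0 < s0 /\
  forall s p, s0 <= s ->
  Cmod (sym_term alpha z s p) <= B * (/ (1 + IZR (fst p) ^ 2) * / (1 + IZR (snd p) ^ 2)).
Proof.
  intros Ha Hz. pose proof PI_RGT_0 as HP.
  destruct (row_away alpha z Ha Hz) as (d & Hd & Hda).
  set (y := Im z) in *. set (b := Cmod z + Rabs alpha).
  assert (Hpy : 0 < PI * y) by now apply Rmult_lt_0_compat.
  assert (Hb : 0 < b).
  { unfold b. assert (0 < Cmod z).
    { eapply Rlt_le_trans; [|apply im_le_Cmod]. fold y. rewrite Rabs_pos_eq; lra. }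
    pose proof (Rabs_pos alpha). lra. }
  (* for s >= 6 b^2 / y the growth exp (3 PI |X|^2 / s) of gauss_pair_bound is at most
     exp (PI y (m^2 + 1)), a third of what the weight provides *)
  set (s0 := 6 * b ^ 2 / y).
  assert (Hb2 : 0 < b ^ 2) by (apply pow_lt; lra).
  assert (Hs0 : 0 < s0) by (unfold s0; apply Rdiv_lt_0_compat; lra).
  assert (Hrow : forall m, Cmod (row alpha z m) <= b * (1 + Rabs (IZR m))).
  { intros m. unfold row. eapply Rle_trans; [apply Cmod_triangle|].
    rewrite Cmod_mult, !Cmod_R. unfold b. pose proof (Rabs_pos (IZR m)).
    pose proof (Rabs_pos alpha). pose proof (Cmod_ge_0 z).
    assert (0 <= Rabs alpha * Rabs (IZR m)) by now apply Rmult_le_pos. lra. }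
  destruct (gauss_bound (PI * y) 0 Hpy) as (B0 & HB0 & HG).
  set (K := 1 + / (PI * y)).
  assert (HK : 0 < K) by (unfold K; pose proof (Rinv_0_lt_compat _ Hpy); lra).
  set (Cst := 20 / d ^ 2 * b * (1 + 2 * b ^ 2) * exp (PI * y) * K).
  assert (Hd2 : 0 < d ^ 2) by (apply pow_lt; lra).
  assert (HC : 0 < Cst).
  { unfold Cst. repeat apply Rmult_lt_0_compat; auto; try lra; [|apply exp_pos].
    now apply Rinv_0_lt_compat. }
  exists (Cst * B0), s0. split; [now apply Rmult_lt_0_compat|]. split; auto.
  intros s [m n] Hs. cbn [fst snd]. unfold sym_term. cbn [fst snd].
  set (X := row alpha z m). assert (HX := Hrow m). fold X in HX.
  assert (HGP := gauss_pair_bound d X n s Hd (Hda m) ltac:(lra)).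
  unfold weight. cbn [fst snd]. rewrite Cmod_mult, Cmod_mult, sg_Cmod, Rmult_1_l, qpow_mod.
  rewrite Cmod_div, (Cmod_R 2), (Rabs_pos_eq 2) by (apply C2_neq0 || lra). fold y.
  set (x := Cmod X) in *. assert (Hx0 : 0 <= x) by apply Cmod_ge_0.
  set (M := Rabs (IZR m)) in *. assert (HM : 0 <= M) by apply Rabs_pos.
  assert (HM2 : IZR m ^ 2 = M ^ 2) by (unfold M; now rewrite pow2_abs).
  specialize (HG (IZR m)). fold M in HG. rewrite HM2 in HG |- *. rewrite Rmult_0_l, Rminus_0_l in HG.
  assert (Hx2 : x ^ 2 <= 2 * b ^ 2 * (1 + M ^ 2)).
  { apply Rle_trans with ((b * (1 + M)) ^ 2); [apply pow_incr; lra|].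
    rewrite Rpow_mult_distr. pose proof (pow2_ge_0 (M - 1)). nra. }
  assert (He : exp (3 * PI * x ^ 2 / s) <= exp (PI * y) * exp (PI * y * M ^ 2)).
  { rewrite <- exp_plus. apply exp_le. apply div_le; [lra|].
    apply Rle_trans with (PI * y * (1 + M ^ 2) * s0).
    - unfold s0. replace (PI * y * (1 + M ^ 2) * (6 * b ^ 2 / y)) with
        (3 * PI * (2 * b ^ 2 * (1 + M ^ 2))) by (field; lra).
      apply Rmult_le_compat_l; lra.
    - replace (PI * y + PI * y * M ^ 2) with (PI * y * (1 + M ^ 2)) by ring.
      apply Rmult_le_compat_l; [|lra]. apply Rmult_le_pos; [lra|]. pose proof (pow2_ge_0 M); lra. }
  assert (Hpoly : 1 + M ^ 2 <= K * exp (PI * y * M ^ 2)).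
  { pose proof (exp_ineq1_le (PI * y * M ^ 2)) as H. pose proof (pow2_ge_0 M).
    apply Rle_trans with (K * (1 + PI * y * M ^ 2)); [|apply Rmult_le_compat_l; lra].
    unfold K. pose proof (Rinv_0_lt_compat _ Hpy).
    replace ((1 + / (PI * y)) * (1 + PI * y * M ^ 2)) with
      (1 + M ^ 2 + / (PI * y) + PI * y * M ^ 2) by (field; lra).
    assert (0 <= PI * y * M ^ 2) by (apply Rmult_le_pos; lra). lra. }
  assert (Hxx : x * (1 + x ^ 2) <= b * (1 + M) * ((1 + 2 * b ^ 2) * (1 + M ^ 2))).
  { apply Rmult_le_compat; auto; [pose proof (pow2_ge_0 x); lra|].
    pose proof (pow2_ge_0 M). assert (0 <= b ^ 2 * M ^ 2) by (apply Rmult_le_pos; lra). lra. }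
  set (Q := exp (- (2 * PI * (3 / 2 * M ^ 2) * y))).
  assert (HQ : Q * (exp (PI * y * M ^ 2) * exp (PI * y * M ^ 2)) = exp (- (PI * y * M ^ 2))).
  { unfold Q. rewrite <- !exp_plus. f_equal. field. }
  assert (HQ0 : 0 < Q) by apply exp_pos.
  pose proof (inv_sq_pos n) as Hin. pose proof (pow2_ge_0 x) as Hx2'.
  set (e := exp (PI * y * M ^ 2)) in *. assert (He0 : 0 < e) by apply exp_pos.
  apply Rle_trans with (Q * ((40 / d ^ 2 * (b * (1 + M) * ((1 + 2 * b ^ 2) * (K * e)) * (exp (PI * y) * e)) * / (1 + IZR n ^ 2)) / 2)).
  - apply Rmult_le_compat_l; [lra|]. match goal with |- ?a / 2 <= ?b / 2 => assert (Hab : a <= b); [|lra] end.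
    eapply Rle_trans; [exact HGP|]. apply Rmult_le_compat_r; [lra|].
    apply Rmult_le_compat_l; [left; apply Rdiv_lt_0_compat; lra|].
    apply Rmult_le_compat; auto; [apply Rmult_le_pos; lra|left; apply exp_pos|].
    eapply Rle_trans; [exact Hxx|]. apply Rmult_le_compat_l; [apply Rmult_le_pos; lra|].
    apply Rmult_le_compat_l; lra.
  - replace (Q * ((40 / d ^ 2 * (b * (1 + M) * ((1 + 2 * b ^ 2) * (K * e)) * (exp (PI * y) * e)) * / (1 + IZR n ^ 2)) / 2))
      with (Cst * ((1 + M) * (Q * (e * e))) * / (1 + IZR n ^ 2)) by (unfold Cst; field; split; [|lra]; pose proof (pow2_ge_0 (IZR n)); lra).
    rewrite HQ.
    replace (Cst * B0 * (/ (1 + M ^ 2) * / (1 + IZR n ^ 2))) with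
      (Cst * (B0 / (1 + M ^ 2)) * / (1 + IZR n ^ 2)) by (unfold Rdiv; ring).
    apply Rmult_le_compat_r; [lra|]. apply Rmult_le_compat_l; lra.
Qed.

(** The terms converge to those of [csc_partial_fractions] on each row, and the sum over the rows
    is the cosecant series of [eta_NN]. *)
Lemma Psi_limit l p z : not_integer (ratio l p) -> 0 < Im z ->
  Clim (Rbar_locally p_infty) (Psi (ratio l p) z) (PI * (eta z * NN l p z))%C.
Proof.
  intros Ha Hz. set (alpha := ratio l p) in *.
  destruct (sym_term_bound alpha z Ha Hz) as (B & s0 & HB & Hs0 & Hb).
  assert (Hg := summable_lattice B ltac:(lra)).
  set (lim_term := fun p : Z * Z => (weight z p *
    ((/ (row alpha z (fst p) + RtoC (IZR (snd p))) + / (row alpha z (fst p) - RtoC (IZR (snd p)))) / 2))%C).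
  assert (Hev : Rbar_locally p_infty (fun s => forall p, Cmod (sym_term alpha z s p) <=
     B * (/ (1 + IZR (fst p) ^ 2) * / (1 + IZR (snd p) ^ 2)))).
  { exists s0. intros s Hs p0. apply Hb. lra. }
  assert (Hgl : forall w, Clim (Rbar_locally p_infty) (fun s => gauss s w) 1%C).
  { intros w. rewrite <- Cexp_0. unfold gauss. apply Clim_Cexp; [apply _|].
    replace (RtoC 0) with (RtoC (- (PI * 0)) * (w * w))%C
      by (rewrite Rmult_0_r, Ropp_0; ring).
    apply Clim_mult; [apply _| |apply Clim_const, _].
    apply Clim_RtoC; [apply _|].
    assert (Hi : filterlim Rinv (Rbar_locally p_infty) (Rbar_locally 0))
      by exact (filterlim_Rbar_inv p_infty ltac:(easy)).
    apply (filterlim_comp _ _ _ Rinv (fun x => - (PI * x)) _ (locally 0)); auto.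
    apply (continuity_pt_filterlim (fun x => - (PI * x)) 0). apply derivable_continuous_pt.
    exists (- PI). apply is_derive_Reals. auto_derive; auto. ring. }
  assert (Hl : forall p, Clim (Rbar_locally p_infty) (fun s => sym_term alpha z s p) (lim_term p)).
  { intros [m n]. unfold sym_term, lim_term. cbn [fst snd]. apply Clim_scal; [apply _|].
    unfold Cdiv. apply Clim_mult; [apply _| |apply Clim_const, _].
    assert (Hq : forall w c : C, Clim (Rbar_locally p_infty) (fun s => gauss s w * c)%C c).
    { intros w c. pose proof (Clim_mult (Rbar_locally p_infty) _ _ _ _ (Hgl w)
        (Clim_const (Rbar_locally p_infty) c)) as H. now rewrite Cmult_1_l in H. }
    apply Clim_plus; [apply _| |]; apply Hq. }
  assert (Hb0 : forall p, Cmod (lim_term p) <= B * (/ (1 + IZR (fst p) ^ 2) * / (1 + IZR (snd p) ^ 2))).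
  { intros q. apply (Clim_bound (Rbar_locally p_infty) (fun s => sym_term alpha z s q)); auto.
    revert Hev. apply filter_imp. auto. }
  destruct (summable_has_sum lim_term _ Hg Hb0) as [S HS].
  destruct (row_away alpha z Ha Hz) as (d & Hd & Hda).
  assert (Hrow : forall m, has_sum (fun n => lim_term (m, n)) (PI * csc_term alpha z m)%C).
  { intros m.
    assert (H := csc_partial_fractions (row alpha z m)
      (fun k => away_neq0 d _ k (proj1 Hd) (Hda m))).
    apply (has_sum_scal (RtoC (sg m) * qpow (3 / 2 * IZR m ^ 2) z)%C) in H.
    replace (PI * csc_term alpha z m)%C with
      (sg m * qpow (3 / 2 * IZR m ^ 2) z * (PI / Csin (PI * row alpha z m)))%C
      by (unfold csc_term, Cdiv; ring).
    revert H. apply has_sum_ext. intros n. unfold lim_term, weight. cbn [fst snd].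
    rewrite sg_add, RtoC_mult. ring. }
  assert (HF := has_sum_fubini _ _ _ HS Hrow).
  assert (HN := has_sum_scal PI _ _ (eta_NN l p z Ha Hz)). fold alpha in HN.
  rewrite <- (has_sum_unique _ _ _ HF HN).
  apply (has_sum_lim (Rbar_locally p_infty) (sym_term alpha z) lim_term _ _ S Hg); auto.
  exists (Im z / 3). intros s Hs. now apply sym_term_has_sum.
Qed.

(** * The non-holomorphic part *)

Lemma is_RInt_Cderive (F f : R -> C) a b : a <= b ->
  (forall t, a <= t <= b -> Cis_derive F t (f t)) ->
  (forall t, a <= t <= b -> Clim (locally t) f (f t)) ->
  @is_RInt C_R_NormedModule f a b (F b - F a)%C.
Proof.
  intros Hab HD HC.
  assert (H1 : is_RInt (fun t => Re (f t)) a b (Re (F b) - Re (F a))).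
  { apply (is_RInt_derive (V := R_CompleteNormedModule) (fun t => Re (F t)) (fun t => Re (f t)) a b);
      rewrite Rmin_left, Rmax_right by lra; intros t Ht.
    - apply HD, Ht.
    - apply (Clim_Re (locally t)), HC, Ht. }
  assert (H2 : is_RInt (fun t => Im (f t)) a b (Im (F b) - Im (F a))).
  { apply (is_RInt_derive (V := R_CompleteNormedModule) (fun t => Im (F t)) (fun t => Im (f t)) a b);
      rewrite Rmin_left, Rmax_right by lra; intros t Ht.
    - apply HD, Ht.
    - apply (Clim_Im (locally t)), HC, Ht. }
  exact (is_RInt_fct_extend_pair (U := R_NormedModule) (V := R_NormedModule) f a b _ _ H1 H2).
Qed.

Lemma Clim_filterlim {T} (F : (T -> Prop) -> Prop) {FF : Filter F} (u : T -> C) (l : C) :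
  Clim F u l -> filterlim u F (@locally (NormedModule.UniformSpace _ C_R_NormedModule) l).
Proof.
  intros H. apply (filterlim_locally (U := NormedModule.UniformSpace _ C_R_NormedModule)).
  intros eps. generalize (H eps (cond_pos eps)). apply filter_imp. intros t Ht. split.
  - eapply Rle_lt_trans; [|exact Ht]. exact (re_le_Cmod (u t - l)).
  - eapply Rle_lt_trans; [|exact Ht]. exact (im_le_Cmod (u t - l)).
Qed.

Lemma RInt_gen_Cderive (F f : R -> C) a L :
  (forall t, a <= t -> Cis_derive F t (f t)) ->
  (forall t, a <= t -> Clim (locally t) f (f t)) ->
  Clim (Rbar_locally p_infty) F L ->
  @is_RInt_gen C_R_NormedModule f (at_point a) (Rbar_locally p_infty) (L - F a)%C.
Proof.
  intros HD HC HL P HP.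
  assert (HF : Clim (Rbar_locally p_infty) (fun b => F b - F a)%C (L - F a)%C).
  { apply Clim_minus; [apply _|exact HL|apply Clim_const, _]. }
  assert (Hev := Clim_filterlim (Rbar_locally p_infty) _ _ HF P HP).
  apply (Filter_prod _ _ _ (fun x => x = a) (fun b => a <= b /\ P (F b - F a)%C)).
  - reflexivity.
  - apply filter_and; [|exact Hev]. exists a. intros b Hb; lra.
  - intros x b -> [Hb Hpb]. exists (F b - F a)%C. split; [|exact Hpb]. simpl.
    apply is_RInt_Cderive; auto; intros t Ht; [apply HD|apply HC]; lra.
Qed.

Lemma Csqrt_pos x : 0 <= x -> Csqrt (RtoC x) = RtoC (sqrt x).
Proof.
  intros Hx. unfold Csqrt. rewrite Cmod_R, Rabs_pos_eq by exact Hx. unfold RtoC; simpl.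
  replace ((x + x) / 2) with x by field. replace ((x - x) / 2) with 0 by field.
  rewrite sqrt_0, Rmult_0_r. reflexivity.
Qed.

(** On the vertical half-line through [- Re z + i t] the substitution [s = (t + Im z) / 3] turns
    [dPsi] into the integrand of [T1], up to a constant factor; the starting point [t = Im z] is
    [s = 2 Im z / 3]. *)
Lemma eta_T1 l p z : not_integer (ratio l p) -> 0 < Im z ->
  (eta z * T1 l p z)%C =
  (eta z * NN l p z - / RtoC PI * Psi (ratio l p) z (2 * Im z / 3))%C.
Proof.
  intros Ha Hz. set (alpha := ratio l p) in *. pose proof PI_RGT_0 as HP.
  destruct z as [x y]. cbn [Im snd] in Hz |- *. change (Im (x, y)) with y in *.
  set (z := (x, y) : C) in *.
  assert (Heta : eta z <> 0%C) by (apply eta_neq0; exact Hz).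
  assert (HPI : RtoC PI <> 0%C) by (apply RtoC_neq0; lra).
  assert (H3 : 0 < sqrt 3) by (apply sqrt_lt_R0; lra).
  assert (H33 : sqrt 3 * sqrt 3 = 3) by (apply sqrt_sqrt; lra).
  set (c := (Ci * RtoC (sqrt 3) / (PI * eta z))%C).
  set (u := fun t : R => (t + y) / 3).
  set (F := fun t => (c * Psi alpha z (u t))%C).
  set (f := fun t => (c * (RtoC (/ 3) * dPsi alpha z (u t)))%C).
  set (I := fun t : R => (Ci * (Theta1 l p (- x, t)%R / Csqrt (- Ci * ((- x, t)%R + z))))%C).
  assert (Hu : forall t, 0 < t -> Im z / 3 < u t) by (intros t Ht; unfold u, z; simpl; lra).
  assert (HfI : forall t, 0 < t -> f t = I t).
  { intros t Ht. unfold f, I, alpha. rewrite dPsi_Theta1 by auto.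
    replace (- Re z) with (- x) by reflexivity.
    replace (3 * u t - Im z) with t by (unfold u, z; simpl; field).
    replace (- Ci * ((- x, t)%R + z))%C with (RtoC (t + y)).
    2:{ unfold z, Ci, Cmult, Cplus, Copp, RtoC; simpl. f_equal; ring. }
    rewrite Csqrt_pos by lra. unfold u. rewrite sqrt_div_alt by lra.
    assert (Hq : 0 < sqrt (t + y)) by (apply sqrt_lt_R0; lra).
    replace (PI / (sqrt (t + y) / sqrt 3)) with (PI * sqrt 3 / sqrt (t + y)) by (field; lra).
    unfold c. rewrite RtoC_div, RtoC_mult, RtoC_inv by lra.
    set (T := Theta1 l p (- x, t)%R). set (r := RtoC (sqrt (t + y))).
    assert (Hr : r <> 0%C) by (apply RtoC_neq0; lra).
    replace (Ci * RtoC (sqrt 3) / (PI * eta z) * (/ 3 * (PI * RtoC (sqrt 3) / r * (eta z * T))))%C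
      with ((RtoC (sqrt 3) * RtoC (sqrt 3)) / 3 * (Ci * (T / r)))%C
      by (field; repeat split; auto; apply RtoC_neq0; lra).
    rewrite <- RtoC_mult, H33. field. auto. }
  assert (HF : @is_RInt_gen C_R_NormedModule f (at_point y) (Rbar_locally p_infty)
     (c * (PI * (eta z * NN l p z)) - F y)%C).
  { apply RInt_gen_Cderive.
    - intros t Ht. unfold F, f. apply Cis_derive_scal.
      apply (Cis_derive_comp (Psi alpha z) u t).
      + unfold u. auto_derive; auto. field.
      + apply Psi_derive; auto. apply Hu; lra.
    - intros t Ht. unfold f. apply Clim_scal; [apply _|]. apply Clim_scal; [apply _|].
      apply (Clim_comp (locally t) (locally (u t)) u (dPsi alpha z)).
      + apply (continuity_pt_filterlim u t). apply derivable_continuous_pt. exists (/ 3).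
        apply is_derive_Reals. unfold u. auto_derive; auto. field.
      + apply dPsi_continuous; auto. apply Hu; lra.
    - unfold F. apply Clim_scal; [apply _|].
      apply (Clim_comp (Rbar_locally p_infty) (Rbar_locally p_infty) u (Psi alpha z)).
      + intros P [M HM]. exists (3 * M - y). intros t Ht. apply HM. unfold u. lra.
      + now apply Psi_limit. }
  assert (HI : Cint_to_ioo (fun tau => Theta1 l p tau / Csqrt (- Ci * (tau + z)))%C (- Cconj z)
    = (c * (PI * (eta z * NN l p z)) - F y)%C).
  { unfold Cint_to_ioo.
    replace (Re (- Cconj z)) with (- x) by reflexivity.
    replace (Im (- Cconj z)) with y by (unfold z; simpl; ring).
    apply (is_RInt_gen_unique (V := C_R_CompleteNormedModule)).
    apply (is_RInt_gen_ext (V := C_R_NormedModule) f); [|exact HF].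
    apply (Filter_prod _ _ _ (fun a => a = y) (fun b => y <= b)).
    - reflexivity.
    - exists y. intros b Hb; lra.
    - intros a b -> Hb t Ht. simpl in Ht. rewrite Rmin_left, Rmax_right in Ht by lra.
      apply HfI. lra. }
  unfold T1. rewrite HI. unfold F, c, u.
  replace ((y + y) / 3) with (2 * y / 3) by field.
  set (P0 := Psi alpha z (2 * y / 3)). set (W := NN l p z).
  replace (eta z * (- (Ci / RtoC (sqrt 3)) * (Ci * RtoC (sqrt 3) / (PI * eta z) * (PI * (eta z * W)) -
     Ci * RtoC (sqrt 3) / (PI * eta z) * P0)))%C
   with (- (Ci * Ci) * (eta z * W - / PI * P0))%C
   by (field; repeat split; auto; apply RtoC_neq0; lra).
  rewrite Ci_sq. ring.
Qed.

Lemma FF1_Psi l p z : not_integer (ratio l p) -> 0 < Im z ->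
  FF1 l p z = (/ RtoC PI * Psi (ratio l p) z (2 * Im z / 3))%C.
Proof.
  intros Ha Hz. unfold FF1, GG1.
  replace (eta z * (NN l p z - T1 l p z))%C with (eta z * NN l p z - eta z * T1 l p z)%C by ring.
  rewrite eta_T1 by auto. ring.
Qed.

(** * Modularity *)

Lemma sg_even m n : Z.even m = Z.even n -> sg m = sg n.
Proof. unfold sg. now intros ->. Qed.

Lemma Cexp_3PI_Z k : Cexp (3 * PI * Ci * RtoC (IZR k)) = RtoC (sg k).
Proof.
  replace (3 * PI * Ci * RtoC (IZR k))%C with (Ci * PI * RtoC (IZR (3 * k)))%C
    by (rewrite mult_IZR, RtoC_mult; ring).
  rewrite Cexp_PI_Z. f_equal. apply sg_even. rewrite Z.even_mul. reflexivity.
Qed.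

(** At the endpoint the holomorphic weight and the Gaussian combine into a Gaussian of the
    invariant [|w|^2 / Im z]: with [y = Im z], the exponent [- 3 PI w^2 / (2 y)] differs from
    [- 3 PI |w|^2 / (2 y)] by [- 3 PI i m w], because [Im w = m y]. *)
Lemma lterm_invariant alpha z m n : 0 < Im z ->
  lterm alpha z (2 * Im z / 3) (m, n) =
  (RtoC (sg (m * n + m + n)) * Cexp (- (3 * PI * Ci * RtoC (alpha * IZR m)))
   * (RtoC (exp (- (3 * PI / 2 * (Cmod (lat alpha z (m, n)) ^ 2 / Im z)))) / lat alpha z (m, n)))%C.
Proof.
  intros Hz. unfold lterm, weight, gauss. cbn [fst snd].
  assert (Him : Im (lat alpha z (m, n)) = IZR m * Im z) by apply lat_Im.
  assert (Hw : lat alpha z (m, n) = (IZR m * z + alpha + IZR n)%C) by reflexivity.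
  set (w := lat alpha z (m, n)) in *.
  assert (E : (qpow (3 / 2 * IZR m ^ 2) z * Cexp (RtoC (- (PI / (2 * Im z / 3))) * (w * w)))%C =
    (RtoC (sg (m * n)) * Cexp (- (3 * PI * Ci * RtoC (alpha * IZR m))) *
      RtoC (exp (- (3 * PI / 2 * (Cmod w ^ 2 / Im z)))))%C).
  { rewrite <- sg_opp, <- Cexp_3PI_Z, <- Cexp_RtoC. unfold qpow. rewrite <- !Cexp_add. f_equal.
    assert (Hm : RtoC (- (3 * PI / 2 * (Cmod w ^ 2 / Im z))) =
       (RtoC (- (PI / (2 * Im z / 3))) * (w * w) + 3 * PI * Ci * RtoC (IZR m) * w)%C).
    { rewrite Cmod2_alt. destruct w as [a b]. simpl in Him. subst b.
      unfold Cplus, Cmult, RtoC, Ci, Re, Im; simpl. f_equal; field; change (snd z) with (Im z); lra. }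
    rewrite Hm, Hw, opp_IZR, !mult_IZR, (RtoC_mult alpha), (RtoC_opp (IZR m * IZR n)),
      !RtoC_mult, (RtoC_div 3 2) by lra.
    simpl (IZR m ^ 2). rewrite Rmult_1_r, !RtoC_mult. field. }
  rewrite !sg_add, (RtoC_mult (_ * _) (sg n)), (RtoC_mult (sg (m * n))), (RtoC_mult (sg m)).
  transitivity (RtoC (sg m) * RtoC (sg n) *
     (qpow (3 / 2 * IZR m ^ 2) z * Cexp (RtoC (- (PI / (2 * Im z / 3))) * (w * w))) / w)%C.
  - unfold Cdiv. ring.
  - rewrite E. unfold Cdiv. ring.
Qed.

(** The sign [(-1)^(mn + m + n)] comes from a quadratic form modulo 2 that vanishes only at the
    origin, hence is invariant under SL_2. A translation by [(m0, n0)] changes such a form by its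
    value at [(m0, n0)] and by the symplectic pairing. *)
Lemma theta_sign_parity a b c d m n m0 n0 : (a * d - b * c = 1)%Z ->
  let M := (m * a + n * c + m0)%Z in let N := (m * b + n * d + n0)%Z in
  sg (m * n + m + n) * sg (m0 * (N - n0) - n0 * M) = sg m0 * sg n0 * sg (M * N + M + N).
Proof.
  intros Hdet M N. rewrite <- !sg_add. apply sg_even.
  assert (H : Z.even (a * d - b * c) = false) by now rewrite Hdet.
  unfold M, N. clear Hdet M N.
  repeat rewrite ?Z.even_add, ?Z.even_sub, ?Z.even_mul in *.
  destruct (Z.even a), (Z.even b), (Z.even c), (Z.even d), (Z.even m), (Z.even n),
    (Z.even m0), (Z.even n0); simpl in *; congruence.
Qed.

Lemma cocycle_neq0 c d z : (c <> 0 \/ d <> 0)%Z -> 0 < Im z ->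
  (RtoC (IZR c) * z + RtoC (IZR d))%C <> 0%C.
Proof.
  intros H Hz E. assert (Him := f_equal Im E). assert (Hre := f_equal Re E).
  destruct z as [x y]. simpl in *.
  assert (Hc : IZR c = 0) by (apply Rmult_eq_reg_r with y; lra).
  assert (Hd : IZR d = 0) by (rewrite Hc in Hre; lra).
  apply eq_IZR in Hc, Hd. tauto.
Qed.

Lemma Im_moebius a b c d z : (a * d - b * c = 1)%Z -> 0 < Im z ->
  Im ((RtoC (IZR a) * z + RtoC (IZR b)) / (RtoC (IZR c) * z + RtoC (IZR d)))
  = Im z / Cmod (RtoC (IZR c) * z + RtoC (IZR d)) ^ 2.
Proof.
  intros Hdet Hz.
  assert (HD : (RtoC (IZR c) * z + RtoC (IZR d))%C <> 0%C) by (apply cocycle_neq0; [nia|auto]).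
  assert (HD2 : 0 < Cmod (RtoC (IZR c) * z + RtoC (IZR d)) ^ 2).
  { apply pow_lt, Cmod_gt_0, HD. }
  apply (f_equal IZR) in Hdet. rewrite minus_IZR, !mult_IZR in Hdet.
  transitivity ((IZR a * IZR d - IZR b * IZR c) * Im z
    / Cmod (RtoC (IZR c) * z + RtoC (IZR d)) ^ 2); [|now rewrite Hdet, Rmult_1_l].
  rewrite Cmod2_alt in *. destruct z as [x y].
  unfold Cdiv, Cinv, Cmult, Cplus, RtoC, Re, Im in *; simpl in *.
  field. intros E. lra.
Qed.

(** The hypotheses on [alpha] and [beta] say that [alpha (c z + d)] is [beta] up to the lattice
    vector [m0 z + n0]. *)
Lemma lterm_modular a b c d alpha beta m0 n0 z m n :
  (a * d - b * c = 1)%Z -> 0 < Im z -> not_integer beta ->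
  alpha * IZR c = IZR m0 -> alpha * IZR d = IZR n0 + beta ->
  let D := (RtoC (IZR c) * z + RtoC (IZR d))%C in
  let z' := ((RtoC (IZR a) * z + RtoC (IZR b)) / D)%C in
  lterm alpha z' (2 * Im z' / 3) (m, n) =
  (D * (Cexp (RtoC (3 * PI) * Ci * RtoC (IZR m0 * (alpha * IZR d))) * RtoC (sg m0) * RtoC (sg n0)) *
   lterm beta z (2 * Im z / 3) (m * a + n * c + m0, m * b + n * d + n0)%Z)%C.
Proof.
  intros Hdet Hz Hb Hc Hd D z'.
  assert (HD : D <> 0%C) by (apply cocycle_neq0; [nia|auto]).
  assert (HDp : 0 < Cmod D) by now apply Cmod_gt_0.
  assert (Hz' : Im z' = Im z / Cmod D ^ 2) by now apply Im_moebius.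
  assert (Hz'0 : 0 < Im z') by (rewrite Hz'; apply Rdiv_lt_0_compat; [auto|apply pow_lt; auto]).
  rewrite !lterm_invariant by auto.
  set (M := (m * a + n * c + m0)%Z). set (N := (m * b + n * d + n0)%Z).
  set (W := lat beta z (M, N)).
  assert (HW : W <> 0%C) by now apply lat_neq0.
  assert (Hw : lat alpha z' (m, n) = (W / D)%C).
  { assert (Ec : (RtoC alpha * RtoC (IZR c))%C = RtoC (IZR m0)) by (rewrite <- RtoC_mult; now f_equal).
    assert (Ed : (RtoC alpha * RtoC (IZR d))%C = (RtoC (IZR n0) + RtoC beta)%C)
      by (rewrite <- RtoC_mult, <- RtoC_plus; now f_equal).
    unfold lat, row, W, z'. cbn [fst snd]. unfold lat, row. cbn [fst snd]. unfold M, N.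
    rewrite !plus_IZR, !mult_IZR, !RtoC_plus, !RtoC_mult, <- Ec.
    replace (RtoC (IZR n0)) with (RtoC alpha * RtoC (IZR d) - RtoC beta)%C by (rewrite Ed; ring).
    assert (ED : D = (RtoC (IZR c) * z + RtoC (IZR d))%C) by reflexivity.
    replace ((RtoC (IZR m) * ((RtoC (IZR a) * z + RtoC (IZR b)) / D) + RtoC alpha + RtoC (IZR n)))%C
      with ((RtoC (IZR m) * (RtoC (IZR a) * z + RtoC (IZR b)) + (RtoC alpha + RtoC (IZR n)) * D) / D)%C
      by (field; auto).
    rewrite ED at 1. unfold Cdiv. f_equal. ring. }
  rewrite Hw.
  assert (Hmod : Cmod (W / D) ^ 2 / Im z' = Cmod W ^ 2 / Im z).
  { rewrite Cmod_div, Hz' by auto. field. split; lra. }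
  rewrite Hmod.
  (* the symplectic pairing of the translation with the image point is the parity that
     theta_sign_parity needs to compare the quadratic signs *)
  assert (Hphase : (Cexp (- (3 * PI * Ci * RtoC (alpha * IZR m))))%C =
    (Cexp (RtoC (3 * PI) * Ci * RtoC (IZR m0 * (alpha * IZR d))) *
     RtoC (sg (m0 * (N - n0) - n0 * M)) * Cexp (- (3 * PI * Ci * RtoC (beta * IZR M))))%C).
  { rewrite <- Cexp_3PI_Z, <- !Cexp_add. f_equal.
    assert (Hr : - (alpha * IZR m) = IZR m0 * (alpha * IZR d) + IZR (m0 * (N - n0) - n0 * M)
       - beta * IZR M).
    { apply (f_equal IZR) in Hdet. rewrite minus_IZR, !mult_IZR in Hdet.
      unfold M, N. rewrite !minus_IZR, !mult_IZR, minus_IZR, !plus_IZR, !mult_IZR.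
      replace beta with (alpha * IZR d - IZR n0) by lra. rewrite <- Hc.
      assert (Hx : alpha * IZR m = alpha * IZR m * (IZR a * IZR d - IZR b * IZR c)) by (rewrite Hdet; ring).
      rewrite Hx. ring. }
    replace (- (3 * PI * Ci * RtoC (alpha * IZR m)))%C with (3 * PI * Ci * RtoC (- (alpha * IZR m)))%C
      by (rewrite RtoC_opp; ring).
    rewrite Hr, RtoC_minus, RtoC_plus, (RtoC_mult 3). ring. }
  rewrite Hphase.
  assert (Hs := theta_sign_parity a b c d m n m0 n0 Hdet). cbv zeta in Hs. fold M N in Hs.
  set (e := RtoC (exp (- (3 * PI / 2 * (Cmod W ^ 2 / Im z))))).
  set (P1 := Cexp (RtoC (3 * PI) * Ci * RtoC (IZR m0 * (alpha * IZR d)))).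
  set (P2 := Cexp (- (3 * PI * Ci * RtoC (beta * IZR M)))).
  transitivity (RtoC (sg (m * n + m + n) * sg (m0 * (N - n0) - n0 * M)) * P1 * P2 * (D * e / W))%C.
  - rewrite RtoC_mult. field. auto.
  - rewrite Hs, !RtoC_mult. unfold Cdiv. ring.
Qed.

(** The terms correspond under the bijection of the index lattice given by the matrix and the
    translation by [(m0, n0)]. *)
Lemma Psi_modular a b c d alpha beta m0 n0 z :
  (a * d - b * c = 1)%Z -> 0 < Im z -> not_integer alpha -> not_integer beta ->
  alpha * IZR c = IZR m0 -> alpha * IZR d = IZR n0 + beta ->
  let D := (RtoC (IZR c) * z + RtoC (IZR d))%C in
  let z' := ((RtoC (IZR a) * z + RtoC (IZR b)) / D)%C in
  Psi alpha z' (2 * Im z' / 3) =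
  (D * (Cexp (RtoC (3 * PI) * Ci * RtoC (IZR m0 * (alpha * IZR d))) * RtoC (sg m0) * RtoC (sg n0)) *
   Psi beta z (2 * Im z / 3))%C.
Proof.
  intros Hdet Hz Ha Hb Hc Hd D z'.
  assert (HD : D <> 0%C) by (apply cocycle_neq0; [nia|auto]).
  assert (Hz'0 : 0 < Im z').
  { unfold z', D. rewrite Im_moebius by auto. apply Rdiv_lt_0_compat; auto.
    apply pow_lt, Cmod_gt_0, HD. }
  assert (H := Psi_has_sum beta z (2 * Im z / 3) Hb Hz ltac:(lra)).
  apply (has_sum_bij (fun p : Z * Z => (fst p * a + snd p * c + m0, fst p * b + snd p * d + n0)%Z)
    (fun p => (d * (fst p - m0) - c * (snd p - n0), a * (snd p - n0) - b * (fst p - m0))%Z)) in H.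
  - apply (has_sum_scal (D * (Cexp (RtoC (3 * PI) * Ci * RtoC (IZR m0 * (alpha * IZR d)))
      * RtoC (sg m0) * RtoC (sg n0)))%C) in H.
    apply (has_sum_unique (lterm alpha z' (2 * Im z' / 3))).
    + apply Psi_has_sum; auto. lra.
    + revert H. apply has_sum_ext. intros [m n]. cbn [fst snd]. symmetry.
      now apply lterm_modular.
  - intros [M N]. cbn [fst snd]. f_equal.
    + transitivity ((M - m0) * (a * d - b * c) + m0)%Z; [ring|rewrite Hdet; ring].
    + transitivity ((N - n0) * (a * d - b * c) + n0)%Z; [ring|rewrite Hdet; ring].
  - intros [m n]. cbn [fst snd]. f_equal.
    + transitivity (m * (a * d - b * c))%Z; [ring|rewrite Hdet; ring].
    + transitivity (n * (a * d - b * c))%Z; [ring|rewrite Hdet; ring].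
Qed.

Lemma ratio_not_integer l p : (0 < l < p)%Z -> not_integer (ratio l p).
Proof.
  intros H k E. unfold ratio in E.
  assert (Hp : IZR p <> 0) by (apply not_0_IZR; lia).
  assert (E2 : l = (k * p)%Z).
  { apply eq_IZR. rewrite mult_IZR, <- E. field. exact Hp. }
  assert (0 < k)%Z by (apply Z.mul_pos_cancel_r with p; lia).
  assert (1 * p <= k * p)%Z by (apply Z.mul_le_mono_nonneg_r; lia). lia.
Qed.

Theorem theorem4p1 (p l : Z) (Hp : prime p) (Hp3 : (3 < p)%Z)
    (Hl : (1 <= l <= p - 1)%Z) (A : SL2Z) (HA : Gamma0 p A)
    (z : C) (Hz : (0 < Im z)%R) :
  slash 1 (FF1 l p) A z = (mu p A l * FF1 ((sl_d A * l) mod p)%Z p z)%C.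
Proof.
  destruct A as [a b c d Hdet]. unfold Gamma0 in HA. cbn [sl_c] in HA.
  unfold slash, mu. cbn [sl_a sl_b sl_c sl_d].
  set (r := ((d * l) mod p)%Z).
  assert (Hpd : ~ (p | d)%Z).
  { intros Hd. assert (H1 : (p | 1)%Z).
    { rewrite <- Hdet. apply Z.divide_sub_r.
      - now apply Z.divide_mul_r.
      - now apply Z.divide_mul_r. }
    apply Z.divide_1_r in H1. lia. }
  assert (Hpl : ~ (p | l)%Z).
  { intros H. apply Z.divide_pos_le in H; lia. }
  assert (Hr : (0 < r < p)%Z).
  { assert (H := Z.mod_pos_bound (d * l) p ltac:(lia)). fold r in H.
    assert (r <> 0)%Z; [|lia]. intros E. apply Z.mod_divide in E; [|lia].
    apply prime_mult in E; [tauto|exact Hp]. }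
  assert (Ha : not_integer (ratio l p)) by (apply ratio_not_integer; lia).
  assert (Hb : not_integer (ratio r p)) by now apply ratio_not_integer.
  assert (HpR : IZR p <> 0) by (apply not_0_IZR; lia).
  (* the translation that brings (c l / p, d l / p) back to (0, (d l mod p) / p) *)
  assert (Hc : ratio l p * IZR c = IZR (c * l / p)).
  { destruct HA as [q Hq]. rewrite Hq.
    replace (q * p * l)%Z with (q * l * p)%Z by ring. rewrite Z.div_mul by lia.
    unfold ratio. rewrite !mult_IZR. field. exact HpR. }
  assert (Hd : ratio l p * IZR d = IZR (d * l / p) + ratio r p).
  { assert (E := Z.div_mod (d * l) p ltac:(lia)). fold r in E.
    apply (f_equal IZR) in E. rewrite plus_IZR, !mult_IZR in E. unfold ratio.
    apply Rmult_eq_reg_r with (IZR p); [|exact HpR]. field_simplify; [|exact HpR|exact HpR]. lra. }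
  set (D := (RtoC (IZR c) * z + RtoC (IZR d))%C).
  assert (HD : D <> 0%C) by (apply cocycle_neq0; [nia|auto]).
  assert (HM := Psi_modular a b c d _ _ _ _ z Hdet Hz Ha Hb Hc Hd). cbv zeta in HM. fold D in HM.
  set (z' := ((RtoC (IZR a) * z + RtoC (IZR b)) / D)%C) in *.
  assert (Hz' : 0 < Im z').
  { unfold z', D. rewrite Im_moebius by auto. apply Rdiv_lt_0_compat; auto.
    apply pow_lt, Cmod_gt_0, HD. }
  rewrite (FF1_Psi l p z' Ha Hz'), (FF1_Psi r p z Hb Hz), HM.
  rewrite !sg_powerRZ.
  replace (IZR (c * l / p) * (ratio l p * IZR d)) with (IZR c * IZR d * IZR l ^ 2 / IZR p ^ 2).
  2:{ rewrite <- Hc. unfold ratio. field. exact HpR. }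
  simpl Cpow. field. split; [apply RtoC_neq0; pose proof PI_RGT_0; lra|exact HD].
Qed.
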